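(* Let $N\ge 1$, let $a_1,\dots,a_{N-1}>0$, $b_1,\dots,b_N\in\mathbb{R}$, let $A$ be the associated $N\times N$ Jacobi matrix, and let $T>0$. Let $B_N=\mathbb{F}U^T$ be the set of Fourier images of the reachable set at time $T$ of the dynamical system $u_{tt}+Au=(f,0,\dots,0)^{\mathsf T}$, $u(0)=u_t(0)=0$, equipped with the inner product defined through the connecting operator, $$(H,G)_{B_N}:=(C^Th,g)_{\mathcal F^T},\qquad H=\mathbb{F}u^h(T),\ G=\mathbb{F}u^g(T),\ h,g\in\mathcal F_1^T$$ (all objects as defined in the context). Then $B_N$ is a de Branges space: there exists a Hermite-Biehler function $E$ such that $B_N=B(E)$ as sets of entire functions and $(H,G)_{B_N}=[H,G]_{B(E)}$ for all $H,G\in B_N$. Moreover, the reproducing kernel of $B_N$ is obtained from a control problem: for every $z\in\mathbb{C}$, if $j_z\in\mathcal F_1^T$ is the unique control in $\mathcal F_1^T$ with $u^{j_z}_k(T)=\overline{\phi_k(z)}$ for $k=1,\dots,N$, and $J_z:=\mathbb{F}u^{j_z}(T)$, then $(G,J_z)_{B_N}=G(z)$ for all $G\in B_N$.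
   Context: **Jacobi matrix.** $A$ is the real symmetric tridiagonal $N\times N$ matrix with diagonal entries $b_1,\dots,b_N$ and off-diagonal entries $A_{n,n+1}=A_{n+1,n}=a_n>0$, $n=1,\dots,N-1$. Its eigenvalues $\lambda_1,\dots,\lambda_N$ are real and distinct. **Polynomials.** $\phi_1,\dots,\phi_N$ are the polynomials in $\lambda$ determined by $\phi_1=1$, $a_1\phi_2+b_1\phi_1=\lambda\phi_1$, and $a_n\phi_{n+1}+a_{n-1}\phi_{n-1}+b_n\phi_n=\lambda\phi_n$ for $2\le n\le N-1$. **Dynamical system.** The space of controls is $\mathcal F^T=L_2(0,T;\mathbb{C})$ with $(f,g)_{\mathcal F^T}=\int_0^T f(t)\overline{g(t)}\,dt$. The space of states is $\mathcal H^N=\mathbb{C}^N$ with $(a,b)_{\mathcal H^N}=\sum_{k=1}^N a_k\overline{b_k}$. For $f\in\mathcal F^T$, $u^f=(u^f_1,\dots,u^f_N)$ is the $\mathbb{C}^N$-valued solution on $[0,T]$ of $u_{tt}(t)+Au(t)=(f(t),0,\dots,0)^{\mathsf T}$, $u(0)=u_t(0)=0$ (the equation holding for almost every $t$, with $u$ and $u_t$ absolutely continuous). The control operator is $W^T:\mathcal F^T\to\mathcal H^N$, $W^Tf=u^f(T)$. The reachable set is $U^T=W^T\mathcal F^T$. The connecting operator is $C^T=(W^T)^*W^T:\mathcal F^T\to\mathcal F^T$, so that $(C^Tf,g)_{\mathcal F^T}=(u^f(T),u^g(T))_{\mathcal H^N}$. **The subspace $\mathcal F_1^T$.** Let $S(t,\lambda)=\sin(\sqrt{\lambda}\,t)/\sqrt{\lambda}$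 for $\lambda>0$, $S(t,\lambda)=\sinh(\sqrt{|\lambda|}\,t)/\sqrt{|\lambda|}$ for $\lambda<0$, $S(t,0)=t$. Then $\mathcal F_1^T$ is the complex linear span of the functions $t\mapsto S(T-t,\lambda_k)$, $k=1,\dots,N$, in $\mathcal F^T$. It is known that $W^T$ maps $\mathcal F_1^T$ isomorphically onto $\mathcal H^N$; hence $U^T=W^T\mathcal F_1^T=\mathbb{C}^N$, and every element of $B_N$ is $\mathbb{F}u^h(T)$ for a unique $h\in\mathcal F_1^T$. **Fourier transform.** For $c=(c_1,\dots,c_N)\in\mathbb{C}^N$, $(\mathbb{F}c)(\lambda)=\sum_{k=1}^N c_k\phi_k(\lambda)$, a polynomial, regarded as an entire function of $\lambda$. Thus $B_N=\mathbb{F}U^T=\operatorname{Lin}_{\mathbb{C}}\{\phi_1,\dots,\phi_N\}$ is the set of complex polynomials of degree at most $N-1$. **De Branges spaces.** Let $\mathbb{C}_+=\{z:\operatorname{Im}z>0\}$. An entire function $E$ is a Hermite-Biehler function if $|E(z)|>|E(\overline z)|$ for all $z\in\mathbb{C}_+$. For entire $F$ put $F^\#(z)=\overline{F(\overline z)}$. The Hardy space $H_2$ consists of functions $f$ holomorphic in $\mathbb{C}_+$ with $\sup_{y>0}\int_{-\infty}^\infty|f(x+iy)|^2\,dx<\infty$. For a Hermite-Biehler function $E$, $$B(E)=\Big\{F\text{ entire}:\ \tfrac{F}{E},\tfrac{F^\#}{E}\in H_2\Big\},\qquad [F,G]_{B(E)}=\frac1\pi\int_{\mathbb{R}}F(\lambda)\overline{G(\lambda)}\frac{d\lambda}{|E(\lambda)|^2}.$$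 *)

(* Defs.v *)
From HB Require Import structures.
From mathcomp Require Import all_boot all_order all_algebra.
From mathcomp Require Import all_classical all_reals all_analysis.
From mathcomp Require Import complex.

Set Implicit Arguments.
Unset Strict Implicit.
Unset Printing Implicit Defensive.

Import Order.TTheory GRing.Theory Num.Theory.
Import numFieldNormedType.Exports.

Local Open Scope classical_set_scope.
Local Open Scope complex_scope.
Local Open Scope ring_scope.

(* Complex-valued functions of a real variable are handled through their real
   and imaginary parts; `normc z : R` is the modulus of z. *)

Definition cintegral (R : realType) (D : set R) (f : R -> R[i]) : R[i] :=
  Rintegral lebesgue_measure D (fun t => complex.Re (f t)) +i*
  Rintegral lebesgue_measure D (fun t => complex.Im (f t)).

(** * The Jacobi matrix and its polynomials

    The sequences a, b are indexed from 1 as in the text: only the values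
    b 1, ..., b N and a 1, ..., a (N-1) are relevant.  Matrix and vector
    entries are indexed by 'I_N, so the entry of (mathematical) index n has
    ordinal index n - 1. *)

Definition jacobi (R : realType) (N : nat) (a b : nat -> R) : 'M[R]_N :=
  \matrix_(i < N, j < N)
    if i == j then b i.+1
    else if j == i.+1 :> nat then a i.+1
    else if i == j.+1 :> nat then a j.+1
    else 0.

(* With the dummy value phi 0 = 0, the recursion at n = 1 is
   a_1 phi_2 + b_1 phi_1 = 'X phi_1. *)
Fixpoint phi (R : realType) (a b : nat -> R) (n : nat) : {poly R} :=
  match n with
  | 0 => 0
  | m.+1 =>
      match m with
      | 0 => 1
      | l.+1 =>
          (a m)^-1 *: (('X - (b m)%:P) * phi a b m - a l *: phi a b l)
      end
  end.

Definition phiC (R : realType) (a b : nat -> R) (n : nat) (z : R[i]) : R[i] :=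
  (map_poly (real_complex R) (phi a b n)).[z].

(** * The spaces of controls and states *)

(* Controls are represented by functions on R; only their restriction to
   ]0, T[, up to equality almost everywhere, is meaningful. *)
Definition ae_eq_on (R : realType) (T : R) (f g : R -> R[i]) : Prop :=
  {ae (@lebesgue_measure R), forall t, `]0, T[%classic t -> f t = g t}.

Definition control_space (R : realType) (T : R) : set (R -> R[i]) :=
  [set f : R -> R[i] |
    measurable_fun `]0, T[ (fun t => complex.Re (f t)) /\
    measurable_fun `]0, T[ (fun t => complex.Im (f t)) /\
    (\int[lebesgue_measure]_(t in `]0%R, T[) ((Normc.normc (f t)) ^+ 2)%:E
      < +oo)%E].

Definition control_inner (R : realType) (T : R) (f g : R -> R[i]) : R[i] :=
  cintegral `]0, T[ (fun t => f t * (g t)^*).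

Definition state_inner (R : realType) (N : nat) (c d : 'cV[R[i]]_N) : R[i] :=
  \sum_(k < N) c k 0 * (d k 0)^*.

(** * The dynamical system *)

Definition abs_continuous (R : realType) (x y : R) (g : R -> R) : Prop :=
  forall e : R, 0 < e -> exists2 d : R, 0 < d &
    forall (n : nat) (l r : 'I_n -> R),
      (forall i, x <= l i /\ l i <= r i /\ r i <= y) ->
      trivIset setT (fun i => `]l i, r i[%classic) ->
      \sum_(i < n) (r i - l i) < d ->
      \sum_(i < n) `|g (r i) - g (l i)| < e.

Definition abs_continuousC (R : realType) (x y : R) (g : R -> R[i]) : Prop :=
  abs_continuous x y (fun t => complex.Re (g t)) /\
  abs_continuous x y (fun t => complex.Im (g t)).

Definition has_derivC (R : realType) (g : R -> R[i]) (t : R) (d : R[i]) : Prop :=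
  is_derive t (1 : R) (fun s => complex.Re (g s)) (complex.Re d) /\
  is_derive t (1 : R) (fun s => complex.Im (g s)) (complex.Im d).

(* The column (x, 0, ..., 0)^T. *)
Definition forcing (R : realType) (N : nat) (x : R[i]) : 'cV[R[i]]_N :=
  \col_(k < N) if k == 0 :> nat then x else 0.

(* v is u_t and w is u_tt; both u and v are absolutely continuous on [0, T],
   so v 0 is the one-sided derivative of u at 0. *)
Definition is_solution (R : realType) (N : nat) (a b : nat -> R) (T : R)
    (f : R -> R[i]) (u : R -> 'cV[R[i]]_N) : Prop :=
  exists v w : R -> 'cV[R[i]]_N,
    [/\ (forall k, abs_continuousC 0 T (fun t => u t k 0)) /\
        (forall k, abs_continuousC 0 T (fun t => v t k 0)),
        forall t, `]0, T[%classic t -> forall k, has_derivC (fun s => u s k 0) t (v t k 0),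
        {ae (@lebesgue_measure R), forall t, `]0, T[%classic t ->
           forall k, has_derivC (fun s => v s k 0) t (w t k 0)},
        {ae (@lebesgue_measure R), forall t, `]0, T[%classic t ->
           w t + map_mx (real_complex R) (jacobi N a b) *m u t
           = forcing N (f t)} &
        u 0 = 0 /\ v 0 = 0].

(* u^f; it is unique on [0, T]. *)
Definition solution (R : realType) (N : nat) (a b : nat -> R) (T : R)
    (f : R -> R[i]) : R -> 'cV[R[i]]_N :=
  xget (fun=> 0) [set u | is_solution a b T f u].

Definition control_op (R : realType) (N : nat) (a b : nat -> R) (T : R)
    (f : R -> R[i]) : 'cV[R[i]]_N :=
  solution N a b T f T.

Definition reachable (R : realType) (N : nat) (a b : nat -> R) (T : R) :
    set 'cV[R[i]]_N :=
  control_op N a b T @` control_space T.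

Definition is_control_adjoint (R : realType) (N : nat) (a b : nat -> R) (T : R)
    (V : 'cV[R[i]]_N -> (R -> R[i])) : Prop :=
  forall c, control_space T (V c) /\
    forall f, control_space T f ->
      control_inner T f (V c) = state_inner (control_op N a b T f) c.

(* (W^T)^*; each value is unique up to equality almost everywhere. *)
Definition control_adjoint (R : realType) (N : nat) (a b : nat -> R) (T : R) :
    'cV[R[i]]_N -> (R -> R[i]) :=
  xget (fun _ _ => 0) [set V | is_control_adjoint a b T V].

Definition connecting_op (R : realType) (N : nat) (a b : nat -> R) (T : R)
    (f : R -> R[i]) : R -> R[i] :=
  control_adjoint a b T (control_op N a b T f).

(** * The subspace F_1^T *)

Definition Sfun (R : realType) (t lam : R) : R :=
  if 0 < lam then sin (Num.sqrt lam * t) / Num.sqrt lam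
  else if lam < 0 then
    (* sinh (sqrt `|lam| * t) / sqrt `|lam| *)
    (expR (Num.sqrt `|lam| * t) - expR (- (Num.sqrt `|lam| * t))) / 2
      / Num.sqrt `|lam|
  else t.

(* The complex span of t |-> S(T - t, lam), lam an eigenvalue of the Jacobi
   matrix. *)
Definition control_F1 (R : realType) (N : nat) (a b : nat -> R) (T : R) :
    set (R -> R[i]) :=
  [set f | control_space T f /\
    exists (n : nat) (c : 'I_n -> R[i]) (lam : 'I_n -> R),
      (forall i, eigenvalue (jacobi N a b) (lam i)) /\
      ae_eq_on T f (fun t => \sum_(i < n) c i * (Sfun (T - t) (lam i))%:C)].

(** * Fourier transform and the space B_N *)

Definition fourier (R : realType) (N : nat) (a b : nat -> R)
    (c : 'cV[R[i]]_N) : R[i] -> R[i] :=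
  fun z => \sum_(k < N) c k 0 * phiC a b k.+1 z.

Definition BN (R : realType) (N : nat) (a b : nat -> R) (T : R) :
    set (R[i] -> R[i]) :=
  fourier a b @` (reachable a b T : set 'cV[R[i]]_N).

(* The h in F_1^T, unique up to equality almost everywhere, such that H is the
   Fourier transform of u^h(T). *)
Definition BN_control (R : realType) (N : nat) (a b : nat -> R) (T : R)
    (H : R[i] -> R[i]) : R -> R[i] :=
  xget (fun=> 0)
    [set h | control_F1 N a b T h /\ H = fourier a b (control_op N a b T h)].

Definition BN_inner (R : realType) (N : nat) (a b : nat -> R) (T : R)
    (H G : R[i] -> R[i]) : R[i] :=
  control_inner T (connecting_op N a b T (BN_control N a b T H))
    (BN_control N a b T G).

(** * De Branges spaces *)

Definition holomorphic_on (R : realType) (D : set R[i]) (F : R[i] -> R[i]) : Prop :=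
  forall z, D z -> derivable (F : R[i]^o -> R[i]^o) z 1.

Definition entire (R : realType) (F : R[i] -> R[i]) : Prop :=
  holomorphic_on setT F.

Definition upper_half_plane (R : realType) : set R[i] :=
  [set z | 0 < complex.Im z].

Definition hermite_biehler (R : realType) (E : R[i] -> R[i]) : Prop :=
  entire E /\
  forall z, upper_half_plane z -> Normc.normc (E z^*) < Normc.normc (E z).

Definition sharp (R : realType) (F : R[i] -> R[i]) : R[i] -> R[i] :=
  fun z => (F z^*)^*.

Definition hardy2 (R : realType) : set (R[i] -> R[i]) :=
  [set f | holomorphic_on (@upper_half_plane R) f /\
    (ereal_sup [set (\int[lebesgue_measure]_x
         ((Normc.normc (f (x +i* y))) ^+ 2)%:E)%E | y in `]0%R, +oo[]
      < +oo)%E].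

Definition deBranges (R : realType) (E : R[i] -> R[i]) : set (R[i] -> R[i]) :=
  [set F | [/\ entire F,
               hardy2 (fun z => F z / E z) &
               hardy2 (fun z => sharp F z / E z)]].

Definition deBranges_inner (R : realType) (E F G : R[i] -> R[i]) : R[i] :=
  (pi^-1)%:C *
  cintegral setT
    (fun x => F x%:C * (G x%:C)^* / ((Normc.normc (E x%:C)) ^+ 2)%:C).

(* Main.v *)
Require Import Defs.
From HB Require Import structures.
From mathcomp Require Import all_boot all_order all_algebra.
From mathcomp Require Import all_classical all_reals all_analysis.
From mathcomp Require Import measurable_realfun complex perm.
From mathcomp Require Import ring lra.
Import Order.TTheory GRing.Theory Num.Theory.
Import numFieldNormedType.Exports.

Set Implicit Arguments.
Unset Strict Implicit.
Unset Printing Implicit Defensive.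

Local Open Scope classical_set_scope.
Local Open Scope complex_scope.
Local Open Scope ring_scope.

(** Under the map sending c in C^N to the polynomial sum_k c_k phi_k, both
    inner products become the standard inner product of C^N.

    The control side.  Let lam_j be the eigenvalues of A and om_j the masses of
    its spectral measure at the first basis vector, so that the vectors
    phi(lam_j) are orthogonal with squared norms 1 / om_j ([ex_spectral]).
    Projecting the system on phi(lam_j) gives the scalar equation
    y_tt + lam_j y = f, and Duhamel's formula ([duhamel]) yields
    u^f(T) = sum_j om_j phi(lam_j) m_j(f), where m_j(f) is the integral over
    ]0, T[ of f(t) S(T - t, lam_j) ([control_opE]).  As the equation holds only
    almost everywhere, this rests on the fact that an absolutely continuous
    function with almost everywhere zero derivative is constant
    ([abs_continuous_cst]).  The functions S(T - t, lam_j) are linearly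
    independent, so their Gram matrix is invertible ([gram_unit]) and the control
    operator W is a bijection of F_1 onto C^N.  The connecting operator being
    the adjoint of W composed with W, the inner product of B_N is the one of the
    reached states ([BN_inner_fourier]); the state with entries the conjugates of
    phi_k(z) therefore represents evaluation at z.

    The de Branges side.  With Q = (z - b_N) phi_N - a_(N-1) phi_(N-1) one has
    A phi(z) = z phi(z) - Q(z) e_N, and E = phi_N - i Q.  The imaginary part of
    Q(z) times the conjugate of phi_N(z) is Im z sum_k |phi_k(z)|^2, whence E is
    Hermite-Biehler, without zeros in the closed upper half-plane, and |E(z)|
    grows there like (1 + |z|)^N: every polynomial of degree less than N is in
    B(E).  Conversely, for F in B(E) the Hardy norms of F / E and of its
    companion bound |F(z)| by a multiple of (1 + |z|)^N / sqrt |Im z|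
    ([hardy_pointwise]).  The difference of F and the polynomial interpolating F
    at the N points lam_j satisfies the same bound and has N zeros, hence
    vanishes identically ([polynomial_growth_liouville]).

    The inner product of B(E).  The matrix B = A - i e_N e_N^T satisfies
    (z - B) phi(z) = i E(z) e_N.  Its resolvent (z - B)^-1 is thus holomorphic
    near the closed upper half-plane, its imaginary part on the real line is
    - phi_j phi_k / |E|^2 ([resolvent_Im]), and at infinity it is the identity
    divided by z, up to O(|z|^-2).  Cauchy's theorem on growing rectangles
    then shows that phi_j phi_k / |E|^2 has integral pi when j = k and 0
    otherwise ([integral_spectral_density]).

    Complex integrals along segments are increments of antiderivatives of
    continuous functions of a real variable; Cauchy's theorem on rectangles is
    obtained by bisection ([goursat]). *)

(** * Complex derivatives as estimates *)

(** An increment bound free of quotients, valid over R and over C alike: it is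
    how real derivatives are compared with complex ones. *)
Lemma is_derive_epsP (K : numFieldType) (f : K^o -> K^o) (x d : K) :
  is_derive (x : K^o) (1 : K^o) f d <->
  (forall e : K, 0 < e -> exists2 del : K, 0 < del &
     forall h : K, `|h| < del -> `|f (x + h) - f x - d * h| <= e * `|h|).
Proof.
split=> [[/cvg_ex[l /= fl] fd] e e0|H].
  have {fd} ld : l = d by rewrite -fd; apply/esym/cvg_lim.
  move: fl; rewrite {l}ld.
  move/cvgrPdist_le => /(_ _ e0) /nbhs_ballP[del /= del0 H].
  exists del => // h hd.
  have [->|h0] := eqVneq h 0; first by rewrite addr0 subrr mulr0 subrr normr0 mulr0.
  have := H h; rewrite /ball /= sub0r normrN => /(_ hd h0).
  have -> : h *: (1 : K^o) + x = x + h by rewrite addrC; congr (_ + _); exact: mulr1.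
  move=> Hh; rewrite -ler_pdivrMr ?normr_gt0//.
  apply: le_trans Hh; rewrite -normfV -normrM distrC.
  rewrite mulrBl mulfK//.
  by rewrite [X in _ <= `|X - _|]mulrC.
have D : (fun h : K => h^-1 *: ((f \o shift (x : K^o)) (h *: (1 : K^o)) - f x)) @ 0^' --> (d : K^o).
  apply/cvgrPdist_le => e e0; have [del del0 {}H] := H _ e0.
  apply/nbhs_ballP; exists del => //= h.
  rewrite /ball /= sub0r normrN => /H Hh h0.
  have -> : h *: (1 : K^o) + x = x + h by rewrite addrC; congr (_ + _); exact: mulr1.
  move: Hh; rewrite -ler_pdivrMr ?normr_gt0//; apply: le_trans.
  rewrite -normfV -normrM distrC mulrBl mulfK//.
  by rewrite [X in _ <= `|X - _|]mulrC.
split; first by apply/cvg_ex; exists d.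
exact/cvg_lim.
Qed.

Local Notation normc := Normc.normc.

Section NormC.
Variable R : realType.
Implicit Types z w : R[i].

Lemma normcE z : `|z| = (normc z)%:C.
Proof. by []. Qed.

Lemma normc_ge0 z : 0 <= normc z.
Proof. by case: z => x y; exact: sqrtr_ge0. Qed.

Lemma normcD z w : normc (z + w) <= normc z + normc w.
Proof. exact: le_normcD. Qed.

Lemma normc_opp z : normc (- z) = normc z.
Proof. exact: normcN. Qed.

Lemma normcB z w : normc (z - w) <= normc z + normc w.
Proof. by rewrite -(normc_opp w); exact: normcD. Qed.

Lemma normc_dist z w : normc (z - w) = normc (w - z).
Proof. by rewrite -normc_opp opprB. Qed.

Lemma normc_real (x : R) : normc x%:C = `|x|.
Proof. by rewrite /= expr0n addr0 sqrtr_sqr. Qed.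

Lemma normc_eq0 z : (normc z == 0) = (z == 0).
Proof.
apply/eqP/eqP => [/Normc.eq0_normc//|->].
by rewrite Normc.normc0.
Qed.

Lemma normc_gt0 z : (0 < normc z) = (z != 0).
Proof. by rewrite lt_def normc_ge0 andbT normc_eq0. Qed.

Lemma normcX z n : normc (z ^+ n) = normc z ^+ n.
Proof.
by elim: n => [|n IH]; rewrite ?expr0 ?Normc.normc1// !exprS Normc.normcM IH.
Qed.

Lemma normc_conj z : normc z^* = normc z.
Proof. by case: z => x y /=; rewrite sqrrN. Qed.

Lemma sqr_normc z : normc z ^+ 2 = complex.Re z ^+ 2 + complex.Im z ^+ 2.
Proof. by case: z => x y /=; rewrite sqr_sqrtr ?addr_ge0 ?sqr_ge0. Qed.

Lemma normc_Re z : `|complex.Re z| <= normc z.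
Proof.
case: z => x y /=; rewrite -sqrtr_sqr ler_sqrt ?addr_ge0 ?sqr_ge0//.
by rewrite lerDl sqr_ge0.
Qed.

Lemma normc_Im z : `|complex.Im z| <= normc z.
Proof.
case: z => x y /=; rewrite -sqrtr_sqr ler_sqrt ?addr_ge0 ?sqr_ge0//.
by rewrite lerDr sqr_ge0.
Qed.

Lemma normc_le_ReIm z : normc z <= `|complex.Re z| + `|complex.Im z|.
Proof.
have [h|h] := leP (normc z) (`|complex.Re z| + `|complex.Im z|); first by [].
have := sqr_normc z; rewrite -(real_normK (num_real (complex.Re z))).
rewrite -(real_normK (num_real (complex.Im z))).
have := normr_ge0 (complex.Re z); have := normr_ge0 (complex.Im z).
move: h; nra.
Qed.

Lemma normc_sum I (r : seq I) (P : pred I) (F : I -> R[i]) :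
  normc (\sum_(i <- r | P i) F i) <= \sum_(i <- r | P i) normc (F i).
Proof.
elim/big_ind2 : _ => //; first by rewrite Normc.normc0.
by move=> x1 x2 y1 y2 h1 h2; apply: le_trans (normcD _ _) (lerD h1 h2).
Qed.

Lemma normc_ReIm_le z (B : R) :
  `|complex.Re z| <= B -> `|complex.Im z| <= B -> normc z <= 2 * B.
Proof. by move=> h1 h2; apply: le_trans (normc_le_ReIm _) _; lra. Qed.

End NormC.

Section ComplexDerivative.
Variable R : realType.
Local Notation C := R[i].
Implicit Types (k f g : C -> C) (z w d : C).

(** Differentiability relative to Q allows points of the boundary of a closed
    half-plane or rectangle, where only one side of the function matters. *)
Definition cdiff_on (Q : set C) k z d := forall e : R, 0 < e ->
  exists2 del : R, 0 < del & forall h, normc h < del -> Q (z + h) ->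
    normc (k (z + h) - k z - d * h) <= e * normc h.

Definition cdiff k z d := cdiff_on setT k z d.

Definition ccont k z := forall e : R, 0 < e ->
  exists2 del : R, 0 < del & forall h, normc h < del ->
    normc (k (z + h) - k z) < e.

Lemma cdiff_is_derive k z d :
  cdiff k z d <-> is_derive (z : C^o) (1 : C^o) (k : C^o -> C^o) d.
Proof.
rewrite is_derive_epsP; split=> H e e0.
  have e_real : e = (complex.Re e)%:C.
    by move: e0; rewrite ltcE/= => /andP[/eqP + _]; case: (e) => x y /= ->.
  have [|del del0 {}H] := H (complex.Re e); first by move: e0; rewrite e_real ltcR.
  exists del%:C; first by rewrite ltcR.
  move=> h; rewrite normcE ltcR => /H -/(_ I).
  by rewrite e_real !normcE -rmorphM lecR.
have [|del del0 {}H] := H e%:C; first by rewrite ltcR.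
have del_real : del = (complex.Re del)%:C.
  by move: del0; rewrite ltcE/= => /andP[/eqP + _]; case: (del) => x y /= ->.
exists (complex.Re del); first by move: del0; rewrite del_real ltcR.
move=> h hd _; have := H h; rewrite del_real normcE ltcR => /(_ hd).
by rewrite !normcE -rmorphM lecR.
Qed.

Lemma cdiffP k z : (exists d, cdiff k z d) <->
  derivable (k : C^o -> C^o) z (1 : C^o).
Proof.
split=> [[d /cdiff_is_derive[]//]|H].
exists ('D_1 (k : C^o -> C^o) z); apply/cdiff_is_derive; exact/derivableP.
Qed.

Lemma cdiff_onW (Q : set C) k z d : cdiff k z d -> cdiff_on Q k z d.
Proof.
by move=> H e /H[del del0 {}H]; exists del => // h hd _; exact: H.
Qed.

Lemma cdiff_cst (c z : C) : cdiff (fun=> c) z 0.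
Proof. by apply/cdiff_is_derive; exact: is_derive_cst. Qed.

Lemma cdiff_id z : cdiff id z 1.
Proof. by apply/cdiff_is_derive; exact: is_derive_id. Qed.

Lemma cdiffD f g z d e : cdiff f z d -> cdiff g z e ->
  cdiff (fun x => f x + g x) z (d + e).
Proof.
by move=> /cdiff_is_derive hf /cdiff_is_derive hg; apply/cdiff_is_derive; exact: is_deriveD.
Qed.

Lemma cdiffN f z d : cdiff f z d -> cdiff (fun x => - f x) z (- d).
Proof.
by move=> /cdiff_is_derive hf; apply/cdiff_is_derive; exact: is_deriveN.
Qed.

Lemma cdiffB f g z d e : cdiff f z d -> cdiff g z e ->
  cdiff (fun x => f x - g x) z (d - e).
Proof. by move=> hf hg; apply: cdiffD => //; exact: cdiffN. Qed.

Lemma cdiffM f g z d e : cdiff f z d -> cdiff g z e ->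
  cdiff (fun x => f x * g x) z (f z * e + g z * d).
Proof.
by move=> /cdiff_is_derive hf /cdiff_is_derive hg; apply/cdiff_is_derive; exact: is_deriveM.
Qed.

Lemma cdiff_cont k z d : cdiff k z d -> ccont k z.
Proof.
move=> H e e0; have [del del0 {}H] := H 1 ltr01.
have D0 : 0 < 1 + normc d by rewrite ltr_pwDl// normc_ge0.
exists (Num.min del (e / (1 + normc d))) => [|h]; first by rewrite lt_min del0 divr_gt0.
rewrite lt_min => /andP[/H -/(_ I) H1].
rewrite ltr_pdivlMr// => H2.
have := normcD (k (z + h) - k z - d * h) (d * h).
rewrite subrK Normc.normcM; lra.
Qed.

Lemma cdiff_comp f g z d e : cdiff g z e -> cdiff f (g z) d ->
  cdiff (f \o g) z (d * e).
Proof.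
move=> hg hf eps eps0.
have D0 : 0 < 1 + normc e by rewrite ltr_pwDl// normc_ge0.
have D1 : 0 < 1 + normc d by rewrite ltr_pwDl// normc_ge0.
have [|del1 del10 H1] := hf (eps / 2 / (1 + normc e)).
  by rewrite !divr_gt0.
have [del2 del20 H2] := cdiff_cont hg del10.
pose eta := Num.min 1 (eps / 2 / (1 + normc d)).
have eta0 : 0 < eta by rewrite lt_min ltr01 !divr_gt0.
have [del3 del30 H3] := hg eta eta0.
exists (Num.min del2 del3) => [|h]; first by rewrite lt_min del20.
rewrite lt_min => /andP[/H2 {}H2 /H3 /(_ I) {}H3] _ /=.
have := H1 _ H2 I; rewrite (addrC (g z)) subrK => {}H1.
have -> : f (g (z + h)) - f (g z) - d * e * h =
  (f (g (z + h)) - f (g z) - d * (g (z + h) - g z)) +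
  d * (g (z + h) - g z - e * h) by ring.
apply: le_trans (normcD _ _) _; rewrite Normc.normcM.
have h0 := normc_ge0 h.
have A1 : normc (g (z + h) - g z) <= (1 + normc e) * normc h.
  have := normcD (g (z + h) - g z - e * h) (e * h).
  rewrite subrK Normc.normcM.
  have : eta <= 1 by rewrite ge_min lexx.
  move: H3 h0; nra.
have A2 : eps / 2 / (1 + normc e) * normc (g (z + h) - g z) <= eps / 2 * normc h.
  rewrite -mulrA ler_pM2l ?divr_gt0// mulrC ler_pdivrMr// [leRHS]mulrC; exact: A1.
have A3 : normc d * normc (g (z + h) - g z - e * h) <= eps / 2 * normc h.
  have h1 : eta <= eps / 2 / (1 + normc d) by rewrite ge_min lexx orbT.
  have h2 : (1 + normc d) * eta <= eps / 2 by rewrite mulrC -ler_pdivlMr.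
  have := normc_ge0 d.
  move: H3 h0 h2 (ltW eta0).
  set u := normc (g _ - _ - _); set v := normc h; set dd := normc d.
  move=> q1 q2 q3 q4 q5.
  apply: (@le_trans _ _ (dd * (eta * v))); first by rewrite ler_wpM2l.
  by rewrite mulrA ler_wpM2r//; lra.
lra.
Qed.

Lemma cdiff_inv z : z != 0 -> cdiff GRing.inv z (- z ^- 2).
Proof.
move=> z0 e e0; have nz0 : 0 < normc z by rewrite normc_gt0.
pose del := Num.min (normc z / 2) (e * normc z ^+ 3 / 2).
have del0 : 0 < del by rewrite lt_min !divr_gt0// mulr_gt0// exprn_gt0.
exists del => // h; rewrite lt_min => /andP[h1 h2] _.
have zh : normc z / 2 <= normc (z + h).
  have := normcB (z + h) h; rewrite addrK; lra.
have zh0 : z + h != 0 by rewrite -normc_gt0; lra.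
have -> : (z + h)^-1 - z^-1 - - z ^- 2 * h = h * (h / ((z + h) * z ^+ 2)).
  by field; rewrite z0 zh0.
rewrite Normc.normcM mulrC ler_wpM2r ?normc_ge0// Normc.normcM Normc.normcV.
have p0 : 0 < normc z ^+ 3 / 2 by rewrite divr_gt0// exprn_gt0.
have p1 : normc z ^+ 3 / 2 <= normc ((z + h) * z ^+ 2).
  rewrite Normc.normcM normcX.
  have : 0 <= normc z ^+ 2 by rewrite exprn_ge0// ltW.
  rewrite exprS; move: zh; nra.
rewrite ler_pdivrMr; last exact: lt_le_trans p1.
move: p1 h2 (normc_ge0 h); nra.
Qed.

Lemma cdiff_div f g z d e : cdiff f z d -> cdiff g z e -> g z != 0 ->
  exists d', cdiff (fun x => f x / g x) z d'.
Proof.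
move=> hf hg gz; eexists; apply: cdiffM hf _.
exact: cdiff_comp hg (cdiff_inv gz).
Qed.

Lemma cdiff_poly (p : {poly C}) z : exists d, cdiff (fun x => p.[x]) z d.
Proof.
elim/poly_ind: p => [|p c [d hd]].
  by exists 0 => e e0; exists 1 => // h _ _; rewrite !horner0 subrr mul0r subr0
    Normc.normc0 mulr_ge0 ?normc_ge0// ltW.
exists (p.[z] * 1 + z * d + 0).
have := cdiffD (cdiffM hd (cdiff_id z)) (cdiff_cst c z).
rewrite (_ : (fun x : C => _) = (fun x => (p * 'X + c%:P).[x]))//.
by apply/funext => x; rewrite hornerD hornerC hornerM hornerX.
Qed.

Lemma cdiff_eq k z d d' : d = d' -> cdiff k z d -> cdiff k z d'.
Proof. by move=> ->. Qed.

Lemma near_cdiff f g z d (del : R) : 0 < del ->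
  (forall h, normc h < del -> f (z + h) = g (z + h)) -> cdiff f z d -> cdiff g z d.
Proof.
move=> del0 fg hf e e0; have [del1 del10 {}hf] := hf e e0.
exists (Num.min del del1) => [|h]; first by rewrite lt_min del0.
rewrite lt_min => /andP[h1 h2] _.
rewrite -fg// -[in g z](addr0 z) -fg ?addr0 ?Normc.normc0//.
exact: hf.
Qed.

End ComplexDerivative.

(** * Antiderivatives along segments *)

Section Antiderivative.
Variable R : realType.
Implicit Types (f Phi : R -> R) (a b x : R).

(** The integrals from -n to x are antiderivatives right of -n; normalized to
    vanish at 0 they agree on overlaps, and n is chosen according to x. *)
Lemma ex_antiderivative f : continuous f ->
  exists Phi, forall x, is_derive x (1 : R) Phi (f x).
Proof.
move=> cf.
have itg a b : (@lebesgue_measure R).-integrable `[a, b] (EFin \o f).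
  apply: continuous_compact_integrable; first exact: segment_compact.
  exact: continuous_subspaceT.
pose F n x : R := \int[lebesgue_measure]_(t in `[- n%:R, x]) f t.
have FD n x : - n%:R < x -> is_derive x (1 : R) (F n) (f x).
  move=> nx.
  have [dF F'] := @continuous_FTC1_closed R f (- n%:R) x (x + 1)
    (ltr_pwDr ltr01 (lexx x)) (itg _ _) nx (cf x).
  by apply: DeriveDef; [exact: dF|rewrite -F' derive1E].
pose G n x : R := F n x - F n 0.
have GD n x : - n%:R < x -> is_derive x (1 : R) (G n) (f x).
  move=> nx; rewrite -(subr0 (f x)).
  exact: (is_deriveB (FD _ _ nx) (is_derive_cst _ _ _)).
have eqG n m x : - n%:R < x -> (n <= m)%N -> G n x = G m x.
  move=> nx nm.
  have E (y : R) : - n%:R <= y -> F m y = F m (- n%:R) + F n y.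
    move=> ny; have mn : - m%:R <= - n%:R :> R by rewrite lerN2 ler_nat.
    have := @Rintegral_itvB R f (BLeft (- m%:R)) (BRight y) (- n%:R) (itg _ _).
    rewrite !bnd_simp => /(_ mn ny) /eqP; rewrite subr_eq => /eqP; rewrite /F => ->.
    rewrite addrC; congr (_ + _).
    rewrite Rintegral_itv_obnd_cbnd//.
    apply: integrableS (itg (- n%:R) y) => //.
    by apply: subset_itvr; rewrite bnd_simp.
  rewrite /G (E x (ltW nx)) (E 0) ?oppr_le0 ?ler0n//; ring.
pose N x := (Num.truncn `|x|).+1.
have Nx x : `|x| < (N x)%:R by rewrite /N truncnS_gt.
exists (fun x => G (N x) x) => x.
apply: near_eq_is_derive (GD (N x).+1 x _); last first.
  rewrite ltrNl (le_lt_trans (ler_norm _))// normrN (lt_trans (Nx x))//.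
  by rewrite ltr_nat.
near=> y.
have yn : - (N x).+1%:R < y.
  near: y; apply: lt_nbhsr.
  rewrite ltrNl (le_lt_trans (ler_norm _))// normrN (lt_trans (Nx x))//.
  by rewrite ltr_nat.
have yn' : - (N y)%:R < y by rewrite ltrNl (le_lt_trans (ler_norm _))// normrN.
case: (leqP (N x).+1 (N y)) => h; first by apply: eqG.
by symmetry; apply: eqG => //; exact: ltnW.
Unshelve. all: by end_near. Qed.

Lemma derive_cont f x d : is_derive x (1 : R) f d -> {for x, continuous f}.
Proof. by case=> /derivable1_diffP/differentiable_continuous. Qed.

Lemma mvt_le Phi f a b (B : R) : (forall x, is_derive x (1 : R) Phi (f x)) ->
  a <= b -> (forall x, a <= x <= b -> `|f x| <= B) ->
  `|Phi b - Phi a| <= B * (b - a).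
Proof.
move=> D ab fB; have cPhi : {within `[a, b], continuous Phi}.
  by apply: continuous_subspaceT => x; exact: derive_cont (D x).
have [c] := MVT_segment ab (fun x _ => D x) cPhi.
rewrite in_itv/= => /fB cB ->.
by rewrite normrM (ger0_norm (x := b - a)) ?subr_ge0// ler_wpM2r// subr_ge0.
Qed.

Lemma mvt_nondecr Phi f a b : (forall x, is_derive x (1 : R) Phi (f x)) ->
  a <= b -> (forall x, a <= x <= b -> 0 <= f x) -> Phi a <= Phi b.
Proof.
move=> D ab f0; have cPhi : {within `[a, b], continuous Phi}.
  by apply: continuous_subspaceT => x; exact: derive_cont (D x).
have [c] := MVT_segment ab (fun x _ => D x) cPhi.
rewrite in_itv/= => /f0 c0 E.
by rewrite -subr_ge0 E mulr_ge0// subr_ge0.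
Qed.

Lemma antiderivative_unique Phi Psi f a b :
  (forall x, is_derive x (1 : R) Phi (f x)) ->
  (forall x, is_derive x (1 : R) Psi (f x)) -> Phi b - Phi a = Psi b - Psi a.
Proof.
move=> D1 D2.
have D x : is_derive x (1 : R) (Phi - Psi) 0.
  by rewrite -(subrr (f x)); exact: is_deriveB.
have := is_derive_0_is_cst a b D.
rewrite -[(Phi - Psi) a]/(Phi a - Psi a) -[(Phi - Psi) b]/(Phi b - Psi b); lra.
Qed.

Lemma antiderivative_Rintegral Phi f a b : continuous f ->
  (forall x, is_derive x (1 : R) Phi (f x)) -> a < b ->
  (\int[lebesgue_measure]_(x in `[a, b]) (f x)%:E = (Phi b - Phi a)%:E)%E.
Proof.
move=> cf D ab; have dPhi x : {for x, continuous Phi} by exact: derive_cont (D x).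
rewrite (@continuous_FTC2 R f Phi a b)//.
- exact: continuous_subspaceT.
- split.
  + by move=> x _; case: (D x).
  + exact: cvg_at_right_filter (dPhi a).
  + exact: cvg_at_left_filter (dPhi b).
- by move=> x _; rewrite derive1E; case: (D x).
Qed.

(** An antiderivative defined for every function, so that integrals of
    continuous functions need no integrability side condition. *)
Definition prim f x : R :=
  let Phi := xget (fun=> 0) [set Phi | forall y, is_derive y (1 : R) Phi (f y)] in
  Phi x - Phi 0.

Lemma primP f : continuous f -> forall x, is_derive x (1 : R) (prim f) (f x).
Proof.
move=> /ex_antiderivative[Phi HPhi] x; rewrite /prim.
case: xgetP => [Psi _ /(_ x) D|/(_ Phi)//].
by rewrite -(subr0 (f x)); exact: (is_deriveB D (is_derive_cst _ _ _)).
Qed.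

Lemma prim_eq f Phi a b : continuous f ->
  (forall x, is_derive x (1 : R) Phi (f x)) ->
  prim f b - prim f a = Phi b - Phi a.
Proof. by move=> cf D; apply: antiderivative_unique D; exact: primP. Qed.

End Antiderivative.

Section ReIm.
Variable R : rcfType.
Implicit Types z w : R[i].

Lemma cReD z w : complex.Re (z + w) = complex.Re z + complex.Re w.
Proof. by case: z w => a b []. Qed.

Lemma cImD z w : complex.Im (z + w) = complex.Im z + complex.Im w.
Proof. by case: z w => a b []. Qed.

Lemma cReN z : complex.Re (- z) = - complex.Re z.
Proof. by case: z. Qed.

Lemma cImN z : complex.Im (- z) = - complex.Im z.
Proof. by case: z. Qed.

Lemma cReB z w : complex.Re (z - w) = complex.Re z - complex.Re w.
Proof. by rewrite cReD cReN. Qed.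

Lemma cImB z w : complex.Im (z - w) = complex.Im z - complex.Im w.
Proof. by rewrite cImD cImN. Qed.

Lemma cReM z w :
  complex.Re (z * w) = complex.Re z * complex.Re w - complex.Im z * complex.Im w.
Proof. by case: z w => a b []. Qed.

Lemma cImM z w :
  complex.Im (z * w) = complex.Re z * complex.Im w + complex.Im z * complex.Re w.
Proof. by case: z w => a b []. Qed.

Lemma cRe_sum I (r : seq I) (P : pred I) (F : I -> R[i]) :
  complex.Re (\sum_(i <- r | P i) F i) = \sum_(i <- r | P i) complex.Re (F i).
Proof. by apply: (big_morph (@complex.Re R)) => //; exact: cReD. Qed.

Lemma cIm_sum I (r : seq I) (P : pred I) (F : I -> R[i]) :
  complex.Im (\sum_(i <- r | P i) F i) = \sum_(i <- r | P i) complex.Im (F i).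
Proof. by apply: (big_morph (@complex.Im R)) => //; exact: cImD. Qed.

Lemma complex_eqP z w :
  complex.Re z = complex.Re w -> complex.Im z = complex.Im w -> z = w.
Proof. by case: z w => a b [c d] /= -> ->. Qed.

End ReIm.

Section ReImReal.
Variable R : rcfType.
Implicit Types (z : R[i]) (x : R).

Lemma cReMr z x : complex.Re (z * x%:C) = complex.Re z * x.
Proof. by rewrite cReM /= mulr0 subr0. Qed.

Lemma cImMr z x : complex.Im (z * x%:C) = complex.Im z * x.
Proof. by rewrite cImM /= mulr0 add0r. Qed.

End ReImReal.

Section ComplexAntiderivative.
Variable R : realType.
Local Notation C := R[i].
Implicit Types (f g : R -> C) (k : C -> C).

Definition rcont f := continuous (fun t => complex.Re (f t)) /\
  continuous (fun t => complex.Im (f t)).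

Lemma rcontP f : (forall t (e : R), 0 < e -> exists2 del : R, 0 < del &
    forall h : R, `|h| < del -> normc (f (t + h) - f t) < e) -> rcont f.
Proof.
move=> H; split=> t; apply/cvgrPdist_lt => e e0; have [del del0 {}H] := H t e e0;
  apply/nbhs_ballP; exists del => //= y; rewrite /ball /= distrC => /H;
  rewrite (addrC t) subrK => h; rewrite distrC; apply: le_lt_trans h.
- by rewrite -cReB; exact: normc_Re.
- by rewrite -cImB; exact: normc_Im.
Qed.

Lemma ccont_line k (a u : C) : (forall z, ccont k z) ->
  rcont (fun t => k (a + t%:C * u)).
Proof.
move=> ck; apply: rcontP => t e /(ck (a + t%:C * u))[del del0 H].
have D0 : 0 < 1 + normc u by rewrite ltr_pwDl// normc_ge0.
exists (del / (1 + normc u)); first by rewrite divr_gt0.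
move=> h; rewrite ltr_pdivlMr// => hh.
have -> : a + (t + h)%:C * u = a + t%:C * u + h%:C * u by rewrite rmorphD mulrDl addrA.
apply: H; rewrite Normc.normcM normc_real; apply: le_lt_trans hh.
by rewrite ler_wpM2l// lerDr.
Qed.

(** The chain rule along a line. *)
Lemma cdiff_line k (a u : C) (t : R) d : cdiff k (a + t%:C * u) d ->
  has_derivC (fun t => k (a + t%:C * u)) t (d * u).
Proof.
move=> H.
have E (e : R) : 0 < e -> exists2 del : R, 0 < del & forall h : R, `|h| < del ->
    normc (k (a + (t + h)%:C * u) - k (a + t%:C * u) - d * u * h%:C) <= e * `|h|.
  move=> e0; have D0 : 0 < 1 + normc u by rewrite ltr_pwDl// normc_ge0.
  have [|del del0 {}H] := H (e / (1 + normc u)); first by rewrite divr_gt0.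
  exists (del / (1 + normc u)); first by rewrite divr_gt0.
  move=> h; rewrite ltr_pdivlMr// => hh.
  have := H (h%:C * u); rewrite Normc.normcM normc_real => /(_ _ I).
  have -> : a + (t + h)%:C * u = a + t%:C * u + h%:C * u by rewrite rmorphD mulrDl addrA.
  rewrite [h%:C * u]mulrC mulrA => {}H; apply: le_trans (H _) _.
    by apply: le_lt_trans hh; rewrite ler_wpM2l// lerDr.
  by rewrite mulrAC ler_pdivrMr// -mulrA ler_pM2l// ler_wpM2l// lerDr.
split; apply/is_derive_epsP => e /E[del del0 {}E]; exists del => // h /E; apply: le_trans.
  by apply: le_trans (normc_Re _); rewrite !cReB cReMr.
by apply: le_trans (normc_Im _); rewrite !cImB cImMr.
Qed.

Definition cprim f (t : R) : C :=
  prim (fun t => complex.Re (f t)) t +i* prim (fun t => complex.Im (f t)) t.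

Lemma cprim_eq f (Phi : R -> C) (a b : R) : rcont f ->
  (forall t, has_derivC Phi t (f t)) -> cprim f b - cprim f a = Phi b - Phi a.
Proof.
move=> [f1 f2] D; apply: complex_eqP.
  by rewrite !cReB /= (prim_eq _ _ f1 (fun t => (D t).1)).
by rewrite !cImB /= (prim_eq _ _ f2 (fun t => (D t).2)).
Qed.

Lemma cprim_dist f g (a b B : R) : rcont f -> rcont g -> a <= b ->
  (forall t, a <= t <= b -> normc (f t - g t) <= B) ->
  normc ((cprim f b - cprim f a) - (cprim g b - cprim g a)) <= 2 * (B * (b - a)).
Proof.
move=> [f1 f2] [g1 g2] ab fgB.
apply: normc_ReIm_le.
  pose Phi := prim (fun t => complex.Re (f t)) - prim (fun t => complex.Re (g t)).
  have D t : is_derive t (1 : R) Phi (complex.Re (f t) - complex.Re (g t)).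
    by apply: is_deriveB; exact: primP.
  have := mvt_le (B := B) D ab; rewrite !cReB /= /Phi.
  rewrite -[(_ - _) b]/(_ b - _ b) -[(_ - _) a]/(_ a - _ a) => H.
  apply: le_trans (H _) => [|t tab]; last first.
    by rewrite -cReB; apply: le_trans (normc_Re _) _; exact: fgB.
  by rewrite le_eqVlt; apply/orP; left; apply/eqP; congr (`| _ |); ring.
pose Phi := prim (fun t => complex.Im (f t)) - prim (fun t => complex.Im (g t)).
have D t : is_derive t (1 : R) Phi (complex.Im (f t) - complex.Im (g t)).
  by apply: is_deriveB; exact: primP.
have := mvt_le (B := B) D ab; rewrite !cImB /= /Phi.
rewrite -[(_ - _) b]/(_ b - _ b) -[(_ - _) a]/(_ a - _ a) => H.
apply: le_trans (H _) => [|t tab]; last first.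
  by rewrite -cImB; apply: le_trans (normc_Im _) _; exact: fgB.
by rewrite le_eqVlt; apply/orP; left; apply/eqP; congr (`| _ |); ring.
Qed.

End ComplexAntiderivative.

(** * Integrals over rectangles and Goursat's theorem *)

Section Goursat.
Variable R : realType.
Local Notation C := R[i].
Implicit Types (k : C -> C).

(** The horizontal line of ordinate y and the vertical line of abscissa x, in
    the form base point plus parameter times direction required by the chain
    rule along lines. *)
Definition hline k (y : R) : R -> C := fun x => k ('i * y%:C + x%:C * 1).
Definition vline k (x : R) : R -> C := fun y => k (x%:C + y%:C * 'i).

Definition hint k (y a b : R) : C := cprim (hline k y) b - cprim (hline k y) a.
Definition vint k (x c d : R) : C := cprim (vline k x) d - cprim (vline k x) c.

Definition rect_int k (a b c d : R) : C :=
  hint k c a b - hint k d a b + 'i * (vint k b c d - vint k a c d).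

Lemma rect_int_split k (a m b c n d : R) : rect_int k a b c d =
  rect_int k a m c n + rect_int k m b c n + rect_int k a m n d + rect_int k m b n d.
Proof. by rewrite /rect_int /hint /vint; ring. Qed.

Lemma hlineE (x y : R) : 'i * y%:C + x%:C * 1 = x +i* y :> C.
Proof. by apply/eqP; rewrite eq_complex /=; apply/andP; split; apply/eqP; ring. Qed.

Lemma vlineE (x y : R) : x%:C + y%:C * 'i = x +i* y :> C.
Proof. by apply/eqP; rewrite eq_complex /=; apply/andP; split; apply/eqP; ring. Qed.

Lemma hlineEE k y x : hline k y x = k (x +i* y).
Proof. by rewrite /hline hlineE. Qed.

Lemma vlineEE k x y : vline k x y = k (x +i* y).
Proof. by rewrite /vline vlineE. Qed.

Lemma rcont_hline k y : (forall z, ccont k z) -> rcont (hline k y).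
Proof. by move=> ck; exact: ccont_line. Qed.

Lemma rcont_vline k x : (forall z, ccont k z) -> rcont (vline k x).
Proof. by move=> ck; exact: ccont_line. Qed.

(** The increments of L telescope around the rectangle. *)
Lemma rect_int_exact (l L : C -> C) (a b c d : R) :
  (forall z, ccont l z) -> (forall z, cdiff L z (l z)) -> rect_int l a b c d = 0.
Proof.
move=> cl LD; rewrite /rect_int.
have H y : hint l y a b = L (b +i* y) - L (a +i* y).
  rewrite /hint (@cprim_eq _ _ (hline L y)) ?hlineEE//; first exact: rcont_hline.
  by move=> t; have := cdiff_line (LD ('i * y%:C + t%:C * 1)); rewrite mulr1.
have V x : 'i * vint l x c d = L (x +i* d) - L (x +i* c).
  have nL z : cdiff (fun z => - 'i * L z) z (- 'i * l z).
    by have := cdiffM (cdiff_cst (- 'i) z) (LD z); rewrite mulr0 addr0.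
  rewrite /vint (@cprim_eq _ _ (vline (fun z => - 'i * L z) x)) ?vlineEE//.
  - by rewrite -mulrBr mulrA mulrN -expr2 sqr_i opprK mul1r.
  - exact: rcont_vline.
  move=> t; have := cdiff_line (nL (x%:C + t%:C * 'i)).
  by rewrite mulrAC mulNr -expr2 sqr_i opprK mul1r.
by rewrite !H mulrBr !V; ring.
Qed.

End Goursat.

Section GoursatTheorem.
Variable R : realType.
Local Notation C := R[i].
Implicit Types (k : C -> C).

Lemma rect_int_dist (k l : C -> C) (a b c d B : R) :
  (forall z, ccont k z) -> (forall z, ccont l z) -> a <= b -> c <= d ->
  (forall x y, a <= x <= b -> c <= y <= d ->
     normc (k (x +i* y) - l (x +i* y)) <= B) ->
  normc (rect_int k a b c d - rect_int l a b c d) <=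
  4 * (B * ((b - a) + (d - c))).
Proof.
move=> ck cl ab cd klB.
have H y : c <= y <= d -> normc (hint k y a b - hint l y a b) <= 2 * (B * (b - a)).
  move=> cyd; apply: cprim_dist => // [||t tab]; [exact: rcont_hline..|].
  by rewrite !hlineEE; exact: klB.
have V x : a <= x <= b -> normc (vint k x c d - vint l x c d) <= 2 * (B * (d - c)).
  move=> cyd; apply: cprim_dist => // [||t tab]; [exact: rcont_vline..|].
  by rewrite !vlineEE; exact: klB.
have -> : rect_int k a b c d - rect_int l a b c d =
  ((hint k c a b - hint l c a b) - (hint k d a b - hint l d a b)) +
  'i * ((vint k b c d - vint l b c d) - (vint k a c d - vint l a c d)).
  by rewrite /rect_int; ring.
have ni : normc ('i : C) = 1 by rewrite /= expr0n expr1n add0r sqrtr1.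
have := normcD ((hint k c a b - hint l c a b) - (hint k d a b - hint l d a b))
  ('i * ((vint k b c d - vint l b c d) - (vint k a c d - vint l a c d))).
rewrite Normc.normcM ni mul1r.
have := normcB (hint k c a b - hint l c a b) (hint k d a b - hint l d a b).
have := normcB (vint k b c d - vint l b c d) (vint k a c d - vint l a c d).
have := H c; have := H d; have := V a; have := V b.
rewrite !lexx ab cd => /(_ isT) h1 /(_ isT) h2 /(_ isT) h3 /(_ isT) h4.
lra.
Qed.

Lemma nested_intervals (x : nat -> R) (w : R) : 0 <= w ->
  (forall n, x n <= x n.+1 /\ x n.+1 + w / 2 ^+ n.+1 <= x n + w / 2 ^+ n) ->
  exists p, forall n, x n <= p <= x n + w / 2 ^+ n.
Proof.
move=> w0 H; have h1 n m : (n <= m)%N -> x n <= x m.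
  elim: m => [|m IH]; first by rewrite leqn0 => /eqP ->.
  rewrite leq_eqVlt => /orP[/eqP ->//|/IH h]; apply: le_trans h _.
  by case: (H m).
have h2 n m : (n <= m)%N -> x m + w / 2 ^+ m <= x n + w / 2 ^+ n.
  elim: m => [|m IH]; first by rewrite leqn0 => /eqP ->.
  rewrite leq_eqVlt => /orP[/eqP ->//|/IH h]; apply: le_trans h.
  by case: (H m).
exists (sup (range x)) => n; apply/andP; split.
  apply: ub_le_sup; last by exists n.
  exists (x 0%N + w) => _ [m _ <-]; have := h2 0%N m (leq0n _).
  rewrite expr0 divr1; apply: le_trans; rewrite lerDl divr_ge0// exprn_ge0//.
apply: ge_sup; first by exists (x 0%N), 0%N.
move=> _ [m _ <-]; case: (leqP n m) => [nm|/ltnW mn].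
  by apply: le_trans (h2 _ _ nm); rewrite lerDl divr_ge0// exprn_ge0.
apply: le_trans (h1 _ _ mn) _; rewrite lerDl divr_ge0// exprn_ge0//.
Qed.

Lemma ex_halving (M del : R) : 0 < del -> exists n : nat, M / 2 ^+ n < del.
Proof.
move=> del0; pose n := (Num.truncn `|M / del|).+1; exists n.
rewrite ltr_pdivrMr ?exprn_gt0// mulrC -ltr_pdivrMr//.
apply: le_lt_trans (ler_norm _) _; apply: lt_trans (truncnS_gt _) _.
by rewrite -natrX ltr_nat ltn_expl.
Qed.

(** A statement about rectangles that follows from the same statement on their
    four quarters, and fails on a rectangle, fails on a nested sequence of
    quarters, each given by its lower left corner and its generation. *)
Lemma bisection (Q : R -> R -> nat -> Prop) (a c w h : R) :
  (forall x y n, Q x y n.+1 -> Q (x + w / 2 ^+ n.+1) y n.+1 ->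
     Q x (y + h / 2 ^+ n.+1) n.+1 ->
     Q (x + w / 2 ^+ n.+1) (y + h / 2 ^+ n.+1) n.+1 ->
     Q x y n) ->
  ~ Q a c 0%N -> exists x y : nat -> R, [/\ x 0%N = a, y 0%N = c,
    forall n, ~ Q (x n) (y n) n &
    forall n, (x n.+1 = x n \/ x n.+1 = x n + w / 2 ^+ n.+1) /\
              (y n.+1 = y n \/ y n.+1 = y n + h / 2 ^+ n.+1)].
Proof.
move=> HQ Q0.
pose step n (p q : R * R) := [/\ ~ Q p.1 p.2 n -> ~ Q q.1 q.2 n.+1,
  q.1 = p.1 \/ q.1 = p.1 + w / 2 ^+ n.+1 & q.2 = p.2 \/ q.2 = p.2 + h / 2 ^+ n.+1].
have ex_step n p : exists q, step n p q.
  have [Qp|nQp] := pselect (Q p.1 p.2 n).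
    by exists p; split; [|left|left].
  have [q1|n1] := pselect (Q p.1 p.2 n.+1); last by exists p; split; [|left|left].
  have [q2|n2] := pselect (Q (p.1 + w / 2 ^+ n.+1) p.2 n.+1); last first.
    by exists (p.1 + w / 2 ^+ n.+1, p.2); split; [|right|left].
  have [q3|n3] := pselect (Q p.1 (p.2 + h / 2 ^+ n.+1) n.+1); last first.
    by exists (p.1, p.2 + h / 2 ^+ n.+1); split; [|left|right].
  have [q4|n4] := pselect (Q (p.1 + w / 2 ^+ n.+1) (p.2 + h / 2 ^+ n.+1) n.+1); last first.
    by exists (p.1 + w / 2 ^+ n.+1, p.2 + h / 2 ^+ n.+1); split; [|right|right].
  by exfalso; apply: nQp; exact: HQ.
have [nxt Hnxt] := choice (fun np : nat * (R * R) => ex_step np.1 np.2).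
pose p := fix p n := if n is m.+1 then nxt (m, p m) else (a, c).
have pS n : step n (p n) (p n.+1) by have := Hnxt (n, p n).
exists (fun n => (p n).1), (fun n => (p n).2); split => //.
  by elim=> // n IH; case: (pS n) => + _ _; exact.
by move=> n; case: (pS n).
Qed.

(** If the integral exceeded e (w + h)^2, so would it on nested quarters at the
    corresponding scale; near their common point, k is an affine function, whose
    integral vanishes, up to an error too small for that. *)
Theorem goursat k (a b c d : R) : (forall z, ccont k z) -> a <= b -> c <= d ->
  (forall z, a <= complex.Re z <= b -> c <= complex.Im z <= d ->
     exists D, cdiff_on [set z | a <= complex.Re z <= b /\ c <= complex.Im z <= d] k z D) ->
  rect_int k a b c d = 0.
Proof.
move=> ck ab cd kD; set w := b - a; set h := d - c.
have w0 : 0 <= w by rewrite subr_ge0.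
have h0 : 0 <= h by rewrite subr_ge0.
have pow n : (w + h) / 2 ^+ n = w / 2 ^+ n + h / 2 ^+ n by rewrite mulrDl.
suff small (e : R) : 0 < e -> normc (rect_int k a b c d) <= e * (w + h) ^+ 2.
  apply/eqP; rewrite -normc_eq0 eq_le normc_ge0 andbT.
  apply/ler_addgt0Pr => e e0; rewrite add0r.
  have W0 : 0 < 1 + (w + h) ^+ 2 by rewrite ltr_pwDl// sqr_ge0.
  apply: le_trans (small (e / (1 + (w + h) ^+ 2)) _) _; first by rewrite divr_gt0.
  by rewrite mulrAC ler_pdivrMr// ler_pM2l// lerDr.
move=> e0.
pose Q (x y : R) (n : nat) : Prop := normc (rect_int k x (x + w / 2 ^+ n) y (y + h / 2 ^+ n)) <=
  e * ((w + h) / 2 ^+ n) ^+ 2.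
suff : Q a c 0%N by rewrite /Q expr0 !divr1 /w /h [a + _]addrC [c + _]addrC !subrK.
apply: contrapT => nQ0; have [|x [y [x0 y0 nQ xyS]]] := @bisection Q a c w h _ nQ0.
  move=> x y n q1 q2 q3 q4; rewrite /Q.
  have halve (v : R) : v / 2 ^+ n = v / 2 ^+ n.+1 + v / 2 ^+ n.+1.
    by rewrite exprS; field; rewrite expf_neq0.
  rewrite (@rect_int_split _ _ _ (x + w / 2 ^+ n.+1) _ _ (y + h / 2 ^+ n.+1)).
  rewrite (halve w) (halve h) (halve (w + h)) (addrA x) (addrA y).
  move: q1 q2 q3 q4; rewrite /Q.
  move: (rect_int _ _ _ _ _) (rect_int _ _ _ _ _) (rect_int _ _ _ _ _) (rect_int _ _ _ _ _).
  move=> r1 r2 r3 r4 q1 q2 q3 q4.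
  apply: le_trans (normcD _ _) _; apply: le_trans (lerD (normcD _ _) (lexx _)) _.
  apply: le_trans (lerD (lerD (normcD _ _) (lexx _)) (lexx _)) _.
  move: q1 q2 q3 q4; lra.
have pn (n : nat) : 0 < 2 ^+ n :> R by rewrite exprn_gt0.
have halve (v : R) n : v / 2 ^+ n = v / 2 ^+ n.+1 + v / 2 ^+ n.+1.
  by rewrite exprS; field; rewrite expf_neq0.
have [px Hpx] : exists p, forall n, x n <= p <= x n + w / 2 ^+ n.
  apply: nested_intervals => // n; have [+ _] := xyS n; rewrite (halve _ n).
  have : 0 <= w / 2 ^+ n.+1 by rewrite divr_ge0// ltW.
  by move=> ? [] ->; lra.
have [py Hpy] : exists p, forall n, y n <= p <= y n + h / 2 ^+ n.
  apply: nested_intervals => // n; have [_ +] := xyS n; rewrite (halve _ n).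
  have : 0 <= h / 2 ^+ n.+1 by rewrite divr_ge0// ltW.
  by move=> ? [] ->; lra.
have inx n : a <= x n /\ x n + w / 2 ^+ n <= b.
  elim: n => [|n [i1 i2]]; first by rewrite x0 expr0 divr1 /w lexx; split; lra.
  have [+ _] := xyS n; move: i2; rewrite (halve _ n).
  have : 0 <= w / 2 ^+ n.+1 by rewrite divr_ge0// ltW.
  by move=> ? ? [] ->; lra.
have iny n : c <= y n /\ y n + h / 2 ^+ n <= d.
  elim: n => [|n [i1 i2]]; first by rewrite y0 expr0 divr1 /h lexx; split; lra.
  have [_ +] := xyS n; move: i2; rewrite (halve _ n).
  have : 0 <= h / 2 ^+ n.+1 by rewrite divr_ge0// ltW.
  by move=> ? ? [] ->; lra.
have [||D HD] := kD (px +i* py).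
- by have := Hpx 0%N; have := inx 0%N => /=; move: w0; lra.
- by have := Hpy 0%N; have := iny 0%N => /=; move: h0; lra.
have [del del0 {}HD] := HD _ (divr_gt0 e0 (ltr0n R 4)).
have [n Hn] := ex_halving (w + h) del0.
apply: (nQ n); rewrite /Q.
have wn : 0 <= w / 2 ^+ n by rewrite divr_ge0// ltW.
have hn : 0 <= h / 2 ^+ n by rewrite divr_ge0// ltW.
pose p := px +i* py.
(* The affine approximation of k at p, and an antiderivative of it. *)
pose l z := k p + D * (z - p).
pose L z := k p * z + D / 2 * (z - p) ^+ 2.
have LD z : cdiff L z (l z).
  have dz := cdiffB (cdiff_id z) (cdiff_cst p z).
  apply: cdiff_eq (cdiffD (cdiffM (cdiff_cst (k p) z) (cdiff_id z))
    (cdiffM (cdiff_cst (D / 2) z) (cdiffM dz dz))).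
  by rewrite /l; field.
have cl z : ccont l z.
  apply: cdiff_cont (cdiffD (cdiff_cst (k p) z) (cdiffM (cdiff_cst D z)
     (cdiffB (cdiff_id z) (cdiff_cst p z)))).
rewrite -[rect_int k _ _ _ _]subr0 -(rect_int_exact (x n) (x n + w / 2 ^+ n) (y n) (y n + h / 2 ^+ n) cl LD).
apply: le_trans (rect_int_dist (B := e / 4 * ((w + h) / 2 ^+ n)) ck cl _ _ _) _;
  rewrite ?lerDl//; last first.
  rewrite pow; lra.
move=> u v /andP[u1 u2] /andP[v1 v2].
pose hh := (u +i* v) - p.
have nhh : normc hh <= (w + h) / 2 ^+ n.
  apply: le_trans (normc_le_ReIm _) _; rewrite pow.
  by have := Hpx n; have := Hpy n => /andP[? ?] /andP[? ?];
    apply: lerD; rewrite /hh /p /= ler_norml; apply/andP; split; lra.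
have -> : u +i* v = p + hh by rewrite /hh addrC subrK.
have -> : k (p + hh) - l (p + hh) = k (p + hh) - k p - D * hh.
  by rewrite /l; ring.
apply: le_trans (HD hh _ _) _.
- exact: le_lt_trans Hn.
- have -> : px +i* py + hh = u +i* v by rewrite /hh addrC subrK.
  by have := inx n; have := iny n => -[? ?] [? ?] /=; split; apply/andP; split; lra.
- by rewrite ler_wpM2l// divr_ge0// ltW.
Qed.

End GoursatTheorem.

(** * The mean value bound on circles *)

Section ComplexExponential.
Variable R : realType.
Local Notation C := R[i].

Definition cexp (w : C) : C :=
  (expR (complex.Re w))%:C * (cos (complex.Im w) +i* sin (complex.Im w)).

Lemma cexpD z w : cexp (z + w) = cexp z * cexp w.
Proof.
rewrite /cexp cReD cImD expRD cosD sinD rmorphM /=.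
by apply: complex_eqP; rewrite !(cReM, cImM) /=; ring.
Qed.

Lemma normc_cexp w : normc (cexp w) = expR (complex.Re w).
Proof.
rewrite /cexp Normc.normcM normc_real ger0_norm ?expR_ge0//.
by rewrite [normc (_ +i* _)]/= cos2Dsin2 sqrtr1 mulr1.
Qed.

(** It suffices to combine the real derivatives at 0 of the exponential, cosine
    and sine; the functional equation transports the result to every point. *)
Lemma cdiff_cexp0 : cdiff cexp 0 1.
Proof.
move=> e e0; have [e1 [e10 eps1 eps2]] : exists e1, [/\ 0 < e1, e1 <= 1 & e1 <= e / 16].
  exists (Num.min 1 (e / 16)); rewrite lt_min ltr01 divr_gt0//.
  by rewrite !ge_min !lexx orbT.
have [del1 d1 H1] := (is_derive_epsP _ _ _).1 (is_derive_expR (0 : R)) e1 e10.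
have [del2 d2 H2] := (is_derive_epsP _ _ _).1 (is_derive_cos (0 : R)) e1 e10.
have [del3 d3 H3] := (is_derive_epsP _ _ _).1 (is_derive_sin (0 : R)) e1 e10.
pose del := Num.min (Num.min del1 e1) (Num.min del2 (Num.min del3 1)).
exists del => [|h]; first by rewrite !lt_min d1 d2 d3 e10 ltr01.
rewrite !lt_min => /andP[/andP[h1 h2] /andP[h3 /andP[h4 h5]]] _.
set a := complex.Re h; set b := complex.Im h.
have ha : `|a| <= normc h by exact: normc_Re.
have hb : `|b| <= normc h by exact: normc_Im.
have {}H1 := H1 a (le_lt_trans ha h1).
have {}H2 := H2 b (le_lt_trans hb h3).
have {}H3 := H3 b (le_lt_trans hb h4).
rewrite !add0r ?expR0 ?cos0 ?sin0 ?oppr0 ?mul0r ?mul1r ?subr0 ?addr0 in H1 H2 H3.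
have n0 := normc_ge0 h.
have x0 := expR_ge0 a.
have xa : `|expR a - 1| <= 2 * normc h.
  have := ler_normD (expR a - 1 - a) a; rewrite subrK.
  have := normr_ge0 a; nra.
have x3 : expR a <= 3.
  have := ler_norm (expR a - 1); lra.
rewrite add0r; apply: le_trans (normc_le_ReIm _) _.
rewrite !cReB !cImB /cexp !cReM !cImM /= -/a -/b expR0 cos0 sin0.
have -> : expR a * cos b - 0 * sin b - (1 * 1 - 0 * 0) - (1 * a - 0 * b) =
  expR a * (cos b - 1) + (expR a - 1 - a) by ring.
have -> : expR a * sin b + 0 * cos b - (1 * 0 + 0 * 1) - (1 * b + 0 * a) =
  expR a * (sin b - b) + (expR a - 1) * b by ring.
have A1 : `|expR a * (cos b - 1)| <= 3 * (e1 * normc h).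
  rewrite normrM ger0_norm//; apply: ler_pM => //.
  by apply: le_trans H2 _; rewrite ler_wpM2l// ltW.
have A2 : `|expR a * (sin b - b)| <= 3 * (e1 * normc h).
  rewrite normrM ger0_norm//; apply: ler_pM => //.
  by apply: le_trans H3 _; rewrite ler_wpM2l// ltW.
have A3 : `|(expR a - 1) * b| <= (2 * normc h) * e1.
  rewrite normrM; apply: ler_pM => //.
  by apply: le_trans hb _; apply: ltW; exact: lt_le_trans h2 _.
have A4 : `|expR a - 1 - a| <= e1 * normc h.
  by apply: le_trans H1 _; rewrite ler_wpM2l// ltW.
have := ler_normD (expR a * (cos b - 1)) (expR a - 1 - a).
have := ler_normD (expR a * (sin b - b)) ((expR a - 1) * b).
have A5 : e1 * normc h <= e / 16 * normc h by rewrite ler_wpM2r.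
have : 0 <= e * normc h by rewrite mulr_ge0// ltW.
move: A1 A2 A3 A4 A5; rewrite -(mulrA e); set u := normc h.
move=> A1 A2 A3 A4 A5 A6 A7 A8; lra.
Qed.

Lemma cdiff_cexp w : cdiff cexp w (cexp w).
Proof.
move=> e e0; have D0 : 0 < normc (cexp w) by rewrite normc_cexp expR_gt0.
have [del del0 H] := cdiff_cexp0 (divr_gt0 e0 D0).
exists del => // h /H /(_ I); rewrite add0r mul1r => {}H _.
have -> : cexp (w + h) - cexp w - cexp w * h = cexp w * (cexp h - cexp 0 - h).
  rewrite cexpD !mulrBr; congr (_ - _ - _).
  by rewrite -cexpD addr0.
rewrite Normc.normcM -ler_pdivlMl//.
by apply: le_trans H _; rewrite mulrA [e / _]mulrC.
Qed.

End ComplexExponential.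

Section CirclePreliminaries.
Variable R : realType.
Local Notation C := R[i].
Implicit Types (k : C -> C) (c : C).

Lemma ccont_comp (f g : C -> C) z : ccont g z -> ccont f (g z) -> ccont (f \o g) z.
Proof.
move=> cg cf e /cf[d1 d10 H1]; have [d2 d20 H2] := cg _ d10.
exists d2 => // h /H2 /H1 /=; by rewrite [g z + _]addrC subrK.
Qed.

Lemma hint_vperiodic k (y1 y2 a b : R) :
  (forall x, k (x +i* y1) = k (x +i* y2)) -> hint k y1 a b = hint k y2 a b.
Proof.
move=> H; rewrite /hint; congr (cprim _ _ - cprim _ _);
  by apply/funext => x; rewrite !hlineEE.
Qed.

(** Uniform continuity of k near a compact vertical segment. *)
Lemma vint_continuous k (c d s : R) : (forall z, ccont k z) -> c <= d ->
  forall e, 0 < e -> exists2 del : R, 0 < del & forall s', `|s' - s| < del ->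
    normc (vint k s' c d - vint k s c d) < e.
Proof.
move=> ck cd e e0.
have W0 : 0 < 1 + 2 * (d - c) by rewrite ltr_pwDl// mulr_ge0// subr_ge0.
pose e1 := e / (1 + 2 * (d - c)).
have e10 : 0 < e1 by rewrite divr_gt0.
have : \forall s' \near s, `[c, d] `<=` (fun y => normc (k (s' +i* y) - k (s +i* y)) < e1).
  apply: (proj1 (compact_near_coveringP _) (@segment_compact R c d) R (nbhs s)
    (fun s' y => normc (k (s' +i* y) - k (s +i* y)) < e1) _).
  move=> y _ /=.
  have [del del0 H] := ck (s +i* y) (e1 / 2) (divr_gt0 e10 (ltr0n _ 2)).
  exists ((ball y (del / 2)), (ball s (del / 2))) => /=.
    by split; apply: nbhsx_ballx; rewrite divr_gt0.
  move=> [y' s'] /= [hy hs].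
  have {}hy : `|y' - y| < del / 2 by rewrite distrC.
  have {}hs : `|s' - s| < del / 2 by rewrite distrC.
  have h1 : normc (k (s' +i* y') - k (s +i* y)) < e1 / 2.
    have := H ((s' - s) +i* (y' - y)).
    have -> : s +i* y + ((s' - s) +i* (y' - y)) = s' +i* y'.
      by apply: complex_eqP => /=; rewrite addrC subrK.
    apply; apply: le_lt_trans (normc_le_ReIm _) _ => /=.
    by rewrite [X in _ < X](splitr del); exact: ltrD.
  have h2 : normc (k (s +i* y') - k (s +i* y)) < e1 / 2.
    have := H (0 +i* (y' - y)).
    have -> : s +i* y + (0 +i* (y' - y)) = s +i* y'.
      by apply: complex_eqP => /=; rewrite ?addr0// addrC subrK.
    apply; apply: le_lt_trans (normc_le_ReIm _) _ => /=.
    rewrite normr0 add0r; apply: lt_le_trans hy _; lra.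
  have -> : k (s' +i* y') - k (s +i* y') =
    (k (s' +i* y') - k (s +i* y)) - (k (s +i* y') - k (s +i* y)) by ring.
  apply: le_lt_trans (normcB _ _) _; lra.
move=> /nbhs_ballP[del /= del0 H]; exists del => // s' hs'.
have {}H y : c <= y <= d -> normc (k (s' +i* y) - k (s +i* y)) < e1.
  by move=> cyd; apply: (H s') => //=; rewrite /ball /= distrC.
apply: le_lt_trans (@cprim_dist _ _ _ _ _ e1 _ _ cd _) _.
- exact: rcont_vline.
- exact: rcont_vline.
- by move=> t /H; rewrite !vlineEE => /ltW.
by rewrite mulrCA /e1 mulrAC ltr_pdivrMr// ltr_pM2l// ltrDr.
Qed.

(** Removes exceptional points one at a time: at each of them the values from
    the left and from the right agree by continuity. *)
Lemma locally_cst_off_finite (J : R -> C) (L : seq R) :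
  (forall s e, 0 < e -> exists2 del : R, 0 < del &
     forall s', `|s' - s| < del -> normc (J s' - J s) < e) ->
  (forall s1 s2, s1 <= s2 -> (forall s, s1 <= s <= s2 -> s \notin L) -> J s1 = J s2) ->
  forall s1 s2, s1 <= s2 -> J s1 = J s2.
Proof.
move=> cJ; elim: L => [|s0 L IH] H; first by move=> s1 s2 h; apply: H.
apply: IH => s1 s2 s12 avoid.
have [/andP[h1 h2]|h] := boolP (s1 <= s0 <= s2); last first.
  apply: H => // s hs; rewrite in_cons negb_or avoid// andbT.
  by apply: contraNneq h => <-.
have close (z w : C) : (forall e, 0 < e -> normc (z - w) < e) -> z = w.
  move=> hzw; apply/eqP; rewrite -subr_eq0 -normc_eq0 eq_le normc_ge0 andbT.
  by rewrite leNgt; apply/negP => /hzw; rewrite ltxx.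
transitivity (J s0); apply: close => e e0; have [del del0 {}cJ] := cJ s0 e e0.
- move: h1; rewrite le_eqVlt => /orP[/eqP <-|h1].
    by rewrite subrr Normc.normc0.
  pose t := Num.max s1 (s0 - del / 2).
  have t1 : s1 <= t by rewrite le_max lexx.
  have t2 : s0 - del / 2 <= t by rewrite le_max lexx orbT.
  have t3 : t < s0 by rewrite gt_max h1/= ltrBlDr ltrDl divr_gt0.
  rewrite (H s1 t)//; first by apply: cJ; rewrite ltr_norml; apply/andP; split; lra.
  move=> s /andP[hs1 hs2]; rewrite in_cons negb_or avoid; last by apply/andP; split; lra.
  by rewrite andbT lt_eqF//; exact: le_lt_trans hs2 t3.
- move: h2; rewrite le_eqVlt => /orP[/eqP <-|h2].
    by rewrite subrr Normc.normc0.
  pose t := Num.min s2 (s0 + del / 2).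
  have t1 : t <= s2 by rewrite ge_min lexx.
  have t2 : t <= s0 + del / 2 by rewrite ge_min lexx orbT.
  have t3 : s0 < t by rewrite lt_min h2/= ltrDl divr_gt0.
  rewrite normc_dist -(H t s2)//; first by apply: cJ; rewrite ltr_norml; apply/andP; split; lra.
  move=> s /andP[hs1 hs2]; rewrite in_cons negb_or avoid; last by apply/andP; split; lra.
  by rewrite andbT gt_eqF//; exact: lt_le_trans t3 hs1.
Qed.

End CirclePreliminaries.

Section CircleMeanValue.
Variable R : realType.
Local Notation C := R[i].
Implicit Types (k : C -> C) (c : C).

Lemma has_derivC_reflect (f Phi : R -> C) (t : R) :
  has_derivC Phi (- t) (f (- t)) -> has_derivC (fun s => - Phi (- s)) t (f (- t)).
Proof.
move=> [D1 D2]; split.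
  have := @is_derive1_comp R (fun s => complex.Re (Phi s)) -%R t _ _ D1 (is_deriveNid _ _).
  rewrite mulrN1 => /is_deriveN; rewrite opprK.
  by under [X in _ -> is_derive _ _ X _]eq_fun do rewrite cReN.
have := @is_derive1_comp R (fun s => complex.Im (Phi s)) -%R t _ _ D2 (is_deriveNid _ _).
rewrite mulrN1 => /is_deriveN; rewrite opprK.
by under [X in _ -> is_derive _ _ X _]eq_fun do rewrite cImN.
Qed.

Lemma has_derivCD (f g : R -> C) (t : R) d e :
  has_derivC f t d -> has_derivC g t e -> has_derivC (fun s => f s + g s) t (d + e).
Proof.
move=> [D1 D2] [E1 E2]; split; rewrite ?cReD ?cImD.
  by under eq_fun do rewrite cReD; exact: is_deriveD.
by under eq_fun do rewrite cImD; exact: is_deriveD.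
Qed.

Lemma cprimP (f : R -> C) t : rcont f -> has_derivC (cprim f) t (f t).
Proof. by move=> [f1 f2]; split; exact: primP. Qed.

Lemma rcont_cst (z : C) : rcont (fun=> z).
Proof. by split; exact: cst_continuous. Qed.

Lemma cprim_cst (z : C) (a b : R) : cprim (fun=> z) b - cprim (fun=> z) a = (b - a)%:C * z.
Proof.
rewrite (@cprim_eq _ _ (fun t => t%:C * z)); first by rewrite rmorphB mulrBl.
  exact: rcont_cst.
move=> t; have := @cdiff_line R id 0 z t 1 (cdiff_id _).
by rewrite mul1r; under eq_fun do rewrite add0r.
Qed.

(** Folding the interval at 0, so that cancellations between f t and f (- t)
    may be used. *)
Lemma cprim_sym_bound (f : R -> C) (T B : R) : rcont f -> 0 <= T ->
  (forall t, 0 <= t <= T -> normc (f t + f (- t)) <= B) ->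
  normc (cprim f T - cprim f (- T)) <= 2 * (B * T).
Proof.
move=> cf T0 fB.
have cg : rcont (fun t => f t + f (- t)).
  case: cf => f1 f2; split=> t.
    under eq_fun do rewrite cReD; apply: cvgD; first exact: f1.
    apply: (@continuous_comp _ _ _ (-%R : R -> R) (fun t => complex.Re (f t)) t);
      [exact: opp_continuous|exact: f1].
  under eq_fun do rewrite cImD; apply: cvgD; first exact: f2.
  apply: (@continuous_comp _ _ _ (-%R : R -> R) (fun t => complex.Im (f t)) t);
      [exact: opp_continuous|exact: f2].
have := cprim_dist (B := B) cg (rcont_cst 0) T0.
rewrite cprim_cst mulr0 !subr0 => H.
rewrite -(_ : cprim (fun t => f t + f (- t)) T - cprim (fun t => f t + f (- t)) 0 =
  cprim f T - cprim f (- T)); last first.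
  rewrite (@cprim_eq _ _ (fun t => cprim f t - cprim f (- t)))//.
    by rewrite oppr0 subrr subr0.
  move=> t; apply: has_derivCD; first exact: cprimP.
  by apply: has_derivC_reflect; exact: cprimP.
by apply: H => t /fB; rewrite subr0.
Qed.

(** In the coordinate w, z = c + i exp w turns circles around c into vertical
    segments.  Goursat's theorem makes the angular mean of k over the circle of
    radius exp s locally constant in s away from the exceptional points of S, and
    continuity makes it constant; as s tends to - oo it tends to k c.  The
    bound is only required on sums of values at mirror points of the circle, which
    may be much smaller than the values themselves. *)
Theorem circle_mean_bound k (S : seq C) c (r B : R) :
  (forall z, ccont k z) -> (forall z, z \notin S -> exists d, cdiff k z d) ->
  0 < r ->
  (forall t : R, normc (k (c + r%:C * ('i * (cos t +i* sin t))) +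
                 k (c + r%:C * ('i * (cos t -i* sin t)))) <= 2 * B) ->
  normc (k c) <= 2 * B.
Proof.
move=> ck kD r0 kB.
pose G w := k (c + 'i * cexp w).
have cin w : ccont (fun w => c + 'i * cexp w) w.
  apply: cdiff_cont (cdiffD (cdiff_cst c w) (cdiffM (cdiff_cst 'i w) (cdiff_cexp w))).
have cG w : ccont G w by apply: (@ccont_comp _ k (fun w => c + 'i * cexp w)).
have pi0 : - pi <= pi :> R by rewrite ge0_cp// pi_ge0.
pose J s := vint G s (- pi) pi.
have nE (w : C) : normc ('i * cexp w) = expR (complex.Re w).
  by rewrite Normc.normcM normc_cexp /= expr0n expr1n add0r sqrtr1 mul1r.
have Jcst : forall s1 s2, s1 <= s2 -> J s1 = J s2.
  apply: (@locally_cst_off_finite _ J [seq ln (normc (z - c)) | z <- S]).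
    move=> s e e0; exact: vint_continuous.
  move=> s1 s2 s12 avoid.
  have : rect_int G s1 s2 (- pi) pi = 0.
    apply: goursat => // w wre _.
    have [d Hd] : exists d, cdiff k (c + 'i * cexp w) d.
      apply: kD; apply/negP => wS; have /negP := avoid _ wre; apply.
      apply/mapP; exists (c + 'i * cexp w) => //.
      by rewrite addrC addKr nE expRK.
    have := cdiff_comp (cdiffD (cdiff_cst c w) (cdiffM (cdiff_cst 'i w) (cdiff_cexp w))) Hd.
    by move=> H; eexists; apply: cdiff_onW; exact: H.
  have hper : hint G (- pi) s1 s2 = hint G pi s1 s2.
    by apply: hint_vperiodic => x; rewrite /G /cexp /= cosN sinN sinpi oppr0.
  have i_neq0 : ('i : C) != 0 by rewrite eq_complex /= oner_eq0 andbF.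
  rewrite /rect_int hper /J.
  move: (hint _ _ _ _) (vint _ _ _ _) (vint _ _ _ _) => u v v'.
  rewrite subrr add0r => /(canRL (mulKf i_neq0)); rewrite mulr0.
  by move=> /subr0_eq.
have vG s t : vline G s t = k (c + (expR s)%:C * ('i * (cos t +i* sin t))).
  by rewrite vlineEE /G /cexp /= mulrCA.
have two_pi : pi - - pi = 2 * pi :> R by rewrite opprK mulr_natl mulr2n.
have pi_pos : 0 < pi :> R := pi_gt0 R.
have lim e : 0 < e -> normc (J (ln r) - (2 * pi)%:C * k c) <= 2 * (e * (2 * pi)).
  move=> e0; have [del del0 Hdel] := ck c e e0.
  pose s := Num.min (ln r) (ln (del / 2)).
  have es : expR s < del.
    apply: (@le_lt_trans _ _ (del / 2)); last by lra.
    by rewrite -[leRHS]lnK ?posrE ?divr_gt0// ler_expR ge_min lexx orbT.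
  rewrite -(Jcst s); last by rewrite ge_min lexx.
  rewrite -two_pi -cprim_cst; apply: cprim_dist => //.
  - exact: rcont_vline.
  - exact: rcont_cst.
  move=> t _; rewrite vlineEE /G; apply: ltW; apply: Hdel.
  by rewrite nE.
have JE : J (ln r) = (2 * pi)%:C * k c.
  apply/eqP; rewrite -subr_eq0 -normc_eq0 eq_le normc_ge0 andbT.
  apply/ler_addgt0Pr => e e0; rewrite add0r.
  have e1 : 0 < e / (4 * pi) by rewrite divr_gt0// mulr_gt0.
  apply: le_trans (lim _ e1) _; rewrite le_eqVlt; apply/orP; left; apply/eqP.
  by move: (pi : R) pi_pos => p p0; field; rewrite gt_eqF.
have : normc (J (ln r)) <= 2 * (2 * B * pi).
  apply: cprim_sym_bound; [exact: rcont_vline|exact: ltW|move=> t _].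
  by rewrite !vG lnK ?posrE// cosN sinN; exact: kB.
rewrite JE Normc.normcM normc_real ger0_norm; last by rewrite mulr_ge0// ltW.
rewrite mulrA [2 * (2 * B)]mulrCA -mulrA [X in _ <= X]mulrC => H.
by rewrite -(ler_pM2r (x := 2 * pi)) ?mulr_gt0//; lra.
Qed.

End CircleMeanValue.

(** * Pointwise bounds from Hardy norms *)

Section EntirePrimitive.
Variable R : realType.
Local Notation C := R[i].
Implicit Types (F k : C -> C).

Lemma cprim_dist_abs (f : R -> C) (z : C) (a b B : R) : rcont f ->
  (forall t, `|t - a| <= `|b - a| -> normc (f t - z) <= B) ->
  normc ((cprim f b - cprim f a) - (b - a)%:C * z) <= 2 * (B * `|b - a|).
Proof.
move=> cf fB; rewrite -cprim_cst.
have [ab|/ltW ba] := leP a b.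
  rewrite [`|b - a|]ger0_norm ?subr_ge0//; apply: cprim_dist => //; first exact: rcont_cst.
  move=> t /andP[t1 t2]; apply: fB.
  by rewrite !ger0_norm ?subr_ge0// lerD2r.
rewrite -normc_opp !opprB addrC [`|b - a|]ler0_norm ?subr_le0// opprB.
rewrite -[cprim (fun=> z) b - _]opprB; apply: cprim_dist => //; first exact: rcont_cst.
move=> t /andP[t1 t2]; apply: fB.
by rewrite !ler0_norm ?subr_le0// lerN2 lerD2r.
Qed.

(** Integrate from 0 along the real axis, then vertically; Goursat's theorem
    allows one to compare with the other way around the rectangle. *)
Lemma entire_primitive F : (forall z, exists d, cdiff F z d) ->
  exists g, forall z, cdiff g z (F z).
Proof.
move=> FD.
have cF z : ccont F z by case: (FD z) => d; exact: cdiff_cont.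
have rect0 a b c d : rect_int F a b c d = 0.
  have le0 a' b' c' d' : a' <= b' -> c' <= d' -> rect_int F a' b' c' d' = 0.
    move=> ab cd; apply: goursat => // z _ _; have [D HD] := FD z.
    by exists D; exact: cdiff_onW.
  have swap1 a' b' c' d' : rect_int F b' a' c' d' = - rect_int F a' b' c' d'.
    by rewrite /rect_int /hint /vint; ring.
  have swap2 a' b' c' d' : rect_int F a' b' d' c' = - rect_int F a' b' c' d'.
    by rewrite /rect_int /hint /vint; ring.
  have [ab|/ltW ab] := leP a b; have [cd|/ltW cd] := leP c d.
  - exact: le0.
  - by rewrite swap2 le0// oppr0.
  - by rewrite swap1 le0// oppr0.
  - by rewrite swap1 swap2 le0// !oppr0.
pose g z := hint F 0 0 (complex.Re z) + 'i * vint F (complex.Re z) 0 (complex.Im z).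
exists g => z e e0.
have [del del0 Hdel] := cF z (e / 4) (divr_gt0 e0 (ltr0n _ 4)).
exists (del / 2) => [|h hdel _]; first by rewrite divr_gt0.
have -> : g (z + h) - g z =
  hint F (complex.Im (z + h)) (complex.Re z) (complex.Re (z + h)) +
  'i * vint F (complex.Re z) (complex.Im z) (complex.Im (z + h)).
  apply/subr0_eq; rewrite -(rect0 (complex.Re z) (complex.Re (z + h)) 0 (complex.Im (z + h))).
  by rewrite /rect_int /g /hint /vint; ring.
have hE : h = (complex.Re (z + h) - complex.Re z)%:C +
              'i * (complex.Im (z + h) - complex.Im z)%:C.
  by apply: complex_eqP; rewrite !(cReD, cImD, cReM, cImM) /=; ring.
rewrite [X in _ - _ * X]hE.
set x := complex.Re z; set y := complex.Im z.
set x' := complex.Re (z + h); set y' := complex.Im (z + h).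
have hx : `|x' - x| <= normc h by rewrite /x' /x -cReB addrC addKr normc_Re.
have hy : `|y' - y| <= normc h by rewrite /y' /y -cImB addrC addKr normc_Im.
have -> : hint F y' x x' + 'i * vint F x y y' - F z * ((x' - x)%:C + 'i * (y' - y)%:C) =
  (hint F y' x x' - (x' - x)%:C * F z) + 'i * (vint F x y y' - (y' - y)%:C * F z) by ring.
have zE : z = x +i* y by apply: complex_eqP.
apply: le_trans (normcD _ _) _.
rewrite Normc.normcM [normc 'i]/= expr0n expr1n add0r sqrtr1 mul1r.
have close (h' : C) : normc h' <= 2 * normc h -> normc (F (z + h') - F z) <= e / 4.
  move=> hh; apply: ltW; apply: Hdel; apply: le_lt_trans hh _.
  by rewrite mulrC -ltr_pdivlMr.
have A1 : normc (hint F y' x x' - (x' - x)%:C * F z) <= 2 * (e / 4 * `|x' - x|).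
  apply: cprim_dist_abs; first exact: rcont_hline.
  move=> t ht; rewrite hlineEE.
  have -> : t +i* y' = z + ((t - x) +i* (y' - y)).
    by rewrite zE; apply: complex_eqP => /=; ring.
  apply: close; apply: le_trans (normc_le_ReIm _) _ => /=; lra.
have A2 : normc (vint F x y y' - (y' - y)%:C * F z) <= 2 * (e / 4 * `|y' - y|).
  apply: cprim_dist_abs; first exact: rcont_vline.
  move=> t ht; rewrite vlineEE.
  have -> : x +i* t = z + (0 +i* (t - y)).
    by rewrite zE; apply: complex_eqP => /=; ring.
  apply: close; apply: le_trans (normc_le_ReIm _) _ => /=.
  by rewrite normr0 add0r; have := normc_ge0 h; lra.
have A3 : e / 4 * `|x' - x| <= e / 4 * normc h by rewrite ler_wpM2l// divr_ge0// ltW.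
have A4 : e / 4 * `|y' - y| <= e / 4 * normc h by rewrite ler_wpM2l// divr_ge0// ltW.
move: A1 A2 A3 A4; lra.
Qed.

End EntirePrimitive.

Section HardyGrowth.
Variable R : realType.
Local Notation C := R[i].
Implicit Types (F E g : C -> C).

Lemma mvt_dom (Phi Psi f p : R -> R) (a b : R) :
  (forall x, is_derive x (1 : R) Phi (f x)) ->
  (forall x, is_derive x (1 : R) Psi (p x)) -> a <= b ->
  (forall x, a <= x <= b -> `|f x| <= p x) -> `|Phi b - Phi a| <= Psi b - Psi a.
Proof.
move=> D1 D2 ab fp; rewrite ler_norml; apply/andP; split.
  have := mvt_nondecr (fun x => is_deriveD (D2 x) (D1 x)) ab.
  rewrite -[(_ + _) a]/(Psi a + Phi a) -[(_ + _) b]/(Psi b + Phi b) => H.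
  suff : Psi a + Phi a <= Psi b + Phi b by lra.
  by apply: H => x /fp; rewrite ler_norml => /andP[? ?]; lra.
have := mvt_nondecr (fun x => is_deriveB (D2 x) (D1 x)) ab.
rewrite -[(_ - _) a]/(Psi a - Phi a) -[(_ - _) b]/(Psi b - Phi b) => H.
suff : Psi a - Phi a <= Psi b - Phi b by lra.
by apply: H => x /fp; rewrite ler_norml => /andP[? ?]; lra.
Qed.

Lemma line_cont (k : C -> C) (y : R) : (forall x, exists d, cdiff k (x +i* y) d) ->
  continuous (fun x => complex.Re (k (x +i* y))) /\
  continuous (fun x => complex.Im (k (x +i* y))).
Proof.
move=> kD; have H x : exists d, has_derivC (hline k y) x d.
  have [d Hd] := kD x; exists (d * 1); apply: cdiff_line; rewrite hlineE; exact: Hd.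
have E : hline k y = fun x => k (x +i* y) by apply/funext => x; rewrite hlineEE.
by split=> x; have [d] := H x; rewrite E => -[D1 D2];
  [exact: derive_cont D1|exact: derive_cont D2].
Qed.

Lemma line_normc2_cont (k : C -> C) (y : R) : (forall x, exists d, cdiff k (x +i* y) d) ->
  continuous (fun x => normc (k (x +i* y)) ^+ 2).
Proof.
move=> /line_cont[c1 c2] x.
under eq_fun do rewrite sqr_normc.
apply: cvgD; rewrite !expr2.
  by under eq_fun do rewrite expr2; apply: cvgM; exact: c1.
by under eq_fun do rewrite expr2; apply: cvgM; exact: c2.
Qed.

(** The increment of the primitive g of F along a chord of length h is the
    integral of E (F / E).  The Cauchy-Schwarz inequality is replaced by the bound
    |F| <= A (eta |F / E|^2 + 1 / eta) / 2 with eta = sqrt h. *)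
Lemma chord_bound F E g (M A y x1 x2 : R) :
  (forall z, cdiff g z (F z)) -> (forall z, exists d, cdiff F z d) ->
  (forall z, exists d, cdiff E z d) -> (forall x, E (x +i* y) != 0) ->
  (\int[lebesgue_measure]_x ((normc (F (x +i* y) / E (x +i* y))) ^+ 2)%:E <= M%:E)%E ->
  x1 < x2 -> (forall x, x1 <= x <= x2 -> normc (E (x +i* y)) <= A) ->
  normc (g (x2 +i* y) - g (x1 +i* y)) <= A * Num.sqrt (x2 - x1) * (M + 1).
Proof.
move=> gD FD ED E0 HM x12 EA.
pose q x := normc (F (x +i* y) / E (x +i* y)) ^+ 2.
have cq : continuous q.
  apply: (@line_normc2_cont (fun z => F z / E z)) => x.
  have [d Hd] := FD (x +i* y); have [e He] := ED (x +i* y).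
  exact: cdiff_div Hd He (E0 x).
have q0 x : 0 <= q x by exact: sqr_ge0.
pose eta := Num.sqrt (x2 - x1).
have eta0 : 0 < eta by rewrite sqrtr_gt0 subr_gt0.
have eta2 : eta ^+ 2 = x2 - x1 by rewrite sqr_sqrtr// subr_ge0 ltW.
have A0 : 0 <= A by apply: le_trans (EA x1 _); rewrite ?normc_ge0// lexx ltW.
have TM : prim q x2 - prim q x1 <= M.
  rewrite -lee_fin -(antiderivative_Rintegral cq (primP cq) x12).
  apply: le_trans HM; apply: ge0_subset_integral => //.
  - apply/measurable_EFinP; exact: continuous_measurable_fun.
  - by move=> x _; rewrite lee_fin.
pose Psi : R -> R := (A / 2) \*: (eta \*: prim q + eta^-1 \*: (id : R -> R)).
have PsiD x : is_derive x (1 : R) Psi (A / 2 * (eta * q x + eta^-1)).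
  apply: is_derive_eq (is_deriveZ (A / 2) (is_deriveD (is_deriveZ eta (primP cq x))
    (is_deriveZ eta^-1 (is_derive_id x (1 : R))))) _.
  by rewrite /GRing.scale /= mulr1.
have F_le x : x1 <= x <= x2 -> normc (F (x +i* y)) <= A / 2 * (eta * q x + eta^-1).
  move=> hx; have := EA x hx; have E1 := E0 x.
  have -> : F (x +i* y) = E (x +i* y) * (F (x +i* y) / E (x +i* y)) by rewrite mulrCA mulfV// mulr1.
  rewrite Normc.normcM /q; set u := normc (_ / _); move=> h.
  have u0 : 0 <= u by exact: normc_ge0.
  rewrite -mulrA; apply: ler_pM => //; first exact: normc_ge0.
  have ei0 : 0 < eta^-1 by rewrite invr_gt0.
  have ee : eta * eta^-1 = 1 by rewrite mulfV// gt_eqF.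
  have : 0 <= eta * (u - eta^-1) ^+ 2 by rewrite mulr_ge0 ?sqr_ge0 ?ltW.
  nra.
have PsiE : 2 * (Psi x2 - Psi x1) <= A * eta * (M + 1).
  have -> : 2 * (Psi x2 - Psi x1) =
      A * (eta * (prim q x2 - prim q x1) + eta^-1 * (x2 - x1)).
    rewrite -[Psi x2]/(A / 2 * (eta * prim q x2 + eta^-1 * x2)).
    rewrite -[Psi x1]/(A / 2 * (eta * prim q x1 + eta^-1 * x1)).
    by move: (prim q) eta^-1 => u v; field.
  have -> : eta^-1 * (x2 - x1) = eta by rewrite -eta2 expr2 mulKf// gt_eqF.
  have : eta * (prim q x2 - prim q x1) <= eta * M by rewrite ler_wpM2l// ltW.
  by rewrite -mulrA => h; rewrite ler_wpM2l// [leRHS]mulrDr mulr1 lerD2r.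
have gl x : has_derivC (fun x => g (x +i* y)) x (F (x +i* y)).
  have := cdiff_line (gD ('i * y%:C + x%:C * 1)).
  by under eq_fun do rewrite hlineE; rewrite hlineE mulr1.
apply: le_trans PsiE; apply: normc_ReIm_le; rewrite ?cReB ?cImB.
- apply: (mvt_dom (fun x => (gl x).1) PsiD (ltW x12)) => x /F_le.
  exact: le_trans (normc_Re _).
- apply: (mvt_dom (fun x => (gl x).2) PsiD (ltW x12)) => x /F_le.
  exact: le_trans (normc_Im _).
Qed.

End HardyGrowth.

Section HardyPointwise.
Variable R : realType.
Local Notation C := R[i].
Implicit Types (F E g : C -> C).

Lemma ccontD F E z : ccont F z -> ccont E z -> ccont (fun z => F z + E z) z.
Proof.
move=> hF hE e e0; have [d1 d10 H1] := hF (e / 2) (divr_gt0 e0 (ltr0n _ 2)).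
have [d2 d20 H2] := hE (e / 2) (divr_gt0 e0 (ltr0n _ 2)).
exists (Num.min d1 d2) => [|h]; first by rewrite lt_min d10.
rewrite lt_min => /andP[/H1 h1 /H2 h2]; rewrite opprD addrACA.
by apply: le_lt_trans (normcD _ _) _; lra.
Qed.

Lemma near_ccont F E z (del : R) : 0 < del ->
  (forall h, normc h < del -> F (z + h) = E (z + h)) -> ccont F z -> ccont E z.
Proof.
move=> del0 FE hF e e0; have [d1 d10 H] := hF e e0.
exists (Num.min del d1) => [|h]; first by rewrite lt_min del0.
rewrite lt_min => /andP[h1 h2]; rewrite -FE// -[in E z](addr0 z) -FE ?addr0 ?Normc.normc0//.
exact: H.
Qed.

(** The singularity of the difference quotient at z0 is removable. *)
Lemma ccont_quotient g z0 d : cdiff g z0 d ->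
  ccont (fun z => if z == z0 then d else (g z - g z0) / (z - z0)) z0.
Proof.
move=> gD e e0; have [del del0 H] := gD (e / 2) (divr_gt0 e0 (ltr0n _ 2)).
exists del => // h /H /(_ I) hh; rewrite eqxx.
case: eqP => [_|/eqP zh]; first by rewrite subrr Normc.normc0.
have h0 : h != 0 by apply: contraNneq zh => ->; rewrite addr0.
rewrite addrAC subrr add0r.
have -> : (g (z0 + h) - g z0) / h - d = (g (z0 + h) - g z0 - d * h) / h.
  by field.
rewrite Normc.normcM Normc.normcV ltr_pdivrMr ?normc_gt0//.
apply: le_lt_trans hh _; rewrite ltr_pM2r ?normc_gt0//; lra.
Qed.

Lemma sqr_norm_le1 (x : R) : (x ^+ 2 <= 1) = (`|x| <= 1).
Proof. by rewrite -real_normK ?num_real// expr_le1. Qed.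

Lemma ler_sqr_norm (x y : R) : (`|x| <= y) -> (x ^+ 2 <= y ^+ 2).
Proof.
move=> h; rewrite -(real_normK (num_real x)) lerXn2r// nnegrE//.
by apply: le_trans h.
Qed.

(** Let g be a primitive of F, and rho half the distance from z0 to the real
    axis.  The function
      k(z) = (g(z) - g(z0)) (1 / (z - z0) + (z - z0) / rho^2)
    is continuous with k(z0) = F(z0).  At z = z0 + rho v with |v| = 1 its second
    factor is 2 Re v / rho, which takes opposite values at the mirror points
    i (cos t + i sin t) and i (cos t - i sin t): the sum of the values of k there
    only involves the increment of g along a horizontal chord, which the Hardy
    norm controls. *)
Lemma hardy_pointwise F E (M A : R) (z0 : C) :
  (forall z, exists d, cdiff F z d) -> (forall z, exists d, cdiff E z d) ->
  (forall z, 0 < complex.Im z -> E z != 0) ->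
  (forall y : R, 0 < y -> (\int[lebesgue_measure]_x
     ((normc (F (x +i* y) / E (x +i* y))) ^+ 2)%:E <= M%:E)%E) ->
  0 < complex.Im z0 ->
  (forall z, normc (z - z0) <= complex.Im z0 / 2 -> normc (E z) <= A) ->
  normc (F z0) <= 4 * A * (M + 1) / Num.sqrt (complex.Im z0).
Proof.
move=> FD ED E0 HM y0 EA.
have [g gD] := entire_primitive FD.
pose rho := complex.Im z0 / 2.
have rho0 : 0 < rho by rewrite divr_gt0.
pose k (z : C) : C := (if z == z0 then F z0 else (g z - g z0) / (z - z0)) +
            (g z - g z0) * (z - z0) / (rho ^+ 2)%:C.
have kz0 : k z0 = F z0 by rewrite /k eqxx subrr mul0r mul0r addr0.
have regD z : exists d, cdiff (fun z => (g z - g z0) * (z - z0) / (rho ^+ 2)%:C) z d.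
  eexists; exact: (cdiffM (cdiffM (cdiffB (gD z) (cdiff_cst (g z0) z))
    (cdiffB (cdiff_id z) (cdiff_cst z0 z))) (cdiff_cst ((rho ^+ 2)%:C^-1) z)).
have quotD z : z != z0 -> exists d, cdiff
    (fun z => if z == z0 then F z0 else (g z - g z0) / (z - z0)) z d.
  move=> zz0; have zz1 : z - z0 != 0 by rewrite subr_eq0.
  have [d Hd] := cdiff_div (cdiffB (gD z) (cdiff_cst (g z0) z))
    (cdiffB (cdiff_id z) (cdiff_cst z0 z)) zz1.
  exists d; apply: (near_cdiff (del := normc (z - z0)) _ _ Hd) => [|h].
    by rewrite normc_gt0.
  case: eqP => // <-.
  by rewrite opprD addrA subrr sub0r normc_opp ltxx.
have kD z : z \notin [:: z0] -> exists d, cdiff k z d.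
  rewrite inE => /quotD[d1 H1]; have [d2 H2] := regD z.
  by exists (d1 + d2); exact: cdiffD.
have ck z : ccont k z.
  have [->|zz0] := eqVneq z z0; last first.
    by have [|d] := kD z; [rewrite inE|exact: cdiff_cont].
  apply: ccontD; first exact: ccont_quotient.
  by have [d] := regD z0; exact: cdiff_cont.
have sq0 : 0 < Num.sqrt (complex.Im z0) by rewrite sqrtr_gt0.
have M0 : 0 <= M.
  rewrite -lee_fin; apply: le_trans (HM _ y0); apply: integral_ge0 => x _.
  by rewrite lee_fin sqr_ge0.
have A0 : 0 <= A.
  apply: le_trans (EA z0 _); first exact: normc_ge0.
  by rewrite subrr Normc.normc0 ltW.
have -> : 4 * A * (M + 1) / Num.sqrt (complex.Im z0) =
  2 * (2 * A * (M + 1) / Num.sqrt (complex.Im z0)) by field; rewrite gt_eqF.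
rewrite -kz0; apply: (circle_mean_bound ck kD rho0) => t.
set u := 'i * (cos t +i* sin t); set u' := 'i * (cos t -i* sin t).
have n1 : normc u = 1.
  by rewrite Normc.normcM /= expr0n expr1n add0r sqrtr1 mul1r cos2Dsin2 sqrtr1.
have n1' : normc u' = 1.
  by rewrite Normc.normcM /= expr0n expr1n add0r sqrtr1 mul1r sqrrN cos2Dsin2 sqrtr1.
have kv (v : C) : normc v = 1 -> k (z0 + rho%:C * v) =
    (g (z0 + rho%:C * v) - g z0) * (v^-1 + v) / rho%:C.
  move=> nv; have v0 : v != 0 by rewrite -normc_gt0 nv.
  have r0 : rho%:C != 0 :> C by rewrite -normc_gt0 normc_real gtr0_norm.
  rewrite /k ifF; last first.
    by apply/negbTE; rewrite -subr_eq0 addrAC subrr add0r mulf_neq0.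
  rewrite addrAC subrr add0r rmorphXn /=; field.
  by rewrite v0 r0.
have uV : u^-1 + u = (- (2 * sin t))%:C.
  have -> : u^-1 = u^*.
    apply: (mulfI (x := u)); first by rewrite -normc_gt0 n1.
    rewrite mulfV; last by rewrite -normc_gt0 n1.
    apply: complex_eqP; rewrite /= ?mul0r ?mul1r ?sub0r ?add0r ?addr0 /=.
      by rewrite -(cos2Dsin2 t); ring.
    by ring.
  by apply: complex_eqP => /=; ring.
have uV' : u'^-1 + u' = (2 * sin t)%:C.
  have -> : u'^-1 = u'^*.
    apply: (mulfI (x := u')); first by rewrite -normc_gt0 n1'.
    rewrite mulfV; last by rewrite -normc_gt0 n1'.
    apply: complex_eqP; rewrite /= ?mul0r ?mul1r ?sub0r ?add0r ?addr0 /=.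
      by rewrite -(cos2Dsin2 t); ring.
    by ring.
  by apply: complex_eqP => /=; ring.
rewrite !kv// uV uV'.
have -> : (g (z0 + rho%:C * u) - g z0) * (- (2 * sin t))%:C / rho%:C +
  (g (z0 + rho%:C * u') - g z0) * (2 * sin t)%:C / rho%:C =
  (g (z0 + rho%:C * u') - g (z0 + rho%:C * u)) * ((2 * sin t) / rho)%:C.
  by move: (2 * sin t) (rho) => q p; rewrite rmorphN rmorphM fmorphV /=; ring.
(* The chord at height rho c has half-length rho s, and length at most Im z0. *)
have chord (s c : R) : 0 < s -> c ^+ 2 + s ^+ 2 = 1 ->
    normc (g ((complex.Re z0 + rho * s) +i* (complex.Im z0 + rho * c)) -
           g ((complex.Re z0 - rho * s) +i* (complex.Im z0 + rho * c))) <=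
    A * Num.sqrt (complex.Im z0) * (M + 1).
  move=> s0 cs1.
  have y1 : 0 < complex.Im z0 + rho * c.
    have : `|c| <= 1 by rewrite -sqr_norm_le1 -cs1 lerDl sqr_ge0.
    by rewrite ler_norml /rho => /andP[? ?]; move: y0; nra.
  apply: le_trans (@chord_bound _ F E g M A _ _ _ gD FD ED _ (HM _ y1) _ _) _.
  - by move=> x; exact: E0.
  - by rewrite ltrD2l; have := mulr_gt0 rho0 s0; lra.
  - move=> x /andP[x1 x2]; apply: EA.
    rewrite -(ler_pXn2r (n := 2)) ?nnegrE ?normc_ge0 ?(ltW rho0)//.
    rewrite sqr_normc cReB cImB /= -/rho.
    have -> : rho ^+ 2 = (rho * s) ^+ 2 + (rho * c) ^+ 2.
      by rewrite !exprMn -mulrDr addrC cs1 mulr1.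
    rewrite lerD//; last by rewrite addrAC subrr add0r.
    by apply: ler_sqr_norm; rewrite ler_norml; apply/andP; split; lra.
  rewrite ler_wpM2r//; first by rewrite addr_ge0.
  rewrite ler_wpM2l// ler_wsqrtr//.
  have s1 : s <= 1.
    have : `|s| <= 1 by rewrite -sqr_norm_le1 -cs1 lerDr sqr_ge0.
    by apply: le_trans; exact: ler_norm.
  have -> : complex.Im z0 = 2 * rho by rewrite /rho mulrC divfK.
  move: rho0 s1; nra.
have zu : z0 + rho%:C * u = (complex.Re z0 - rho * sin t) +i* (complex.Im z0 + rho * cos t).
  by apply: complex_eqP; rewrite ?cReD ?cImD /=; ring.
have zu' : z0 + rho%:C * u' = (complex.Re z0 + rho * sin t) +i* (complex.Im z0 + rho * cos t).
  by apply: complex_eqP; rewrite ?cReD ?cImD /=; ring.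
rewrite Normc.normcM normc_real zu zu'.
have chord_t : normc (g ((complex.Re z0 + rho * sin t) +i* (complex.Im z0 + rho * cos t)) -
           g ((complex.Re z0 - rho * sin t) +i* (complex.Im z0 + rho * cos t))) <=
    A * Num.sqrt (complex.Im z0) * (M + 1).
  have [s0|s0|s0] := ltgtP (sin t) 0.
  - rewrite normc_dist.
    have := chord (- sin t) (cos t); rewrite mulrN opprK oppr_gt0 sqrrN.
    by apply => //; exact: cos2Dsin2.
  - by apply: chord => //; exact: cos2Dsin2.
  - by rewrite s0 !mulr0 addr0 subr0 subrr Normc.normc0 !mulr_ge0 ?addr_ge0 ?sqrtr_ge0.
have sin1 : `|2 * sin t / rho| <= 2 / rho.
  have : `|sin t| <= 1 by rewrite ler_norml sin_geN1 sin_le1.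
  move: (sin t) (rho) rho0 => s r r0 hs.
  rewrite normrM normrM normfV (gtr0_norm r0) ler_pM2r ?invr_gt0//.
  rewrite ger0_norm//; lra.
apply: le_trans (ler_pM _ _ chord_t sin1) _; rewrite ?normc_ge0//.
rewrite le_eqVlt; apply/orP; left; apply/eqP.
have sq2 : complex.Im z0 = Num.sqrt (complex.Im z0) ^+ 2 by rewrite sqr_sqrtr// ltW.
rewrite /rho; move: (Num.sqrt (complex.Im z0)) sq2 sq0 => q; move: (complex.Im z0) => y -> q0.
by field; rewrite gt_eqF.
Qed.

End HardyPointwise.

(** * Entire functions of polynomial growth off the real axis *)

Section Liouville.
Variable R : realType.
Local Notation C := R[i].

Lemma ccontM (f g : C -> C) z : ccont f z -> ccont g z -> ccont (fun z => f z * g z) z.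
Proof.
move=> cf cg e e0.
have [e1 [e10 e11 e1e]] : exists e1,
    [/\ 0 < e1, e1 <= 1 & e1 * (1 + normc (f z) + normc (g z)) <= e / 2].
  have S0 : 0 < 1 + normc (f z) + normc (g z).
    by rewrite -addrA ltr_pwDl// addr_ge0// normc_ge0.
  exists (Num.min 1 (e / 2 / (1 + normc (f z) + normc (g z)))).
  rewrite lt_min ltr01 !divr_gt0// ge_min lexx; split => //.
  by rewrite -ler_pdivlMr// ge_min lexx orbT.
have [d1 d10 H1] := cf e1 e10; have [d2 d20 H2] := cg e1 e10.
exists (Num.min d1 d2) => [|h]; first by rewrite lt_min d10.
rewrite lt_min => /andP[/H1 h1 /H2 h2].
have -> : f (z + h) * g (z + h) - f z * g z =
  (f (z + h) - f z) * (g (z + h) - g z) + (f z * (g (z + h) - g z) + g z * (f (z + h) - f z)) by ring.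
apply: le_lt_trans (normcD _ _) _.
apply: le_lt_trans (lerD (lexx _) (normcD _ _)) _.
rewrite !Normc.normcM.
have f0 := normc_ge0 (f z); have g0 := normc_ge0 (g z).
move: h1 h2 (normc_ge0 (f (z + h) - f z)) (normc_ge0 (g (z + h) - g z)).
set u := normc (f (z + h) - f z); set v := normc (g (z + h) - g z) => h1 h2 u0 v0.
have k1 : u * v <= e1 by rewrite -[e1]mulr1; apply: ler_pM => //; lra.
have k2 : normc (f z) * v <= normc (f z) * e1 by rewrite ler_wpM2l// ltW.
have k3 : normc (g z) * u <= normc (g z) * e1 by rewrite ler_wpM2l// ltW.
by move: e1e; lra.
Qed.

(** The quotient of D, whose derivative is dD, by the product of the z - l for l in
    s; at a point of s, where D vanishes, the factor z - l is replaced by its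
    limit. *)
Definition deflate (D : C -> C) (dD : C -> C) (s : seq C) (z : C) : C :=
  (if z \in s then dD z else D z) / \prod_(l <- s | l != z) (z - l).

Lemma prod_sub_neq0 (s : seq C) (z : C) : \prod_(l <- s | l != z) (z - l) != 0.
Proof.
rewrite prodf_seq_neq0; apply/allP => l _; apply/implyP => lz.
by rewrite subr_eq0 eq_sym.
Qed.

Lemma cdiff_prod (s : seq C) (P : pred C) z :
  exists d, cdiff (fun z => \prod_(l <- s | P l) (z - l)) z d.
Proof.
elim: s => [|l s [d IH]].
  by exists 0; under eq_fun do rewrite big_nil; exact: cdiff_cst.
case Pl: (P l).
  eexists; under eq_fun do rewrite big_cons Pl.
  exact: cdiffM (cdiffB (cdiff_id z) (cdiff_cst l z)) IH.
by exists d; under eq_fun do rewrite big_cons Pl.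
Qed.

Lemma seq_isolated (s : seq C) (z : C) :
  exists2 del : R, 0 < del & forall h, normc h < del -> z + h \in s -> h = 0.
Proof.
elim: s => [|l s [del del0 IH]]; first by exists 1.
have [lz|lz] := eqVneq l z.
  exists del => // h /IH{}IH; rewrite inE => /orP[/eqP|//].
  by rewrite lz -[RHS]addr0 => /addrI.
exists (Num.min del (normc (l - z))) => [|h].
  by rewrite lt_min del0 normc_gt0 subr_eq0.
rewrite lt_min => /andP[/IH{}IH hl]; rewrite inE => /orP[/eqP zl|//].
by move: hl; rewrite -zl addrAC subrr add0r ltxx.
Qed.

Lemma deflate_cdiff (D dD : C -> C) (s : seq C) z : (forall z, cdiff D z (dD z)) ->
  z \notin s -> exists d, cdiff (deflate D dD s) z d.
Proof.
move=> DD zs; have [d Hd] := cdiff_prod s predT z.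
have p0 : \prod_(l <- s) (z - l) != 0.
  rewrite prodf_seq_neq0; apply/allP => l ls /=; rewrite subr_eq0.
  by apply: contraNneq zs => ->.
have [d' Hd'] := cdiff_div (DD z) Hd p0; exists d'.
have [del del0 iso] := seq_isolated s z.
apply: (near_cdiff del0 _ Hd') => h hdel.
have zhs : z + h \notin s.
  apply/negP => zh; have h0 := iso h hdel zh.
  by move: zs; rewrite -[z]addr0 -h0 zh.
rewrite /deflate (negbTE zhs); congr (_ / _).
rewrite big_mkcond [RHS]big_mkcond; apply: eq_big_seq => l ls.
by case: eqP => //= lz; move: zhs; rewrite -lz ls.
Qed.

Lemma deflate_ccont (D dD : C -> C) (s : seq C) z : (forall z, cdiff D z (dD z)) ->
  uniq s -> (forall l, l \in s -> D l = 0) -> ccont (deflate D dD s) z.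
Proof.
move=> DD us Ds.
have [zs|zs] := boolP (z \in s); last first.
  by have [d] := deflate_cdiff DD zs; exact: cdiff_cont.
have [d Hd] := cdiff_prod s (fun l => l != z) z.
have [d' Hd'] := cdiff_div (cdiff_cst 1 z) Hd (prod_sub_neq0 s z).
have [del del0 iso] := seq_isolated s z.
apply: (near_ccont del0 _ (ccontM (ccont_quotient (DD z)) (cdiff_cont Hd'))) => h hdel.
rewrite /deflate.
have [->|h0] := eqVneq h 0; first by rewrite addr0 eqxx zs div1r.
have zhs : z + h \notin s by apply/negP => /(iso h hdel)/eqP; apply/negP.
rewrite (negbTE zhs) ifF; last by apply/negbTE; rewrite -subr_eq0 addrAC subrr add0r.
rewrite (Ds z zs) subr0 div1r -mulrA -invfM; congr (_ / _).
rewrite [RHS]big_mkcond/=; transitivity (\prod_(l <- s) (z + h - l)).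
  by rewrite (bigD1_seq z).
by apply: eq_big_seq => l ls; case: eqP => //= lz; move: zhs; rewrite -lz ls.
Qed.

(** The quotient H of D by the product of the z - l satisfies
    |H(z)| sqrt |Im z| <= const for large z.  To bound H(w) with w = u + i v, apply
    the mean value bound on the circle of centre w and radius r to the product of
    H by (z - u)^2 - (r^2 - v^2).  The modulus of this factor is 2 r |Im z| on the
    circle, which compensates the singularity of the bound at the real axis, and
    r^2 at the centre; hence |H(w)| = O(r^(- 1 / 2)). *)
Theorem polynomial_growth_liouville (D : C -> C) (s : seq C) (K : R) :
  (forall z, exists d, cdiff D z d) -> uniq s -> (forall l, l \in s -> D l = 0) ->
  (forall z, normc (D z) * Num.sqrt `|complex.Im z| <= K * (1 + normc z) ^+ size s) ->
  forall z, D z = 0.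
Proof.
move=> /choice[dD DD] us Ds DK w.
have [|ws] := boolP (w \in s); first exact: Ds.
pose H := deflate D dD s.
have HD z : z \notin s -> exists d, cdiff H z d by exact: deflate_cdiff.
have cH z : ccont H z by exact: deflate_ccont.
have Hw : H w = D w / \prod_(l <- s) (w - l).
  rewrite /H /deflate (negbTE ws); congr (_ / _); rewrite big_mkcond/=.
  by apply: eq_big_seq => l ls; case: eqP => //= lw; move: ws; rewrite -lw ls.
suff H0 : H w = 0.
  move: H0; rewrite Hw => /eqP; rewrite mulf_eq0 invr_eq0 => /orP[/eqP//|].
  have /negP Hn := prod_sub_neq0 s w; move=> p0; exfalso; apply: Hn.
  rewrite big_mkcond/=; rewrite -(eqP p0); apply/eqP.
  by apply: eq_big_seq => l ls; case: eqP => //= lw; move: ws; rewrite -lw ls.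
have K0 : 0 <= K.
  have := DK 0; rewrite Normc.normc0 addr0 expr1n mulr1; apply: le_trans.
  by rewrite mulr_ge0// ?normc_ge0// sqrtr_ge0.
pose Lam : R := 1 + \sum_(l <- s) normc l.
have Lam1 : 1 <= Lam by rewrite lerDl sumr_ge0// => l _; exact: normc_ge0.
have LamP l : l \in s -> normc l <= Lam.
  move=> ls; rewrite /Lam (big_rem l ls)/= addrCA lerDl addr_ge0//.
  by rewrite sumr_ge0// => *; exact: normc_ge0.
set n := size s.
(* Far away, each factor z - l has modulus at least |z| / 2. *)
have far z : 2 * Lam <= normc z -> normc (H z) * Num.sqrt `|complex.Im z| <= K * 4 ^+ n.
  move=> zL.
  have zs : z \notin s by apply/negP => /LamP; lra.
  have -> : H z = D z / \prod_(l <- s) (z - l).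
    rewrite /H /deflate (negbTE zs); congr (_ / _); rewrite big_mkcond/=.
    by apply: eq_big_seq => l ls; case: eqP => //= lw; move: zs; rewrite -lw ls.
  have low : (normc z / 2) ^+ n <= normc (\prod_(l <- s) (z - l)).
    rewrite /n; elim: (s) LamP => [|l s' IH] LamP'.
      by rewrite big_nil Normc.normc1 expr0.
    rewrite big_cons Normc.normcM exprS; apply: ler_pM.
    - by rewrite divr_ge0// normc_ge0.
    - by rewrite exprn_ge0// divr_ge0// normc_ge0.
    - have := LamP' l (mem_head _ _); have := normcD (z - l) l; rewrite subrK; lra.
    - by apply: IH => l' ls'; apply: LamP'; rewrite inE ls' orbT.
  have z2 : 0 < normc z / 2 by lra.
  have p0 : 0 < (normc z / 2) ^+ n by rewrite exprn_gt0.
  rewrite Normc.normcM Normc.normcV mulrAC ler_pdivrMr; last exact: lt_le_trans low.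
  apply: le_trans (DK z) _; rewrite -mulrA ler_wpM2l//.
  apply: (@le_trans _ _ (4 ^+ n * (normc z / 2) ^+ n)); last first.
    by rewrite ler_wpM2l// exprn_ge0.
  rewrite -exprMn lerXn2r ?nnegrE//; lra.
have [v vE] : exists v, v = complex.Im w by exists (complex.Im w).
have [u uE] : exists u, u = complex.Re w by exists (complex.Re w).
have wE : w = u +i* v by rewrite uE vE; case: (w).
have bound (t : R) : 1 <= t -> 2 * Lam + 2 * normc w <= t ->
    normc (H w) <= 8 * (K * 4 ^+ n) / t.
  move=> t1 tL.
  have t0 : 0 < t by lra.
  (* The radius is t^2, so that square roots become polynomial in t. *)
  pose r := t ^+ 2.
  have rt : t <= r by rewrite /r expr2; nra.
  have r0 : 0 < r by lra.
  pose M (z : C) : C := (z - u%:C) ^+ 2 - (r ^+ 2 - v ^+ 2)%:C.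
  have MD z : exists d, cdiff M z d.
    eexists; have dz := cdiffB (cdiff_id z) (cdiff_cst u%:C z).
    have := cdiffB (cdiffM dz dz) (cdiff_cst (r ^+ 2 - v ^+ 2)%:C z).
    by under eq_fun do rewrite -expr2; exact.
  have Mw : M w = - (r ^+ 2)%:C.
    rewrite /M wE; apply: complex_eqP => /=; ring.
  have ME (e : C) : normc e = 1 ->
      normc (M (w + r%:C * e)) = 2 * r * `|complex.Im (w + r%:C * e)|.
    move=> e1.
    have ee : complex.Re e ^+ 2 + complex.Im e ^+ 2 = 1 by rewrite -sqr_normc e1 expr1n.
    have -> : M (w + r%:C * e) = (2 * r * complex.Im (w + r%:C * e))%:C * ('i * e).
      rewrite /M wE; move: ee; case: e {e1} => p q /= ee.
      apply: complex_eqP => /=.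
        transitivity (r ^+ 2 * (p ^+ 2 - q ^+ 2 - 1) - 2 * v * r * q); first by ring.
        by rewrite (_ : p ^+ 2 = 1 - q ^+ 2); [ring|rewrite -ee addrK].
      by ring.
    rewrite Normc.normcM normc_real Normc.normcM e1 mulr1.
    rewrite [normc 'i]/= expr0n expr1n add0r sqrtr1 mulr1.
    by rewrite normrM ger0_norm// mulr_ge0// ltW.
  have HM z : z \notin s -> exists d, cdiff (fun z => H z * M z) z d.
    move=> /HD[d1 h1]; have [d2 h2] := MD z.
    by eexists; exact: cdiffM h1 h2.
  have cHM z : ccont (fun z => H z * M z) z.
    by apply: ccontM => //; have [d] := MD z; exact: cdiff_cont.
  have on_circle (e : C) : normc e = 1 ->
      normc (H (w + r%:C * e) * M (w + r%:C * e)) <= 4 * (K * 4 ^+ n) * r * t.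
    move=> e1; rewrite Normc.normcM ME//.
    set z := w + r%:C * e.
    have nz : r - normc w <= normc z.
      have := normcB (w + r%:C * e) w; rewrite addrAC subrr add0r Normc.normcM normc_real e1.
      by rewrite mulr1 gtr0_norm// -/z; lra.
    have nz' : normc z <= r + normc w.
      have := normcD w (r%:C * e); rewrite Normc.normcM normc_real e1.
      by rewrite mulr1 gtr0_norm// -/z; lra.
    have zL : 2 * Lam <= normc z by have := normc_ge0 w; lra.
    have sq2t : Num.sqrt `|complex.Im z| <= 2 * t.
      rewrite -[leRHS]ger0_norm; last by lra.
      rewrite -[leRHS]sqrtr_sqr ler_wsqrtr//; apply: le_trans (normc_Im _) _.
      by apply: le_trans nz' _; rewrite exprMn -/r; have := normc_ge0 w; lra.
    have := far z zL.
    have -> : 2 * r * `|complex.Im z| = 2 * r * Num.sqrt `|complex.Im z| ^+ 2.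
      by rewrite sqr_sqrtr.
    move: sq2t (sqrtr_ge0 `|complex.Im z|); set q := Num.sqrt `|complex.Im z|.
    move=> q2 q0 hq.
    have KK : 0 <= K * 4 ^+ n by rewrite mulr_ge0// exprn_ge0.
    have -> : normc (H z) * (2 * r * q ^+ 2) = 2 * r * ((normc (H z) * q) * q) by ring.
    have -> : 4 * (K * 4 ^+ n) * r * t = 2 * r * ((K * 4 ^+ n) * (2 * t)) by ring.
    rewrite ler_wpM2l//; first by lra.
    by apply: ler_pM => //; rewrite mulr_ge0// normc_ge0.
  have ni (c d : R) : c ^+ 2 + d ^+ 2 = 1 -> normc ('i * (c +i* d)) = 1.
    move=> cd; rewrite Normc.normcM [normc 'i]/= expr0n expr1n add0r sqrtr1 mul1r.
    by rewrite /= cd sqrtr1.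
  have := @circle_mean_bound R (fun z => H z * M z) s w r (4 * (K * 4 ^+ n) * r * t)
    cHM HM r0.
  move=> /(_ _) circ.
  have : normc (H w * M w) <= 2 * (4 * (K * 4 ^+ n) * r * t).
    apply: circ => th; apply: le_trans (normcD _ _) _.
    by rewrite mulr_natl mulr2n; apply: lerD; apply: on_circle; apply: ni;
      rewrite ?sqrrN cos2Dsin2.
  rewrite Mw Normc.normcM normc_opp normc_real ger0_norm ?sqr_ge0//.
  rewrite -ler_pdivlMr ?exprn_gt0// => h; apply: le_trans h _.
  rewrite le_eqVlt; apply/orP; left; apply/eqP; rewrite /r.
  move: (K * 4 ^+ n) => KK; field; rewrite gt_eqF//.
apply/eqP; rewrite -normc_eq0 eq_le normc_ge0 andbT.
apply/ler_addgt0Pr => e e0; rewrite add0r.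
pose t := 1 + (2 * Lam + 2 * normc w) + 8 * (K * 4 ^+ n) / e.
have KK : 0 <= 8 * (K * 4 ^+ n) by rewrite !mulr_ge0// exprn_ge0.
have Ke : 0 <= 8 * (K * 4 ^+ n) / e by rewrite divr_ge0// ltW.
have nw := normc_ge0 w.
apply: le_trans (bound t _ _) _; rewrite /t; [lra|lra|].
rewrite ler_pdivrMr; last by lra.
rewrite mulrDr mulrC [e * (_ / e)]mulrC divfK ?gt_eqF//.
by rewrite lerDr mulr_ge0// ?ltW//; lra.
Qed.

End Liouville.

(** * Jacobi matrices and their spectral data *)

Section JacobiRecursion.
Variable R : realType.
Local Notation C := R[i].
Variables (a b : nat -> R).

Lemma phi_rec n : 0 < a n.+1 -> a n.+1 *: phi a b n.+2 =
  ('X - (b n.+1)%:P) * phi a b n.+1 - a n *: phi a b n.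
Proof. by move=> a0; rewrite /= scalerA mulfV ?gt_eqF// scale1r. Qed.

(** The right-hand side of the recursion: at the last index, where no next
    polynomial exists, its roots are the eigenvalues. *)
Definition phiQ n : {poly R} := ('X - (b n.+1)%:P) * phi a b n.+1 - a n *: phi a b n.

Definition phiQC n (z : C) : C :=
  (z - (b n.+1)%:C) * phiC a b n.+1 z - (a n)%:C * phiC a b n z.

Lemma phiQCE n z : phiQC n z = (map_poly (real_complex R) (phiQ n)).[z].
Proof.
rewrite /phiQC /phiQ /phiC rmorphB rmorphM /= map_polyZ rmorphB /= map_polyX map_polyC /=.
by rewrite !(hornerD, hornerN, hornerM, hornerZ, hornerX, hornerC).
Qed.

Lemma phiC_rec n z : 0 < a n.+1 -> (a n.+1)%:C * phiC a b n.+2 z = phiQC n z.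
Proof.
move=> a0; rewrite phiQCE /phiQ -phi_rec// /phiC.
by rewrite [in RHS]map_polyZ hornerZ.
Qed.

Lemma phiC1 z : phiC a b 1 z = 1.
Proof. by rewrite /phiC /= rmorph1 hornerC. Qed.

Lemma phiC0 z : phiC a b 0 z = 0.
Proof. by rewrite /phiC /= rmorph0 horner0. Qed.

Lemma phiC_real n (x : R) : phiC a b n x%:C = ((phi a b n).[x])%:C.
Proof. by rewrite /phiC horner_map. Qed.

Lemma phiC_conj n z : phiC a b n z^* = (phiC a b n z)^*.
Proof.
rewrite /phiC -[RHS](horner_map (@conjc R)) /= -map_poly_comp.
congr (_.[_]); apply: eq_map_poly => x; exact/esym/conjc_real.
Qed.

(** The three terms of a row, over any ring containing the coefficients. *)
Lemma jacobi_mulE (S : nzRingType) (f : {rmorphism R -> S}) n (z : nat -> S) (k : 'I_n.+1) :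
  \sum_(l < n.+1) f (jacobi n.+1 a b k l) * z l =
  f (b k.+1) * z k + (if (k.+1 < n.+1)%N then f (a k.+1) * z k.+1 else 0) +
  (if (0 < k)%N then f (a k) * z k.-1 else 0).
Proof.
have E (l : 'I_n.+1) : f (jacobi n.+1 a b k l) * z l =
    (if l == k then f (b k.+1) * z k else 0) +
    (if l == k.+1 :> nat then f (a k.+1) * z k.+1 else 0) +
    (if (k == l.+1 :> nat) then f (a k) * z k.-1 else 0).
  rewrite mxE (eq_sym l k); case: eqP => [->|kl].
    by rewrite !(ltn_eqF (ltnSn _)) !addr0 // gtn_eqF ?addr0.
  case: eqP => [->|kl1]; first by rewrite ltn_eqF ?addr0 ?add0r// ltnW.
  by case: eqP => [->|_]; rewrite ?rmorph0 ?mul0r ?add0r ?addr0.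
rewrite (eq_bigr _ (fun l _ => E l)) 2!big_split /=; congr (_ + _ + _).
- by rewrite -big_mkcond big_pred1_eq.
- case: ifPn => kn.
    by rewrite -big_mkcond (big_pred1 (Ordinal kn)).
  rewrite big1// => l _; case: eqP => // lk; move: kn; rewrite -lk ltn_ord//.
- case: ifPn => kn.
    have kn1 : (k.-1 < n.+1)%N by rewrite (leq_ltn_trans (leq_pred _)).
    rewrite -big_mkcond (big_pred1 (Ordinal kn1))// => l /=.
    by rewrite -val_eqE /= -(prednK kn) eqSS eq_sym.
  rewrite big1// => l _; case: eqP => // lk; move: kn; rewrite lk//.
Qed.

Lemma jacobi_sym n (k l : 'I_n) : jacobi n a b k l = jacobi n a b l k.
Proof.
rewrite !mxE (eq_sym l k); case: (k =P l) => [->//|kl].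
by case: eqP => [->|//]; rewrite ltn_eqF// ltnW.
Qed.

(** The vector of the phi_k(z) solves all rows of the eigenvalue equation but the
    last, whose defect is phiQC n z. *)
Lemma jacobi_phi n (z : C) (k : 'I_n.+1) :
  (forall m, (1 <= m)%N -> (m < n.+1)%N -> 0 < a m) ->
  \sum_(l < n.+1) (jacobi n.+1 a b k l)%:C * phiC a b l.+1 z =
  z * phiC a b k.+1 z - (if k == n :> nat then phiQC n z else 0).
Proof.
move=> ha; rewrite (jacobi_mulE (real_complex R) (fun l => phiC a b l.+1 z)) /=.
rewrite ltnS ltn_neqAle -ltnS ltn_ord andbT.
have -> : (if (0 < k)%N then (a k)%:C * phiC a b k.-1.+1 z else 0) =
    (a k)%:C * phiC a b k z.
  by case: (k : nat) => [|m //]; rewrite phiC0 mulr0.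
case: eqP => [kn|kn] /=.
  by rewrite /phiQC kn; ring.
rewrite phiC_rec; last first.
  by apply: ha => //; rewrite ltnS ltn_neqAle -ltnS ltn_ord andbT; exact/eqP.
by rewrite /phiQC; ring.
Qed.

(** As the off-diagonal entries are nonzero, the first entry of a solution of all
    rows but the last determines it. *)
Lemma jacobi_forward n (z : C) (d : nat -> C) :
  (forall m, (1 <= m)%N -> (m < n.+1)%N -> 0 < a m) ->
  (forall k : 'I_n.+1, (k < n)%N ->
     \sum_(l < n.+1) (jacobi n.+1 a b k l)%:C * d l = z * d k) ->
  forall k, (k <= n)%N -> d k = d 0%N * phiC a b k.+1 z.
Proof.
move=> ha Hd k; elim/ltn_ind: k => -[_ _|k IH kn]; first by rewrite phiC1 mulr1.
have kn1 : (k < n.+1)%N by rewrite ltnW.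
have ak : 0 < a k.+1 by exact: ha.
have := Hd (Ordinal kn1) kn.
rewrite (jacobi_mulE (real_complex R) d) /= ltnS kn (IH k (ltnSn k) (ltnW kn)).
have -> : (if (0 < k)%N then (a k)%:C * d k.-1 else 0) =
    d 0%N * ((a k)%:C * phiC a b k z).
  case: k IH kn kn1 ak => [|m] IH kn kn1 ak; first by rewrite phiC0 !mulr0.
  by rewrite /= (IH m (leqnSn _) (ltnW (ltnW kn))) mulrCA.
move=> H.
have aC : (a k.+1)%:C != 0 :> C by rewrite eq_complex /= gt_eqF.
apply: (mulfI aC); rewrite mulrCA phiC_rec// /phiQC.
have -> : (a k.+1)%:C * d k.+1 = z * (d 0%N * phiC a b k.+1 z) -
   (b k.+1)%:C * (d 0%N * phiC a b k.+1 z) - d 0%N * ((a k)%:C * phiC a b k z).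
  by rewrite -H; ring.
by ring.
Qed.

End JacobiRecursion.

Section SpectralData.
Local Arguments phi : simpl never.
Variable R : realType.
Local Notation C := R[i].
Variables (a b : nat -> R) (n : nat).
Hypothesis ha : forall m, (1 <= m)%N -> (m < n.+1)%N -> 0 < a m.

Local Notation p k x := ((phi a b k).[x]).

(** The number om j is the mass at lam j of the spectral measure of the first
    basis vector.  The second and third clauses say that the matrix with entries
    sqrt (om j) * phi_(k + 1) (lam j) has orthonormal columns and rows. *)
Definition is_spectral (lam om : 'I_n.+1 -> R) : Prop :=
  [/\ (forall j, 0 < om j) /\ injective lam,
      forall k l : 'I_n.+1, \sum_j om j * (p k.+1 (lam j) * p l.+1 (lam j)) = (k == l)%:R,
      forall i j, om i * (\sum_(k < n.+1) p k.+1 (lam i) * p k.+1 (lam j)) = (i == j)%:R &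
      forall j (k : 'I_n.+1), \sum_(l < n.+1) jacobi n.+1 a b k l * p l.+1 (lam j) =
                 lam j * p k.+1 (lam j)].

(** A unitary matrix P diagonalizes the Jacobi matrix; by the recursion its row j
    is P j 0 times the vector of the phi_k(lam_j), so om_j = |P j 0|^2.  Two equal
    eigenvalues would make two orthogonal rows proportional. *)
Lemma ex_spectral : exists lam om, is_spectral lam om.
Proof.
pose A : 'M[C]_n.+1 := map_mx (real_complex R) (jacobi n.+1 a b).
have Akl k l : A k l = (jacobi n.+1 a b k l)%:C by rewrite mxE.
have hA : A \is hermsymmx.
  apply: realsym_hermsym.
    apply/is_hermitianmxP; rewrite expr0 scale1r map_mx_id//.
    by apply/matrixP => i j; rewrite [RHS]mxE !Akl jacobi_sym.
  by apply/mxOverP => i j; rewrite Akl; apply/complex_realP; eexists.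
have /mxOverP sreal := hermitian_spectral_diag_real hA.
have /hermitian_normalmx/orthomx_spectralP := hA.
set P := spectralmx A; set sp := spectral_diag A => AE.
have Pu : P \is unitarymx := spectral_unitarymx A.
have Punit : P \in unitmx := unitarymx_unit Pu.
have PA : P *m A = diag_mx sp *m P by rewrite {1}AE mulmxA mulKVmx// .
have /fin_all_exists[lam lamE] j : exists x, sp 0 j = x%:C by exact/complex_realP/sreal.
have Prow j (k : 'I_n.+1) : \sum_(l < n.+1) (jacobi n.+1 a b k l)%:C * P j l = (lam j)%:C * P j k.
  have /matrixP/(_ j k) := PA; rewrite mul_diag_mx [RHS]mxE lamE => <-.
  by rewrite mxE; apply: eq_bigr => l _; rewrite Akl jacobi_sym mulrC.
have PE j (k : 'I_n.+1) : P j k = P j 0 * (p k.+1 (lam j))%:C.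
  rewrite -phiC_real.
  have := @jacobi_forward R a b n (lam j)%:C (fun m => P j (inord m)) ha _ k.
  rewrite inord_val (_ : inord 0 = 0); last by apply: val_inj; rewrite /= inordK.
  apply; last by rewrite -ltnS.
  move=> k' _ /=; rewrite inord_val -Prow; apply: eq_bigr => l _.
  by rewrite inord_val.
have PtE j k : (P ^t*)%sesqui k j = (P j k)^* by rewrite mxE mxE.
pose om j := normc (P j 0) ^+ 2.
have conjr (x : R) : (x%:C)^* = x%:C :> C.
  by apply/CrealP; apply/complex_realP; eexists.
have cM (u v : C) : (u * v)^* = u^* * v^* by exact: rmorphM.
have omE j : P j 0 * (P j 0)^* = (om j)%:C.
  by rewrite -normCK normcE -rmorphXn.
have P0 j : P j 0 != 0.
  apply/negP => /eqP Pj0.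
  have /unitarymxP/matrixP/(_ j j) := Pu; rewrite [RHS]mxE [LHS]mxE eqxx big1 => [/eqP|k _].
    by rewrite eq_sym oner_eq0.
  by rewrite PE Pj0 !mul0r.
have om0 j : 0 < om j by rewrite exprn_gt0// normc_gt0.
clearbody om.
have dual i j : P i 0 * (P j 0)^* * (\sum_(k < n.+1) p k.+1 (lam i) * p k.+1 (lam j))%:C
    = (i == j)%:R.
  have /unitarymxP/matrixP/(_ i j) := Pu; rewrite [RHS]mxE [LHS]mxE => <-.
  rewrite raddf_sum /= mulr_sumr; apply: eq_bigr => k _.
  rewrite PtE (PE i k) (PE j k) cM conjr.
  move: (p k.+1 (lam i)) (p k.+1 (lam j)) => u v.
  by rewrite rmorphM /=; ring.
exists lam, om; split; first split => //.
- move=> i j ij; apply/eqP; rewrite -[_ == _]negbK; apply/negP => nij.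
  have := dual i j; rewrite (negbTE nij) ij => /eqP.
  rewrite mulf_eq0 mulf_eq0 (negbTE (P0 i)) conjC_eq0 (negbTE (P0 j)) /=.
  move=> /eqP s0; have := dual j j; rewrite eqxx => /eqP.
  by rewrite [X in _ * X]s0 mulr0 eq_sym oner_eq0.
- move=> k l; apply: (@complexI R).
  have /mulmx1C/matrixP/(_ k l) : P *m (P ^t*)%sesqui = 1%:M by apply/unitarymxP.
  rewrite [RHS]mxE [LHS]mxE => E; rewrite raddf_sum /=.
  transitivity ((k == l)%:R : C); last by case: (k == l).
  rewrite -E; apply: eq_bigr => j _.
  rewrite PtE (PE j k) (PE j l) cM conjr.
  move: (p k.+1 (lam j)) (p l.+1 (lam j)) => u v.
  have -> : (om j * (u * v))%:C = (om j)%:C * (u%:C * v%:C) by rewrite !rmorphM.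
  by rewrite -omE; ring.
- move=> i j; have := dual i j; case: eqP => [<-|_] /eqP.
    by rewrite omE -rmorphM => /eqP/(@complexI R).
  rewrite mulf_eq0 mulf_eq0 (negbTE (P0 i)) conjC_eq0 (negbTE (P0 j)) /=.
  by move=> /eqP/(@complexI R) ->; rewrite mulr0.
- move=> j k; apply: (@complexI R).
  rewrite raddf_sum rmorphM /=; apply: (mulfI (P0 j)).
  have := Prow j k; rewrite (PE j k) mulrCA => <-.
  rewrite mulr_sumr; apply: eq_bigr => l _.
  by rewrite (PE j l) rmorphM mulrCA.
Qed.

(** An eigenvector for another number would be orthogonal to the eigenvectors
    with entries phi_k(lam_j), which span. *)
Lemma spectral_eigenvalue lam om (x : R) : is_spectral lam om ->
  eigenvalue (jacobi n.+1 a b) x <-> exists j, x = lam j.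
Proof.
move=> [[om0 injl] cpl dual eig]; split.
  move=> /eigenvalueP[v vA v0]; apply: contrapT => nx.
  have vphi j : \sum_(k < n.+1) v 0 k * p k.+1 (lam j) = 0.
    have H : x * (\sum_(k < n.+1) v 0 k * p k.+1 (lam j)) =
             lam j * (\sum_(k < n.+1) v 0 k * p k.+1 (lam j)).
      transitivity (\sum_(k < n.+1) (v *m jacobi n.+1 a b) 0 k * p k.+1 (lam j)).
        rewrite vA mulr_sumr; apply: eq_bigr => k _.
        by rewrite [(x *: v) 0 k]mxE mulrA.
      rewrite mulr_sumr.
      under eq_bigr do rewrite mxE mulr_suml.
      rewrite exchange_big /=; apply: eq_bigr => k _.
      under eq_bigr do rewrite -mulrA.
      by rewrite -mulr_sumr eig mulrCA.
    apply/eqP; have /eqP := H; rewrite -subr_eq0 -mulrBl mulf_eq0 => /orP[|//].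
    by rewrite subr_eq0 => /eqP xl; exfalso; apply: nx; exists j.
  have /negP := v0; apply; apply/eqP/rowP => l; rewrite [RHS]mxE.
  transitivity (\sum_(k < n.+1) v 0 k * (k == l)%:R).
    rewrite (bigD1 l)//= eqxx mulr1 big1 ?addr0// => k /negbTE ->; exact: mulr0.
  under eq_bigr do rewrite -cpl mulr_sumr.
  rewrite exchange_big /= big1// => j _.
  transitivity (om j * p l.+1 (lam j) * (\sum_(k < n.+1) v 0 k * p k.+1 (lam j))).
    by rewrite mulr_sumr; apply: eq_bigr => k _; ring.
  by rewrite vphi mulr0.
move=> [j ->]; apply/eigenvalueP; exists (\row_k p k.+1 (lam j)).
  apply/rowP => k; rewrite [RHS]mxE [X in _ * X]mxE -eig mxE.
  by apply: eq_bigr => l _; rewrite [X in X * _]mxE jacobi_sym mulrC.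
apply/negP => /eqP/rowP/(_ 0); rewrite !mxE /phi hornerC => /eqP.
by rewrite oner_eq0.
Qed.

End SpectralData.

(** * Absolutely continuous functions *)

Section Cousin.
Variable R : realType.

(** Cousin's lemma: an additive property of intervals that holds on all small
    intervals around each point holds on the whole segment. *)
Lemma cousin (Q : R -> R -> Prop) (a b : R) : a <= b ->
  (forall x y z, a <= x -> x <= y -> y <= z -> z <= b -> Q x y -> Q y z -> Q x z) ->
  (forall x, a <= x <= b -> exists2 del : R, 0 < del &
     forall u v, a <= u -> u <= x -> x <= v -> v <= b -> x - u < del -> v - x < del -> Q u v) ->
  Q a b.
Proof.
move=> ab Qadd Qloc; pose S := [set t | a <= t <= b /\ Q a t].
have Sa : S a.
  split; first by rewrite lexx.
  have [|del del0 Qa] := Qloc a; first by rewrite lexx.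
  by apply: Qa; rewrite ?subrr.
have Sb : has_ubound S by exists b => t [/andP[]].
have hS : has_sup S by split; first by exists a.
have as_ : a <= sup S by exact: ub_le_sup.
have sb : sup S <= b by apply: ge_sup; [exists a|move=> t [/andP[]]].
have [|del del0 Qs] := Qloc (sup S); first by rewrite as_.
have [t [/andP[t1 t2] Qt] tS] := sup_adherent del0 hS.
have ts : t <= sup S by apply: ub_le_sup => //; split => //; rewrite t1.
pose v := Num.min b (sup S + del / 2).
have vb : v <= b by rewrite ge_min lexx.
have vs : v <= sup S + del / 2 by rewrite ge_min lexx orbT.
have sv : sup S <= v by rewrite le_min sb lerDl ltW// divr_gt0.
have Qv : Q a v.
  apply: (Qadd a t v) => //; first exact: le_trans sv.
  by apply: Qs => //; lra.
have Sv : S v by split => //; rewrite (le_trans as_ sv).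
have vsup : v <= sup S by exact: ub_le_sup.
suff -> : b = v by [].
apply/eqP; rewrite eq_le vb andbT /v le_min lexx/=.
rewrite leNgt; apply/negP => bs.
by move: vsup; rewrite /v (min_r (ltW bs)); lra.
Qed.

End Cousin.

Section AbsoluteContinuity.
Variable R : realType.
Local Notation mu := (@lebesgue_measure R).
Implicit Types (G : R -> R) (U : set R) (s : seq (R * R)).

(** Ordered families of closed subintervals of the segment from u to v, with
    disjoint interiors and contained in U. *)
Fixpoint chain U (u : R) s (v : R) : Prop :=
  if s is p :: s' then
    [/\ u <= p.1, p.1 <= p.2, (forall x, p.1 <= x <= p.2 -> U x) & chain U p.2 s' v]
  else u <= v.

Lemma chain_le U u s v : chain U u s v -> u <= v.
Proof.
elim: s u => //= p s IH u [h1 h2 _ /IH h3].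
exact: le_trans h1 (le_trans h2 h3).
Qed.

Lemma chainW U u u' s v : u <= u' -> chain U u' s v -> chain U u s v.
Proof.
case: s => [|p s] /= uu'; first exact: le_trans.
by move=> [h1 h2 h3 h4]; split => //; exact: le_trans h1.
Qed.

Lemma chain_cat U u s y s' v : chain U u s y -> chain U y s' v -> chain U u (s ++ s') v.
Proof.
elim: s u => [|p s IH] u /=; first exact: chainW.
by move=> [h1 h2 h3 h4] h5; split => //; exact: IH.
Qed.

Lemma chain_lb U u s v i : chain U u s v -> (i < size s)%N ->
  u <= (nth (0, 0) s i).1 /\ (nth (0, 0) s i).1 <= (nth (0, 0) s i).2 /\
  (nth (0, 0) s i).2 <= v.
Proof.
elim: s u i => //= p s IH u [|i] [h1 h2 h3 h4] /=.
  by move=> _; do !split => //; exact: chain_le h4.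
move=> /(IH _ _ h4)[k1 k2]; split => //.
exact: le_trans h1 (le_trans h2 k1).
Qed.

Lemma chain_lt U u s v i j : chain U u s v -> (i < j)%N -> (j < size s)%N ->
  (nth (0, 0) s i).2 <= (nth (0, 0) s j).1.
Proof.
elim: s u i j => //= p s IH u [|i] [|j] //= [h1 h2 h3 h4] ij js.
  by have [] := chain_lb h4 js.
exact: (IH _ i j h4).
Qed.

Lemma chain_measure U u s v : open U -> chain U u s v ->
  ((\sum_(p <- s) (p.2 - p.1))%:E <= mu (U `&` `[u, v]))%E.
Proof.
move=> oU; have mU : measurable U by exact: open_measurable.
elim: s u => [|p s IH] u /=; first by rewrite big_nil measure_ge0.
move=> [h1 h2 h3 h4]; rewrite big_cons EFinD.
have h5 := chain_le h4.
apply: (@le_trans _ _ (mu (U `&` `[u, p.2[) + mu (U `&` `[p.2, v]))%E).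
  apply: leeD; last exact: IH.
  have -> : ((p.2 - p.1)%:E = mu `[p.1, p.2[)%E.
    by rewrite lebesgue_measure_itv/= lte_fin; case: ltP => // h6; rewrite (le_anti (introT andP (conj h2 h6))) subrr.
  apply: le_measure; rewrite ?inE//; first exact: measurableI.
  move=> x /= ; rewrite !in_itv /= => /andP[x1 x2]; split.
    by apply: h3; rewrite x1 ltW.
  by rewrite x2 (le_trans h1 x1).
rewrite -measureU//; [|exact: measurableI|exact: measurableI|].
  apply: le_measure; rewrite ?inE//; [|exact: measurableI|].
    by apply: measurableU; exact: measurableI.
  move=> x /= [] [Ux]; rewrite !in_itv/= => /andP[x1 x2]; split => //.
    by rewrite x1 (le_trans (ltW x2)).
  by rewrite x2 (le_trans (le_trans h1 h2)).
apply/seteqP; split => // x [[_ +] [_ +]] /=.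
by rewrite /= !in_itv/= => /andP[_ x1] /andP[x2 _]; rewrite leNgt x1 in x2.
Qed.

Lemma negligible_open_cover (Z : set R) (d : R) : mu.-negligible Z -> 0 < d ->
  exists U, [/\ open U, Z `<=` U & (mu U < d%:E)%E].
Proof.
move=> [A [mA A0 ZA]] d0.
have [|U [oU AU UA]] := lebesgue_regularity_outer mA _ d0; first by rewrite [X in (X < _)%E]A0 ltry.
exists U; split => //; first exact: subset_trans ZA AU.
have mU : measurable U by exact: open_measurable.
rewrite -(setDUK AU) measureU//; last by rewrite setDIK.
  by rewrite [X in (X + _)%E]A0 add0e.
exact: measurableD.
Qed.

(** Cover the exceptional null set by an open set U of small measure.  Around a
    point outside U the increment is at most e times the length, and an interval
    around a point of U may be chosen inside U.  Cousin's lemma bounds the total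
    increment by e (b - a) plus the increments over a chain of intervals of U,
    whose total length is at most the measure of U. *)
Theorem abs_continuous_cst G (a b : R) : a <= b -> abs_continuous a b G ->
  {ae mu, forall t, `]a, b[%classic t -> is_derive t (1 : R) G 0} -> G b = G a.
Proof.
move=> ab acG aeG.
suff H e : 0 < e -> `|G b - G a| <= e * (b - a) + e.
  apply/eqP; rewrite -subr_eq0 -normr_eq0 eq_le normr_ge0 andbT.
  apply/ler_addgt0Pr => e e0; rewrite add0r.
  have W0 : 0 < b - a + 1 by rewrite ltr_pwDr// subr_ge0.
  apply: le_trans (H (e / (b - a + 1)) _) _; first by rewrite divr_gt0.
  rewrite -[X in _ + X]mulr1 -mulrDr divfK// gt_eqF//.
move=> e0; have [d d0 Hd] := acG e e0.
pose Z : set R := ~` [set t | `]a, b[%classic t -> is_derive t (1 : R) G 0] `|` ([set a] `|` [set b]).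
have Z0 : mu.-negligible Z.
  apply: negligibleU; first exact: aeG.
  by apply: negligibleU; apply/negligibleP => //; exact: lebesgue_measure_set1.
have [U [oU ZU Ud]] := negligible_open_cover Z0 d0.
pose inc (s : seq (R * R)) := \sum_(p <- s) `|G p.2 - G p.1|.
pose Q u v := u <= v /\ exists s, chain U u s v /\ `|G v - G u| <= e * (v - u) + inc s.
have [_ [s [cs Gs]]] : Q a b.
  apply: cousin => //.
    move=> x y z _ _ _ _ [xy [s [cs hs]]] [yz [s' [cs' hs']]].
    split; first exact: le_trans yz.
    exists (s ++ s'); split; first exact: chain_cat cs cs'.
    rewrite /inc big_cat /=.
    have -> : G z - G x = (G z - G y) + (G y - G x) by ring.
    apply: le_trans (ler_normD _ _) _; move: hs hs'; rewrite /inc; lra.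
  move=> x /andP[ax xb].
  have [Zx|nZx] := pselect (Z x).
    have /nbhs_ballP[del /= del0 xU] : nbhs x U by apply: open_nbhs_nbhs; split => //; exact: ZU.
    exists del => // u v au ux xv vb xu vx; split; first exact: le_trans xv.
    exists [:: (u, v)]; split; last first.
      by rewrite /inc big_seq1 lerDr mulr_ge0 ?(ltW e0)// subr_ge0 (le_trans ux).
    split => //=; first exact: le_trans xv.
    move=> y /andP[y1 y2]; apply: xU; rewrite /ball /= ltr_norml.
    by apply/andP; split; lra.
  have xab : `]a, b[%classic x.
    rewrite /= in_itv/= !lt_neqAle ax xb !andbT; apply/andP; split; apply/eqP => E; apply: nZx.
      by right; left.
    by right; right.
  have Gx : is_derive x (1 : R) G 0.
    by apply: contrapT => nG; apply: nZx; left => /= /(_ xab).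
  have [del del0 Hdel] := (is_derive_epsP _ _ _).1 Gx e e0.
  exists del => // u v au ux xv vb xu vx; split; first exact: le_trans xv.
  exists [::]; split; first exact: le_trans xv.
  have h1 := Hdel (v - x); have h2 := Hdel (u - x).
  rewrite /inc big_nil addr0.
  move: h1 h2; rewrite !mul0r !subr0 ![x + (_ - x)]addrC !subrK.
  rewrite (ger0_norm (x := v - x)) ?subr_ge0// (ler0_norm (x := u - x)) ?subr_le0// opprB.
  move=> /(_ vx) h1 /(_ xu) h2.
  have -> : G v - G u = (G v - G x) - (G u - G x) by ring.
  apply: le_trans (ler_normB _ _) _; lra.
apply: le_trans Gs _; rewrite lerD2l.
rewrite /inc (big_nth (0, 0)) big_mkord; apply: ltW.
apply: (Hd (size s) (fun i => (nth (0, 0) s i).1) (fun i => (nth (0, 0) s i).2)).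
- by move=> i; exact: (chain_lb cs).
- apply/trivIsetP => i j _ _ ij; apply/seteqP; split => // x [] /=.
  rewrite !in_itv/= => /andP[x1 x2] /andP[x3 x4].
  have [lt_ij|lt_ji|/val_inj ij'] := ltngtP i j; last by rewrite ij' eqxx in ij.
    have := chain_lt cs lt_ij (ltn_ord j).
    by move: (lt_trans x3 x2); lra.
  have := chain_lt cs lt_ji (ltn_ord i).
  by move: (lt_trans x1 x4); lra.
- rewrite -lte_fin; apply: le_lt_trans Ud.
  have := chain_measure oU cs; rewrite (big_nth (0, 0)) big_mkord => h.
  apply: le_trans h _; apply: le_measure; rewrite ?inE//.
  + by apply: measurableI => //; exact: open_measurable.
  + exact: open_measurable.
Qed.

End AbsoluteContinuity.

Section AbsoluteContinuityCalculus.
Variable R : realType.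
Local Notation mu := (@lebesgue_measure R).
Implicit Types (g h : R -> R) (a b : R).

Lemma abs_continuous_lipschitz g a b (K : R) :
  (forall x y, a <= x -> x <= y -> y <= b -> `|g y - g x| <= K * (y - x)) ->
  abs_continuous a b g.
Proof.
move=> gK e e0; pose K1 := `|K| + 1.
have K10 : 0 < K1 by rewrite ltr_wpDl.
exists (e / K1); first by rewrite divr_gt0.
move=> n l r lr _; rewrite ltr_pdivlMr// => H.
apply: le_lt_trans H; rewrite mulr_suml; apply: ler_sum => i _.
have [h1 [h2 h3]] := lr i.
apply: le_trans (gK _ _ h1 h2 h3) _; rewrite mulrC ler_wpM2l ?subr_ge0//.
by apply: le_trans (ler_norm K) _; rewrite /K1 lerDl.
Qed.

(** The common source of the stability of absolute continuity under sums and
    products. *)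
Lemma abs_continuous_mul_dom g h k a b (A B : R) :
  (forall x y, a <= x -> x <= y -> y <= b ->
     `|k y - k x| <= A * `|g y - g x| + B * `|h y - h x|) ->
  abs_continuous a b g -> abs_continuous a b h -> abs_continuous a b k.
Proof.
move=> kgh acg ach e e0.
pose A1 := `|A| + 1; pose B1 := `|B| + 1.
have A10 : 0 < A1 by rewrite ltr_wpDl.
have B10 : 0 < B1 by rewrite ltr_wpDl.
have [d1 d10 H1] := acg (e / 2 / A1) (divr_gt0 (divr_gt0 e0 (ltr0n _ 2)) A10).
have [d2 d20 H2] := ach (e / 2 / B1) (divr_gt0 (divr_gt0 e0 (ltr0n _ 2)) B10).
exists (Num.min d1 d2) => [|n l r lr tr]; first by rewrite lt_min d10.
rewrite lt_min => /andP[/(H1 _ _ _ lr tr) {}H1 /(H2 _ _ _ lr tr) {}H2].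
rewrite ltr_pdivlMr// in H1; rewrite ltr_pdivlMr// in H2.
apply: (@le_lt_trans _ _ (\sum_(i < n) `|g (r i) - g (l i)| * A1 + \sum_(i < n) `|h (r i) - h (l i)| * B1)).
  rewrite -big_split /=; apply: ler_sum => i _.
  have [h1 [h2 h3]] := lr i; apply: le_trans (kgh _ _ h1 h2 h3) _.
  apply: lerD; rewrite mulrC ler_wpM2l//.
    by apply: le_trans (ler_norm A) _; rewrite /A1 lerDl.
  by apply: le_trans (ler_norm B) _; rewrite /B1 lerDl.
by rewrite -!mulr_suml; lra.
Qed.

Lemma abs_continuousD g h a b : abs_continuous a b g -> abs_continuous a b h ->
  abs_continuous a b (fun t => g t + h t).
Proof.
apply: (@abs_continuous_mul_dom _ _ _ _ _ 1 1) => x y _ _ _.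
by rewrite !mul1r opprD addrACA; exact: ler_normD.
Qed.

Lemma abs_continuousB g h a b : abs_continuous a b g -> abs_continuous a b h ->
  abs_continuous a b (fun t => g t - h t).
Proof.
apply: (@abs_continuous_mul_dom _ _ _ _ _ 1 1) => x y _ _ _.
rewrite !mul1r (_ : g y - h y - (g x - h x) = (g y - g x) - (h y - h x)); last by ring.
exact: ler_normB.
Qed.

Lemma abs_continuousZ g a b (K : R) : abs_continuous a b g ->
  abs_continuous a b (fun t => K * g t).
Proof.
move=> acg; apply: (abs_continuous_mul_dom (A := `|K|) (B := 0) _ acg acg) => x y _ _ _.
by rewrite mul0r addr0 -mulrBr normrM.
Qed.

Lemma abs_continuous_cst_fun a b (K : R) : abs_continuous a b (fun=> K).
Proof.
by apply: (@abs_continuous_lipschitz _ _ _ 0) => *; rewrite subrr normr0 mul0r.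
Qed.

Lemma abs_continuous_sum a b n (F : 'I_n -> R -> R) :
  (forall i, abs_continuous a b (F i)) -> abs_continuous a b (fun t => \sum_(i < n) F i t).
Proof.
elim: n F => [|n IH] F acF.
  have -> : (fun t => \sum_(i < 0) F i t) = (fun=> 0) by apply/funext => t; rewrite big_ord0.
  exact: abs_continuous_cst_fun.
have -> : (fun t => \sum_(i < n.+1) F i t) =
    (fun t => F ord0 t + \sum_(i < n) F (lift ord0 i) t).
  by apply/funext => t; rewrite big_ord_recl.
by apply: abs_continuousD => //; exact: IH.
Qed.

(** An additive local property, to which Cousin's lemma applies. *)
Lemma abs_continuous_bounded g a b : a <= b -> abs_continuous a b g ->
  exists B, forall x, a <= x <= b -> `|g x| <= B.
Proof.
move=> ab acg; have [d d0 Hd] := acg 1 ltr01.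
apply: (@cousin R (fun u v => exists B, forall x, u <= x <= v -> `|g x| <= B)) => //.
  move=> x y z _ xy yz _ [B HB] [B' HB']; exists (Num.max B B') => t /andP[t1 t2].
  rewrite le_max; have [ty|/ltW ty] := leP t y; first by rewrite HB// t1.
  by rewrite [X in _ || X]HB' ?orbT// ty.
move=> x /andP[ax xb]; exists d => // u v au ux xv vb xu vx.
exists (`|g x| + 1) => t /andP[t1 t2].
have one (p q : R) : a <= p -> p <= q -> q <= b -> q - p < d -> `|g q - g p| < 1.
  move=> ap pq qb qp; have := Hd 1%N (fun=> p) (fun=> q).
  rewrite !big_ord1; apply => //.
  by apply/trivIsetP => i j _ _; rewrite !ord1 eqxx.
have : `|g t - g x| < 1.
  have [tx|/ltW xt] := leP t x; last by apply: one => //; lra.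
  by rewrite distrC; apply: one => //; lra.
have := ler_normD (g t - g x) (g x); rewrite subrK; lra.
Qed.

Lemma abs_continuousM g h a b : a <= b -> abs_continuous a b g -> abs_continuous a b h ->
  abs_continuous a b (fun t => g t * h t).
Proof.
move=> ab acg ach.
have [A HA] := abs_continuous_bounded ab acg.
have [B HB] := abs_continuous_bounded ab ach.
apply: (abs_continuous_mul_dom (A := B) (B := A) _ acg ach) => x y ax xy yb.
have -> : g y * h y - g x * h x = h y * (g y - g x) + g x * (h y - h x) by ring.
apply: le_trans (ler_normD _ _) _; rewrite !normrM lerD// ler_wpM2r//.
  by apply: HB; rewrite (le_trans ax xy).
by apply: HA; rewrite ax (le_trans xy).
Qed.

Lemma abs_continuous_C1 g g' a b : (forall t, is_derive t (1 : R) g (g' t)) ->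
  continuous g' -> a <= b -> abs_continuous a b g.
Proof.
move=> gD cg' ab.
have [c c1 c2] := EVT_max ab (continuous_subspaceT cg').
have [c' c1' c2'] := EVT_min ab (continuous_subspaceT cg').
apply: (@abs_continuous_lipschitz _ _ _ (`|g' c| + `|g' c'|)) => x y ax xy yb.
apply: (mvt_le gD xy) => t /andP[t1 t2].
have tab : t \in `[a, b]%R by rewrite in_itv/= (le_trans ax t1) (le_trans t2 yb).
rewrite ler_norml; apply/andP; split.
  have := c2' t tab; have := ler_norm (- g' c'); rewrite normrN.
  have := normr_ge0 (g' c); lra.
have := c2 t tab; have := ler_norm (g' c); have := normr_ge0 (g' c'); lra.
Qed.

End AbsoluteContinuityCalculus.

Section IndefiniteIntegral.
Variable R : realType.
Local Notation mu := (@lebesgue_measure R).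
Variables (T : R) (f : R -> R).
Hypothesis T0 : 0 < T.
Hypothesis fi : mu.-integrable `]0, T[ (EFin \o f).

(** The integrand is cut off outside ]0, T[, where a control is not defined, so
    that the function is defined on the whole line. *)
Definition indef (t : R) : R := \int[mu]_(x in `]-oo, t]) (f \_ `]0, T[) x.

Let fiT : mu.-integrable setT (EFin \o (f \_ `]0, T[)).
Proof.
by rewrite -restrict_EFin; apply/integrable_restrict => //=; rewrite setTI.
Qed.

Lemma indef0 t : t <= 0 -> indef t = 0.
Proof.
move=> t0; rewrite /indef; transitivity (\int[mu]_(x in set0) (f \_ `]0, T[) x).
  2: exact: Rintegral_set0.
rewrite Rintegral_mkcond [RHS]Rintegral_mkcond; apply: eq_Rintegral => x _.
rewrite !patchE in_set0; case: ifPn => // xt; case: ifPn => // x0.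
move: xt x0; rewrite !inE /= !in_itv/= => xt /andP[x0 _].
by have := lt_le_trans x0 (le_trans xt t0); rewrite ltxx.
Qed.

Lemma indefT : indef T = \int[mu]_(x in `]0, T[) f x.
Proof.
rewrite /indef Rintegral_mkcond [RHS]Rintegral_mkcond; apply: eq_Rintegral => x _.
rewrite !patchE; case: ifPn => // xT.
by case: ifPn => //; rewrite inE /= in_itv/= => /andP[_ xT']; move: xT; rewrite notin_setE /= in_itv/= ltW.
Qed.

Lemma indefB l r : l <= r ->
  indef r - indef l = \int[mu]_(x in `]l, r]) (f \_ `]0, T[) x.
Proof.
move=> lr; rewrite /indef; apply: Rintegral_itvB; rewrite ?bnd_simp//.
exact: integrableS fiT.
Qed.

(** Absolute continuity of the Lebesgue integral. *)
Lemma abs_continuous_indef a b : abs_continuous a b indef.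
Proof.
move=> e e0; have [d [d0 Hd]] := integral_normr_continuous fiT e0.
exists d => // n l r lr tr H.
pose F i : set R := `]l i, r i[%classic.
have mF i : measurable (F i) by exact: measurable_itv.
pose D := \big[setU/set0]_(i < n) F i.
have mD : measurable D by exact: bigsetU_measurable.
have nfi : mu.-integrable setT (EFin \o (fun x => `|(f \_ `]0, T[) x|)).
  by have := integrable_abse fiT.
have nfiF i : mu.-integrable (F i) (EFin \o (fun x => `|(f \_ `]0, T[) x|)).
  have H1 := integrableS measurableT _ _ nfi; exact: (H1 (F i) (mF i)).
apply: le_lt_trans (Hd D mD _); last first.
  rewrite /D measure_bigsetU_ord//.
  rewrite (eq_bigr (fun i => (r i - l i)%:E)); first by rewrite sumEFin lte_fin.
  move=> i _; rewrite [LHS]lebesgue_measure_itv/= lte_fin; case: ltP => // h.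
  by have [_ [h2 _]] := lr i; rewrite (le_anti (introT andP (conj h2 h))) subrr.
have Dsum : (\int[mu]_(x in D) (`|(f \_ `]0, T[) x|)%:E =
    \sum_(i < n) \int[mu]_(x in F i) (`|(f \_ `]0, T[) x|)%:E)%E.
  apply: (integral_bigsetU_EFin mu mF (index_enum_uniq _)).
  - exact: sub_trivIset tr.
  - by apply: measurable_funTS; case/integrableP : nfi.
rewrite [leRHS]/Rintegral Dsum -sum_fine; last first.
  move=> i _; apply: integrable_fin_num; first exact: mF.
  exact: nfiF.
apply: ler_sum => i _; have [_ [h2 _]] := lr i.
rewrite indefB//.
rewrite -Rintegral_itv_bndo_bndc//; last exact: integrableS fiT.
apply: le_normr_Rintegral => //; exact: integrableS fiT.
Qed.

Lemma ae_derive_indef :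
  {ae mu, forall t, `]0, T[%classic t -> is_derive t (1 : R) indef (f t)}.
Proof.
have H : {ae mu, forall t, derivable indef t 1 /\ derive1 indef t = (f \_ `]0, T[) t}.
  apply: FTC1Ny; first by move=> y; exact: integrableS fiT.
  exact: integrable_locally.
move: H; apply: filterS; first exact: (ae_filter_ringOfSetsType mu).
move=> t [d1 d2] tT; apply: DeriveDef => //.
by rewrite -derive1E d2 patchE mem_set.
Qed.

End IndefiniteIntegral.

(** * The driven oscillator *)

Section Oscillator.
Variable R : realType.
Local Notation mu := (@lebesgue_measure R).
Variable lam : R.

(** The derivative of t |-> S(t, lam). *)
Definition Cfun (t : R) : R :=
  if 0 < lam then cos (Num.sqrt lam * t)
  else if lam < 0 then (expR (Num.sqrt `|lam| * t) + expR (- (Num.sqrt `|lam| * t))) / 2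
  else 1.

Lemma is_derive_lin (c t : R) : is_derive t (1 : R) (fun s => c * s) c.
Proof.
have := is_deriveZ c (is_derive_id t (1 : R)).
by rewrite /GRing.scale /= mulr1.
Qed.

Lemma is_derive_scale (g : R -> R) (c t d : R) : is_derive t (1 : R) g d ->
  is_derive t (1 : R) (fun s => c * g s) (c * d).
Proof. by move=> H; have := is_deriveZ c H. Qed.

Lemma is_derive_comp_lin (g g' : R -> R) (c t : R) :
  (forall x, is_derive x (1 : R) g (g' x)) ->
  is_derive t (1 : R) (fun s => g (c * s)) (c * g' (c * t)).
Proof.
move=> gD; have := is_derive1_comp (gD (c * t)) (is_derive_lin c t).
by rewrite mulrC.
Qed.

Lemma is_derive_Sfun t : is_derive t (1 : R) (fun s => Sfun s lam) (Cfun t).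
Proof.
rewrite /Sfun /Cfun; case: ltgtP => [l0|l0|_]; last exact: is_derive_id.
- set m := Num.sqrt lam; have m0 : m != 0 by rewrite gt_eqF// sqrtr_gt0.
  have := is_derive_scale m^-1 (is_derive_comp_lin m t (@is_derive_sin R)).
  by rewrite mulKf//; under eq_fun do rewrite mulrC.
- set m := Num.sqrt `|lam|.
  have m0 : m != 0 by rewrite gt_eqF// sqrtr_gt0 normr_gt0 lt_eqF.
  have H1 := is_derive_comp_lin m t (@is_derive_expR R).
  have H2 := is_derive_comp_lin (- m) t (@is_derive_expR R).
  have := is_derive_scale (2^-1 / m) (is_deriveB H1 H2).
  have -> : 2^-1 / m * (m * expR (m * t) - - m * expR (- m * t)) =
    (expR (m * t) + expR (- (m * t))) / 2 by rewrite (mulNr m t); field.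
  rewrite (_ : (fun s => _) = (fun s => (expR (m * s) - expR (- (m * s))) / 2 / m))//.
  by apply/funext => s; rewrite -(mulNr m s) -[(_ - _) s]/(expR (m * s) - expR (- m * s)); field.
Qed.

Lemma is_derive_Cfun t : is_derive t (1 : R) Cfun (- lam * Sfun t lam).
Proof.
rewrite /Sfun; have [l0|l0|l0] := ltgtP lam 0.
- set m := Num.sqrt `|lam|.
  have m0 : m != 0 by rewrite gt_eqF// sqrtr_gt0 normr_gt0 lt_eqF.
  have m2 : lam = - (m * m) by rewrite -expr2 sqr_sqrtr// ltr0_norm// opprK.
  have H1 := is_derive_comp_lin m t (@is_derive_expR R).
  have H2 := is_derive_comp_lin (- m) t (@is_derive_expR R).
  have := is_derive_scale 2^-1 (is_deriveD H1 H2).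
  have -> : 2^-1 * (m * expR (m * t) + - m * expR (- m * t)) =
    - lam * ((expR (m * t) - expR (- (m * t))) / 2 / m).
    by rewrite (_ : - lam = m * m) ?(mulNr m t); [field|rewrite m2 opprK].
  rewrite (_ : (fun s => _) = Cfun)//.
  apply/funext => s; rewrite /Cfun l0 ifF; last by apply/negbTE; rewrite -leNgt ltW.
  by rewrite -/m -(mulNr m s) -[(_ + _) s]/(expR (m * s) + expR (- m * s)); field.
- set m := Num.sqrt lam; have m0 : m != 0 by rewrite gt_eqF// sqrtr_gt0.
  have m2 : lam = m * m by rewrite -expr2 sqr_sqrtr// ltW.
  have := is_derive_comp_lin m t (@is_derive_cos R).
  have -> : m * - sin (m * t) = - lam * (sin (m * t) / m).
    by rewrite (_ : - lam = - (m * m)); [field|rewrite m2].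
  rewrite (_ : (fun s => _) = Cfun)//.
  by apply/funext => s; rewrite /Cfun l0.
- rewrite l0 oppr0 mul0r (_ : Cfun = cst 1); first exact: is_derive_cst.
  by apply/funext => s; rewrite /Cfun l0 ltxx.
Qed.

Lemma Sfun0 : Sfun 0 lam = 0.
Proof.
by rewrite /Sfun !mulr0 sin0 mul0r oppr0 subrr !mul0r; case: ifP => //; case: ifP.
Qed.

Lemma Cfun0 : Cfun 0 = 1.
Proof.
rewrite /Cfun !mulr0 cos0 oppr0 expR0; case: ifP => //; case: ifP => // _ _.
by field.
Qed.

Lemma continuous_Sfun : continuous (fun s => Sfun s lam).
Proof. by move=> t; exact: derive_cont (is_derive_Sfun t). Qed.

Lemma continuous_Cfun : continuous Cfun.
Proof. by move=> t; exact: derive_cont (is_derive_Cfun t). Qed.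

(** Conservation of energy. *)
Lemma Cfun_Sfun t : Cfun t ^+ 2 + lam * Sfun t lam ^+ 2 = 1.
Proof.
pose g s := Cfun s * Cfun s + lam * (Sfun s lam * Sfun s lam).
have gD s : is_derive s (1 : R) g 0.
  have dC := is_derive_Cfun s; have dS := is_derive_Sfun s.
  apply: is_derive_eq (is_deriveD (is_deriveM dC dC) (is_derive_scale lam (is_deriveM dS dS))) _.
  by rewrite /GRing.scale /=; ring.
have := is_derive_0_is_cst t 0 gD.
by rewrite /g Cfun0 Sfun0 !mulr0 addr0 mulr1 !expr2.
Qed.

Variables (T : R).
Hypothesis T0 : 0 < T.

Lemma is_derive_rev (g g' : R -> R) t : (forall x, is_derive x (1 : R) g (g' x)) ->
  is_derive t (1 : R) (fun s => g (T - s)) (- g' (T - t)).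
Proof.
move=> gD.
have D : is_derive t (1 : R) (fun s : R => T - s) (- 1).
  by have := is_deriveB (is_derive_cst T t (1 : R)) (is_derive_id t (1 : R)); rewrite sub0r.
by have := @is_derive1_comp R g (fun s => T - s) t _ _ (gD (T - t)) D; rewrite mulrN1.
Qed.

Lemma integrable_mul_cont (f h : R -> R) : mu.-integrable `]0, T[ (EFin \o f) ->
  continuous h -> mu.-integrable `]0, T[ (EFin \o (fun t => f t * h t)).
Proof.
move=> fi ch.
have mh : measurable_fun `]0, T[ h.
  by apply: measurable_funTS; exact: continuous_measurable_fun.
have := @integrableMl _ _ _ mu `]0, T[ (measurable_itv _) _ h fi mh.
rewrite (_ : (_ \* _)%E = EFin \o (fun t => f t * h t)); last by apply/funext => t /=.
apply; have [c c1 c2] := EVT_max (ltW T0) (continuous_subspaceT ch).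
have [c' c1' c2'] := EVT_min (ltW T0) (continuous_subspaceT ch).
exists (`|h c| + `|h c'|); split; first exact: num_real.
move=> B hB t /= tT.
have tab : t \in `[0, T]%R by apply: subset_itv_oo_cc tT.
apply: ltW; apply: le_lt_trans hB; rewrite ler_norml; apply/andP; split.
  have := c2' t tab; have := ler_norm (- h c'); rewrite normrN.
  have := normr_ge0 (h c); lra.
have := c2 t tab; have := ler_norm (h c); have := normr_ge0 (h c'); lra.
Qed.

(** The function z S(T - t) + y C(T - t) is absolutely continuous and has almost
    everywhere the derivative f S(T - t); it is 0 at 0 and y at T. *)
Lemma duhamel (f y z w : R -> R) : mu.-integrable `]0, T[ (EFin \o f) ->
  abs_continuous 0 T y -> abs_continuous 0 T z ->
  (forall t, `]0, T[%classic t -> is_derive t (1 : R) y (z t)) ->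
  {ae mu, forall t, `]0, T[%classic t -> is_derive t (1 : R) z (w t)} ->
  {ae mu, forall t, `]0, T[%classic t -> w t + lam * y t = f t} ->
  y 0 = 0 -> z 0 = 0 ->
  y T = \int[mu]_(t in `]0, T[) (f t * Sfun (T - t) lam).
Proof.
move=> fi acy acz yD zD wE y0 z0.
have SD t := is_derive_rev t is_derive_Sfun.
have CD t := is_derive_rev t is_derive_Cfun.
have cS : continuous (fun s => Sfun (T - s) lam) by move=> t; exact: derive_cont (SD t).
have cC : continuous (fun s => Cfun (T - s)) by move=> t; exact: derive_cont (CD t).
have gi := integrable_mul_cont fi cS.
pose g t := f t * Sfun (T - t) lam.
pose G t := z t * Sfun (T - t) lam + y t * Cfun (T - t) - indef T g t.
have cS' : continuous (fun s => - Cfun (T - s)) by move=> t; apply: cvgN; exact: cC.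
have cC' : continuous (fun s => - (- lam * Sfun (T - s) lam)).
  move=> t; apply: cvgN; apply: cvgM; [exact: cvg_cst|exact: cS].
have : G T = G 0.
  apply: abs_continuous_cst; first exact: ltW.
    apply: abs_continuousB; last exact: abs_continuous_indef.
    apply: abs_continuousD; apply: abs_continuousM => //; try exact: ltW.
      exact: abs_continuous_C1 SD cS' (ltW T0).
    exact: abs_continuous_C1 CD cC' (ltW T0).
  have indD := ae_derive_indef gi.
  move: zD wE indD; apply: filterS3; first exact: (ae_filter_ringOfSetsType mu).
  move=> t zD wE iD tT; move: (zD tT) (wE tT) (iD tT) (yD t tT) => {}zD {}wE {}iD {}yD'.
  apply: is_derive_eq (is_deriveB (is_deriveD (is_deriveM zD (SD t)) (is_deriveM yD' (CD t))) iD) _.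
  by rewrite /GRing.scale /= -wE; ring.
rewrite -indefT /G y0 z0 subrr Sfun0 Cfun0 (indef0 T g (lexx 0)).
move: (indef T _ T) (Sfun _ _) (Cfun _) => I S C; lra.
Qed.

(** Variation of constants: y = S F1 - C F2 with F1 and F2 the indefinite
    integrals of C f and S f.  In order that y be differentiable at every point
    of ]0, T[, it is defined as the antiderivative of its continuous would-be
    derivative z = C F1 + lam S F2. *)
Lemma oscillator_exists (f : R -> R) : mu.-integrable `]0, T[ (EFin \o f) ->
  exists y z : R -> R, [/\ abs_continuous 0 T y /\ abs_continuous 0 T z,
    forall t, is_derive t (1 : R) y (z t),
    {ae mu, forall t, `]0, T[%classic t -> is_derive t (1 : R) z (f t - lam * y t)} &
    y 0 = 0 /\ z 0 = 0].
Proof.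
move=> fi.
have cS := continuous_Sfun; have cC := continuous_Cfun.
pose F1 := indef T (fun t => f t * Cfun t).
pose F2 := indef T (fun t => f t * Sfun t lam).
have F1i := integrable_mul_cont fi cC; have F2i := integrable_mul_cont fi cS.
have acF1 a b : abs_continuous a b F1 by exact: abs_continuous_indef.
have acF2 a b : abs_continuous a b F2 by exact: abs_continuous_indef.
have acS a b : a <= b -> abs_continuous a b (fun s => Sfun s lam).
  exact: abs_continuous_C1 is_derive_Sfun cC.
have acC a b : a <= b -> abs_continuous a b Cfun.
  apply: abs_continuous_C1 is_derive_Cfun _ => t.
  by apply: cvgM; [exact: cvg_cst|exact: cS].
pose z t := Cfun t * F1 t + lam * (Sfun t lam * F2 t).
have acz a b : a <= b -> abs_continuous a b z.
  move=> ab; apply: abs_continuousD; last apply: abs_continuousZ;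
    by apply: abs_continuousM => //; [exact: acC || exact: acS].
have cz : continuous z.
  move=> t; apply/cvgrPdist_lt => e e0.
  have tt : t - 1 <= t + 1 by lra.
  have [d d0 Hd] := acz _ _ tt e e0.
  apply/nbhs_ballP; exists (Num.min d 1) => /=; first by rewrite lt_min d0 ltr01.
  move=> s; rewrite /ball /= lt_min [X in _ && X]ltr_norml => /andP[sd /andP[s1 s2]].
  have tr (p q : R) : trivIset [set: 'I_1] (fun=> `]p, q[%classic).
    by apply/trivIsetP => i j _ _; rewrite !ord1 eqxx.
  have [st|/ltW ts] := leP s t.
    have := Hd 1%N (fun=> s) (fun=> t); rewrite !big_ord1; apply => //.
      by move=> _; lra.
    by apply: le_lt_trans sd; exact: ler_norm.
  have := Hd 1%N (fun=> t) (fun=> s); rewrite !big_ord1 distrC; apply => //.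
    by move=> _; lra.
  by apply: le_lt_trans sd; rewrite distrC ler_norm.
pose y := prim z.
have yD t : is_derive t (1 : R) y (z t) by exact: primP.
have y0 : y 0 = 0 by rewrite /y /prim subrr.
have F10 : F1 0 = 0 by exact: indef0.
have F20 : F2 0 = 0 by exact: indef0.
have aeF1 := ae_derive_indef F1i; have aeF2 := ae_derive_indef F2i.
have yE t : 0 <= t -> t <= T -> y t = Sfun t lam * F1 t - Cfun t * F2 t.
  move=> t0 tT; pose G s := y s - (Sfun s lam * F1 s - Cfun s * F2 s).
  have : G t = G 0.
    apply: abs_continuous_cst => //.
      apply: abs_continuousB; first exact: abs_continuous_C1 yD cz t0.
      by apply: abs_continuousB; apply: abs_continuousM => //; [exact: acS|exact: acC].
    move: aeF1 aeF2; apply: filterS2; first exact: (ae_filter_ringOfSetsType mu).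
    move=> s H1 H2; rewrite /= in_itv/= => /andP[s0 st].
    have sT : `]0, T[%classic s by rewrite /= in_itv/= s0 (lt_le_trans st).
    apply: is_derive_eq (is_deriveB (yD s) (is_deriveB
      (is_deriveM (is_derive_Sfun s) (H1 sT)) (is_deriveM (is_derive_Cfun s) (H2 sT)))) _.
    by rewrite /GRing.scale /= /z -/F1 -/F2; ring.
  by rewrite /G y0 F10 F20 !mulr0 !subr0 => /eqP; rewrite subr_eq0 => /eqP.
exists y, z; split => //.
- split; [exact: abs_continuous_C1 yD cz (ltW T0)|exact: acz (ltW T0)].
- move: aeF1 aeF2; apply: filterS2; first exact: (ae_filter_ringOfSetsType mu).
  move=> t H1 H2 tT; have tT' := tT; rewrite /= in_itv/= in tT'; case/andP: tT' => t0 t1.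
  apply: is_derive_eq (is_deriveD (is_deriveM (is_derive_Cfun t) (H1 tT))
    (is_derive_scale lam (is_deriveM (is_derive_Sfun t) (H2 tT)))) _.
  rewrite /GRing.scale /= (yE t (ltW t0) (ltW t1)) -/F1 -/F2.
  transitivity (f t * (Cfun t ^+ 2 + lam * Sfun t lam ^+ 2) -
    lam * (Sfun t lam * F1 t - Cfun t * F2 t)); first by ring.
  by rewrite Cfun_Sfun mulr1.
- by split => //; rewrite /z F10 F20 !mulr0 addr0.
Qed.

End Oscillator.

(** * The control operator *)

Section RealSystem.
Variable R : realType.
Local Notation mu := (@lebesgue_measure R).
Variables (a b : nat -> R) (n : nat) (lam om : 'I_n.+1 -> R) (T : R).
Hypothesis spec : is_spectral a b lam om.
Hypothesis T0 : 0 < T.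

Local Notation p k x := ((phi a b k).[x]).

Definition real_solution (F : R -> R) (U V : 'I_n.+1 -> R -> R) : Prop :=
  [/\ forall k, abs_continuous 0 T (U k) /\ abs_continuous 0 T (V k),
      forall k t, `]0, T[%classic t -> is_derive t (1 : R) (U k) (V k t),
      {ae mu, forall t, `]0, T[%classic t -> forall k, is_derive t (1 : R) (V k)
         ((k == 0)%:R * F t - \sum_(l < n.+1) jacobi n.+1 a b k l * U l t)} &
      forall k, U k 0 = 0 /\ V k 0 = 0].

Lemma is_derive_lincomb (c : 'I_n.+1 -> R) (g : 'I_n.+1 -> R -> R) (d : 'I_n.+1 -> R) t :
  (forall k, is_derive t (1 : R) (g k) (d k)) ->
  is_derive t (1 : R) (fun s => \sum_k c k * g k s) (\sum_k c k * d k).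
Proof.
move=> gD; have := @is_derive_sum R R R n.+1 (fun k s => c k * g k s) t 1 (fun k => c k * d k)
  (fun k => is_derive_scale (c k) (gD k)).
rewrite (_ : \sum_(i < n.+1) _ = (fun s => \sum_k c k * g k s))//.
by apply/funext => s; rewrite fct_sumE.
Qed.

(** The expansion of x in the eigenvectors. *)
Lemma spectral_sum (k : 'I_n.+1) (x : 'I_n.+1 -> R) :
  \sum_j om j * p k.+1 (lam j) * (\sum_(l < n.+1) p l.+1 (lam j) * x l) = x k.
Proof.
have [_ cpl _ _] := spec.
under eq_bigr do rewrite mulr_sumr.
rewrite exchange_big /= (bigD1 k)//= [X in _ + X]big1 ?addr0.
  transitivity ((\sum_j om j * (p k.+1 (lam j) * p k.+1 (lam j))) * x k).
    by rewrite mulr_suml; apply: eq_bigr => j _; rewrite !mulrA.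
  by rewrite cpl eqxx mul1r.
move=> l lk; transitivity ((\sum_j om j * (p k.+1 (lam j) * p l.+1 (lam j))) * x l).
  by rewrite mulr_suml; apply: eq_bigr => j _; rewrite !mulrA.
by rewrite cpl eq_sym (negbTE lk) mul0r.
Qed.

Lemma phi1E (x : R) : p 1 x = 1.
Proof. by rewrite /phi hornerC. Qed.

(** The components of U on the eigenvectors are driven oscillators. *)
Lemma real_solution_final (F : R -> R) U V : mu.-integrable `]0, T[ (EFin \o F) ->
  real_solution F U V -> forall k, U k T =
  \sum_j om j * p k.+1 (lam j) * \int[mu]_(t in `]0, T[) (F t * Sfun (T - t) (lam j)).
Proof.
move=> Fi [acUV UD VD U0] k; have [_ _ _ eig] := spec.
rewrite -[LHS](spectral_sum k (fun l => U l T)); apply: eq_bigr => j _; congr (_ * _).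
pose y t := \sum_(l < n.+1) p l.+1 (lam j) * U l t.
pose z t := \sum_(l < n.+1) p l.+1 (lam j) * V l t.
apply: (@duhamel R (lam j) T T0 F y z (fun t => F t - lam j * y t)) => //.
- by apply: abs_continuous_sum => l; apply: abs_continuousZ; case: (acUV l).
- by apply: abs_continuous_sum => l; apply: abs_continuousZ; case: (acUV l).
- by move=> t tT; apply: is_derive_lincomb => l; exact: UD.
- move: VD; apply: filterS; first exact: (ae_filter_ringOfSetsType mu).
  move=> t VD tT; apply: is_derive_eq (is_derive_lincomb _ (VD tT)) _.
  under eq_bigr do rewrite mulrBr; rewrite sumrB; congr (_ - _).
    rewrite (bigD1 0)// eqxx mul1r phi1E mul1r big1 /= ?addr0// => i /negbTE ->.
    by rewrite mul0r mulr0.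
  under eq_bigr do rewrite mulr_sumr.
  rewrite exchange_big /= /y mulr_sumr; apply: eq_bigr => l _.
  rewrite mulrA -eig mulr_suml; apply: eq_bigr => i _.
  by rewrite jacobi_sym; ring.
- apply: aeW => t _; by rewrite subrK.
- by rewrite /y big1// => l _; have [-> _] := U0 l; rewrite mulr0.
- by rewrite /z big1// => l _; have [_ ->] := U0 l; rewrite mulr0.
Qed.

Lemma real_solution_exists (F : R -> R) : mu.-integrable `]0, T[ (EFin \o F) ->
  exists U V, real_solution F U V.
Proof.
move=> Fi; have [_ cpl _ eig] := spec.
have H j := oscillator_exists (lam j) T0 Fi.
have /fin_all_exists[y Hy] j : exists y, exists z : R -> R,
    [/\ abs_continuous 0 T y /\ abs_continuous 0 T z,
    forall t, is_derive t (1 : R) y (z t),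
    {ae mu, forall t, `]0, T[%classic t -> is_derive t (1 : R) z (F t - lam j * y t)} &
    y 0 = 0 /\ z 0 = 0] by exact: H.
have /fin_all_exists[z Hz] := Hy.
pose U (k : 'I_n.+1) t := \sum_j om j * p k.+1 (lam j) * y j t.
pose V (k : 'I_n.+1) t := \sum_j om j * p k.+1 (lam j) * z j t.
exists U, V; split.
- by move=> k; split; apply: abs_continuous_sum => j; apply: abs_continuousZ;
    case: (Hz j) => -[].
- by move=> k t _; apply: is_derive_lincomb => j; case: (Hz j).
- have aez : {ae mu, forall t, forall j, `]0, T[%classic t ->
      is_derive t (1 : R) (z j) (F t - lam j * y j t)}.
    have : {ae mu, forall t m, `]0, T[%classic t ->
        is_derive t (1 : R) (z (inord m)) (F t - lam (inord m) * y (inord m) t)}.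
      by apply: ae_foralln => m; case: (Hz (inord m)).
    apply: filterS; first exact: (ae_filter_ringOfSetsType mu).
    by move=> t H' j; have := H' j; rewrite inord_val.
  move: aez; apply: filterS; first exact: (ae_filter_ringOfSetsType mu).
  move=> t zD tT k; apply: is_derive_eq (is_derive_lincomb _ (fun j => zD j tT)) _.
  under eq_bigr do rewrite mulrBr; rewrite sumrB; congr (_ - _).
    rewrite -mulr_suml; congr (_ * _); rewrite -cpl; apply: eq_bigr => j _.
    by rewrite phi1E mulr1.
  rewrite /U; under [RHS]eq_bigr do rewrite mulr_sumr.
  rewrite exchange_big /=; apply: eq_bigr => j _.
  transitivity (om j * y j t * (lam j * p k.+1 (lam j))); first by ring.
  rewrite -eig mulr_sumr; apply: eq_bigr => l _; ring.
- by move=> k; split; rewrite /U /V big1// => j _; case: (Hz j) => _ _ _ [h1 h2]; rewrite ?h1 ?h2 mulr0.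
Qed.

End RealSystem.

Section ControlOperator.
Variable R : realType.
Local Notation C := R[i].
Local Notation mu := (@lebesgue_measure R).
Variables (a b : nat -> R) (n : nat) (lam om : 'I_n.+1 -> R) (T : R).
Hypothesis spec : is_spectral a b lam om.
Hypothesis T0 : 0 < T.

Local Notation p k x := ((phi a b k).[x]).

(** On a set of finite measure, square integrability of g is enough to integrate
    what is dominated by 1 + g^2. *)
Lemma integrable_dom (D : set R) (f : R -> R) (g : R -> R) : measurable D ->
  measurable_fun D f -> measurable_fun D g -> (mu D < +oo)%E ->
  (\int[mu]_(t in D) (g t ^+ 2)%:E < +oo)%E ->
  (forall t, D t -> `|f t| <= 1 + g t ^+ 2) -> mu.-integrable D (EFin \o f).
Proof.
move=> mD mf mg muD gfin fg; apply/integrableP; split; first exact/measurable_EFinP.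
have mg2 : measurable_fun D (fun t => (g t ^+ 2)%:E).
  by apply/measurable_EFinP; exact: measurable_funX.
apply: (@le_lt_trans _ _ (\int[mu]_(t in D) (1%:E + (g t ^+ 2)%:E))%E).
  apply: ge0_le_integral => //.
  - by apply: measurableT_comp => //; apply/measurable_EFinP.
  - by apply: emeasurable_funD => //; exact: measurable_cst.
rewrite ge0_integralD//=.
- by rewrite integral_cst// mul1e lte_add_pinfty.
- by move=> t _; rewrite lee_fin sqr_ge0.
Qed.

Lemma measurable_normc (D : set R) (f : R -> C) :
  measurable_fun D (fun t => complex.Re (f t)) ->
  measurable_fun D (fun t => complex.Im (f t)) ->
  measurable_fun D (fun t => normc (f t)).
Proof.
move=> m1 m2.
have -> : (fun t => normc (f t)) = (fun t => Num.sqrt (complex.Re (f t) ^+ 2 + complex.Im (f t) ^+ 2)).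
  by apply/funext => t; case: (f t).
apply: (@measurableT_comp _ _ _ _ _ _ (@Num.sqrt R)).
  exact: continuous_measurable_fun (@sqrt_continuous R).
by apply: measurable_funD; exact: measurable_funX.
Qed.

Lemma control_integrable (f : R -> C) : control_space T f ->
  mu.-integrable `]0, T[ (EFin \o (fun t => complex.Re (f t))) /\
  mu.-integrable `]0, T[ (EFin \o (fun t => complex.Im (f t))).
Proof.
move=> [m1 [m2 fin]]; have mn := measurable_normc m1 m2.
have muT : (mu `]0%R, T[ < +oo)%E.
  by rewrite lebesgue_measure_itv/=; case: ifP => _; rewrite ?ltry.
have le1 (x : R) : x <= 1 + x ^+ 2 by nra.
split; apply: (integrable_dom (g := fun t => normc (f t))) => // t _.
  exact: le_trans (normc_Re _) (le1 _).
exact: le_trans (normc_Im _) (le1 _).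
Qed.

Definition spectral_moment (f : R -> C) (j : 'I_n.+1) : C :=
  cintegral `]0, T[ (fun t => f t * (Sfun (T - t) (lam j))%:C).

Lemma spectral_momentE f j : spectral_moment f j =
  (\int[mu]_(t in `]0, T[) (complex.Re (f t) * Sfun (T - t) (lam j))) +i*
  (\int[mu]_(t in `]0, T[) (complex.Im (f t) * Sfun (T - t) (lam j))).
Proof.
rewrite /spectral_moment /cintegral; congr (_ +i* _); apply: eq_Rintegral => t _.
  by rewrite cReMr.
by rewrite cImMr.
Qed.

Lemma forcing_entry (x : C) (k : 'I_n.+1) : forcing n.+1 x k 0 = (k == 0)%:R * x.
Proof. by rewrite mxE -val_eqE /=; case: ifP => _; rewrite ?mul1r ?mul0r. Qed.

Lemma solution_final (f : R -> C) (u : R -> 'cV[C]_n.+1) : control_space T f -> is_solution a b T f u ->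
  forall k, u T k 0 = \sum_j (om j * p k.+1 (lam j))%:C * spectral_moment f j.
Proof.
move=> /control_integrable[f1 f2] [v [w [[acu acv] uD vD eqn [u0 v0]]]] k.
have eqk : {ae mu, forall t, `]0, T[%classic t -> forall k, w t k 0 =
    (k == 0)%:R * f t - \sum_(l < n.+1) (jacobi n.+1 a b k l)%:C * u t l 0}.
  move: eqn; apply: filterS; first exact: (ae_filter_ringOfSetsType mu).
  move=> t H tT l; have /matrixP/(_ l 0) := H tT; rewrite forcing_entry => <-.
  rewrite [X in X - _]mxE [X in _ + X - _]mxE.
  have -> : \sum_(j < n.+1) map_mx (real_complex R) (jacobi n.+1 a b) l j * u t j 0 =
      \sum_(j < n.+1) (jacobi n.+1 a b l j)%:C * u t j 0.
    by apply: eq_bigr => j _; rewrite [X in X * _]mxE.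
  by rewrite addrK.
have re : real_solution a b T (fun t => complex.Re (f t))
    (fun k t => complex.Re (u t k 0)) (fun k t => complex.Re (v t k 0)).
  split.
  - by move=> l; split; [case: (acu l)|case: (acv l)].
  - by move=> l t tT; case: (uD t tT l).
  - move: vD eqk; apply: filterS2; first exact: (ae_filter_ringOfSetsType mu).
    move=> t H1 H2 tT l; have [D _] := H1 tT l; apply: is_derive_eq D _.
    rewrite (H2 tT l) cReB cRe_sum; congr (_ - _).
      by case: (l == 0); rewrite ?mul1r ?mul0r.
    by apply: eq_bigr => m _; rewrite mulrC cReMr mulrC.
  - by move=> l; rewrite u0 v0 !mxE.
have im : real_solution a b T (fun t => complex.Im (f t))
    (fun k t => complex.Im (u t k 0)) (fun k t => complex.Im (v t k 0)).
  split.
  - by move=> l; split; [case: (acu l)|case: (acv l)].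
  - by move=> l t tT; case: (uD t tT l).
  - move: vD eqk; apply: filterS2; first exact: (ae_filter_ringOfSetsType mu).
    move=> t H1 H2 tT l; have [_ D] := H1 tT l; apply: is_derive_eq D _.
    rewrite (H2 tT l) cImB cIm_sum; congr (_ - _).
      by case: (l == 0); rewrite ?mul1r ?mul0r.
    by apply: eq_bigr => m _; rewrite mulrC cImMr mulrC.
  - by move=> l; rewrite u0 v0 !mxE.
apply: complex_eqP.
  rewrite (real_solution_final spec T0 f1 re) cRe_sum; apply: eq_bigr => j _.
  by rewrite mulrC [in RHS]mulrC cReMr spectral_momentE.
rewrite (real_solution_final spec T0 f2 im) cIm_sum; apply: eq_bigr => j _.
by rewrite mulrC [in RHS]mulrC cImMr spectral_momentE.
Qed.

Lemma solution_exists (f : R -> C) : control_space T f ->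
  exists u : R -> 'cV[C]_n.+1, is_solution a b T f u.
Proof.
move=> /control_integrable[f1 f2].
have [U1 [V1 [ac1 D1 W1 I1]]] := real_solution_exists spec T0 f1.
have [U2 [V2 [ac2 D2 W2 I2]]] := real_solution_exists spec T0 f2.
pose u t : 'cV[C]_n.+1 := \col_k (U1 k t +i* U2 k t).
pose v t : 'cV[C]_n.+1 := \col_k (V1 k t +i* V2 k t).
have uE k : (fun t => u t k 0) = (fun t => U1 k t +i* U2 k t).
  by apply/funext => t; rewrite mxE.
have vE k : (fun t => v t k 0) = (fun t => V1 k t +i* V2 k t).
  by apply/funext => t; rewrite mxE.
pose w t : 'cV[C]_n.+1 := forcing n.+1 (f t) -
  map_mx (real_complex R) (jacobi n.+1 a b) *m u t.
exists u, v, w; split.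
- split=> k; rewrite ?uE ?vE; split => /=.
  + by case: (ac1 k).
  + by case: (ac2 k).
  + by case: (ac1 k).
  + by case: (ac2 k).
- by move=> t tT k; rewrite uE mxE; split; [exact: D1|exact: D2].
- move: W1 W2; apply: filterS2; first exact: (ae_filter_ringOfSetsType mu).
  move=> t H1 H2 tT k; rewrite vE.
  have wE : w t k 0 = (k == 0)%:R * f t - \sum_(l < n.+1) (jacobi n.+1 a b k l)%:C * (U1 l t +i* U2 l t).
    rewrite /w [LHS]mxE forcing_entry; congr (_ + _).
    rewrite [LHS]mxE [X in - X]mxE; congr (- _); apply: eq_bigr => l _.
    by rewrite [X in X * _]mxE [X in _ * X]mxE.
  split.
    apply: is_derive_eq (H1 tT k) _; rewrite wE cReB cRe_sum; congr (_ - _).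
      by case: (k == 0); rewrite ?mul1r ?mul0r.
    by apply: eq_bigr => m _; rewrite [in RHS]mulrC cReMr mulrC.
  apply: is_derive_eq (H2 tT k) _; rewrite wE cImB cIm_sum; congr (_ - _).
    by case: (k == 0); rewrite ?mul1r ?mul0r.
  by apply: eq_bigr => m _; rewrite [in RHS]mulrC cImMr mulrC.
- by apply: aeW => t _; rewrite subrK.
- by split; apply/colP => k; rewrite !mxE; have [h1 h2] := I1 k; have [h3 h4] := I2 k;
    rewrite ?h1 ?h2 ?h3 ?h4.
Qed.

Theorem control_opE (f : R -> C) : control_space T f -> forall k,
  control_op n.+1 a b T f k 0 = \sum_j (om j * p k.+1 (lam j))%:C * spectral_moment f j.
Proof.
move=> cf; have [u Hu] := solution_exists cf.
apply: solution_final => //; rewrite /solution; case: xgetP => // /(_ u).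
by move=> /(_ Hu).
Qed.

End ControlOperator.

(** * Invertibility of the Gram matrix *)

Section Gram.
Variable R : realType.
Local Notation C := R[i].
Local Notation mu := (@lebesgue_measure R).
Variables (n : nat) (lam : 'I_n -> R) (T : R).
Hypothesis T0 : 0 < T.
Hypothesis injl : injective lam.

Lemma is_derive_unique (f : R -> R) (t d e : R) :
  is_derive t (1 : R) f d -> is_derive t (1 : R) f e -> d = e.
Proof. by move=> [_ <-] [_ <-]. Qed.

Lemma derive_zero_itv (f : R -> R) (t d : R) : (forall s, 0 < s -> s < T -> f s = 0) ->
  0 < t -> t < T -> is_derive t (1 : R) f d -> d = 0.
Proof.
move=> f0 t0 tT fD; apply: (is_derive_unique fD).
apply: (near_eq_is_derive _ (is_derive_cst 0 t (1 : R))).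
near=> s; apply/esym/f0; near: s; [exact: lt_nbhsr|exact: lt_nbhsl].
Unshelve. all: by end_near. Qed.

(** Differentiating a relation twice multiplies its coefficients by the
    eigenvalues, up to sign. *)
Lemma Sfun_shift (x : 'I_n -> R) :
  (forall s, 0 < s -> s < T -> \sum_l x l * Sfun s (lam l) = 0) ->
  forall s, 0 < s -> s < T -> \sum_l x l * lam l * Sfun s (lam l) = 0.
Proof.
move=> x0.
have dS t : is_derive t (1 : R) (fun s => \sum_l x l * Sfun s (lam l))
    (\sum_l x l * Cfun (lam l) t).
  have := @is_derive_sum R R R n (fun l s => x l * Sfun s (lam l)) t 1
    (fun l => x l * Cfun (lam l) t) (fun l => is_derive_scale (x l) (is_derive_Sfun (lam l) t)).
  rewrite (_ : \sum_(i < n) _ = (fun s => \sum_l x l * Sfun s (lam l)))//.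
  by apply/funext => s; rewrite fct_sumE.
have dC t : is_derive t (1 : R) (fun s => \sum_l x l * Cfun (lam l) s)
    (\sum_l x l * (- lam l * Sfun t (lam l))).
  have := @is_derive_sum R R R n (fun l s => x l * Cfun (lam l) s) t 1
    (fun l => x l * (- lam l * Sfun t (lam l)))
    (fun l => is_derive_scale (x l) (is_derive_Cfun (lam l) t)).
  rewrite (_ : \sum_(i < n) _ = (fun s => \sum_l x l * Cfun (lam l) s))//.
  by apply/funext => s; rewrite fct_sumE.
have C0 s : 0 < s -> s < T -> \sum_l x l * Cfun (lam l) s = 0.
  by move=> s0 sT; exact: (derive_zero_itv x0 s0 sT (dS s)).
move=> s s0 sT; have := derive_zero_itv C0 s0 sT (dC s).
under eq_bigr do rewrite mulNr mulrN.
by rewrite sumrN => /eqP; rewrite oppr_eq0 => /eqP E; rewrite -[RHS]E; apply: eq_bigr => l _; rewrite mulrA.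
Qed.

(** Combining a relation with its second derivative eliminates one eigenvalue;
    after eliminating all but lam j, the function S(s, lam j) would vanish on an
    interval, together with its derivative, against conservation of energy. *)
Lemma Sfun_free (x : 'I_n -> R) :
  (forall s, 0 < s -> s < T -> \sum_l x l * Sfun s (lam l) = 0) -> forall j, x j = 0.
Proof.
move=> x0 j.
have kill (s : seq 'I_n) : forall t, 0 < t -> t < T ->
    \sum_l x l * (\prod_(i <- s) (lam l - lam i)) * Sfun t (lam l) = 0.
  elim: s => [|i s IH] t t0 tT.
    by under eq_bigr do rewrite big_nil mulr1; exact: x0.
  have H1 := Sfun_shift IH t0 tT; have H2 := IH t t0 tT.
  transitivity (\sum_l x l * (\prod_(i <- s) (lam l - lam i)) * lam l * Sfun t (lam l)
    - lam i * \sum_l x l * (\prod_(i <- s) (lam l - lam i)) * Sfun t (lam l)).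
    rewrite mulr_sumr -sumrB; apply: eq_bigr => l _; rewrite big_cons; ring.
  by rewrite H1 H2 mulr0 subrr.
pose s := [seq i <- index_enum 'I_n | i != j].
pose q := \prod_(i <- s) (lam j - lam i).
have q0 : q != 0.
  rewrite prodf_seq_neq0; apply/allP => i; rewrite mem_filter => /andP[ij _] /=.
  by rewrite subr_eq0; apply: contra ij => /eqP/injl ->.
have xS t : 0 < t -> t < T -> x j * q * Sfun t (lam j) = 0.
  move=> t0 tT; have := kill s t t0 tT; rewrite [LHS](bigD1 j)//= [X in _ + X]big1 ?addr0 => [|l lj]; first by [].
  
  have -> : \prod_(i <- s) (lam l - lam i) = 0.
    rewrite (big_rem l) /= ?subrr ?mul0r//.
    by rewrite mem_filter lj mem_index_enum.
  by rewrite mulr0 mul0r.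
have tT0 : 0 < T / 2 by rewrite divr_gt0.
have tT1 : T / 2 < T by lra.
have S0 t : 0 < t -> t < T -> x j * q != 0 -> Sfun t (lam j) = 0.
  move=> t0 tT xq; have /eqP := xS t t0 tT; rewrite mulf_eq0 (negbTE xq) /=.
  by move/eqP.
apply/eqP; rewrite -[_ == 0]negbK; apply/negP => xj0.
have xq : x j * q != 0 by rewrite mulf_neq0.
have C0 : Cfun (lam j) (T / 2) = 0.
  apply: (derive_zero_itv _ tT0 tT1 (is_derive_Sfun (lam j) (T / 2))).
  by move=> t t0 tT; exact: S0.
have := Cfun_Sfun (lam j) (T / 2); rewrite C0 S0// !expr0n mulr0 addr0 => /eqP.
by rewrite eq_sym oner_eq0.
Qed.

Lemma Sfun_rev_cont (l : R) : continuous (fun t => Sfun (T - t) l).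
Proof. by move=> t; exact: derive_cont (is_derive_rev T t (is_derive_Sfun l)). Qed.

Definition gram (j l : 'I_n) : R :=
  \int[mu]_(t in `]0, T[) (Sfun (T - t) (lam j) * Sfun (T - t) (lam l)).

Lemma cont_integrable (f : R -> R) : continuous f -> mu.-integrable `]0, T[ (EFin \o f).
Proof.
move=> cf; have fi : mu.-integrable `[0, T] (EFin \o f).
  apply: continuous_compact_integrable; first exact: segment_compact.
  exact: continuous_subspaceT.
by apply: integrableS fi => //; exact: subset_itv_oo_cc.
Qed.

Lemma Rintegral_sum (m : nat) (f : 'I_m -> R -> R) (D : set R) : measurable D ->
  (forall i, mu.-integrable D (EFin \o f i)) ->
  \int[mu]_(t in D) (\sum_(i < m) f i t) = \sum_(i < m) \int[mu]_(t in D) f i t.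
Proof.
move=> mD; elim: m f => [|m IH] f fi.
  under eq_Rintegral do rewrite big_ord0.
  by rewrite big_ord0 Rintegral_cst// mul0r.
under eq_Rintegral do rewrite big_ord_recl.
rewrite big_ord_recl -IH//; apply: RintegralD => //.
rewrite (_ : EFin \o _ = (fun t => \sum_(i < m) (f (lift ord0 i) t)%:E)%E).
  by apply: integrable_sum => // i _; exact: fi.
by apply/funext => t; rewrite /= sumEFin.
Qed.

Lemma cont_integral0 (g : R -> R) : continuous g -> (forall t, 0 <= g t) ->
  \int[mu]_(t in `]0, T[) g t = 0 -> forall t, 0 < t -> t < T -> g t = 0.
Proof.
move=> cg g0 ig.
have PT : prim g T - prim g 0 = 0.
  have := antiderivative_Rintegral cg (primP cg) T0.
  have gi := cont_integrable cg.
  move: ig; rewrite Rintegral_itv_bndo_bndc// Rintegral_itv_obnd_cbnd.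
    by rewrite /Rintegral => + E; rewrite E.
  have fi : mu.-integrable `[0, T] (EFin \o g).
    apply: continuous_compact_integrable; first exact: segment_compact.
    exact: continuous_subspaceT.
  by apply: integrableS fi => //; exact: subset_itv_oc_cc.
have P0 s : 0 < s -> s < T -> prim g s - prim g 0 = 0.
  move=> s0 sT; apply/eqP; rewrite eq_le; apply/andP; split.
    have := mvt_nondecr (primP cg) (ltW sT) (fun x _ => g0 x); move: PT; lra.
  by have := mvt_nondecr (primP cg) (ltW s0) (fun x _ => g0 x); lra.
move=> t t0 tT; apply: (derive_zero_itv P0 t0 tT).
have := is_deriveB (primP cg t) (is_derive_cst (prim g 0) t (1 : R)).
by rewrite subr0.
Qed.

(** A vector x in the kernel gives h(t) = sum_l x_l S(T - t, lam_l) with zero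
    integral of h^2. *)
Lemma gram_unit : (\matrix_(j < n, l < n) gram j l) \in unitmx.
Proof.
set G := \matrix_(j < n, l < n) gram j l.
suff inj (x : 'rV[R]_n) : x *m G = 0 -> x = 0.
  rewrite -row_free_unit -kermx_eq0; apply/eqP/row_matrixP => i.
  rewrite row0; apply: inj; rewrite -row_mul.
  by rewrite mulmx_ker row0.
move=> xG.
pose h t := \sum_l x 0 l * Sfun (T - t) (lam l).
have ch : continuous h.
  move=> t; have D : is_derive t (1 : R) h (\sum_l x 0 l * - Cfun (lam l) (T - t)).
    have := @is_derive_sum R R R n (fun l s => x 0 l * Sfun (T - s) (lam l)) t 1
      (fun l => x 0 l * - Cfun (lam l) (T - t))
      (fun l => is_derive_scale (x 0 l) (is_derive_rev T t (is_derive_Sfun (lam l)))).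
    rewrite (_ : \sum_(i < n) _ = h)//.
    by apply/funext => s; rewrite fct_sumE.
  exact: derive_cont D.
have SSi j l : mu.-integrable `]0, T[
    (EFin \o (fun t => Sfun (T - t) (lam j) * Sfun (T - t) (lam l))).
  apply: cont_integrable => t; apply: cvgM; exact: Sfun_rev_cont.
have hh0 : \int[mu]_(t in `]0, T[) (h t * h t) = 0.
  transitivity (\sum_j x 0 j * (x *m G) 0 j); last first.
    by rewrite xG big1// => j _; rewrite mxE mulr0.
  transitivity (\sum_(j < n) \int[mu]_(t in `]0, T[)
      (\sum_(l < n) x 0 j * (x 0 l * (Sfun (T - t) (lam l) * Sfun (T - t) (lam j))))).
    rewrite -Rintegral_sum//.
      apply: eq_Rintegral => t _; rewrite /h mulr_suml; apply: eq_bigr => j _.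
      rewrite mulr_sumr; apply: eq_bigr => l _; ring.
    move=> j; rewrite (_ : EFin \o _ = (fun t => \sum_(l < n)
        (x 0 j * (x 0 l * (Sfun (T - t) (lam l) * Sfun (T - t) (lam j))))%:E)%E); last first.
      by apply/funext => t; rewrite /= sumEFin.
    apply: integrable_sum => // l _; apply: cont_integrable => t.
    apply: cvgM; first exact: cvg_cst.
    apply: cvgM; first exact: cvg_cst.
    apply: cvgM; exact: Sfun_rev_cont.
  apply: eq_bigr => j _; rewrite Rintegral_sum//; last first.
    move=> l; apply: cont_integrable => t; apply: cvgM; first exact: cvg_cst.
    apply: cvgM; first exact: cvg_cst.
    apply: cvgM; exact: Sfun_rev_cont.
  rewrite mxE mulr_sumr; apply: eq_bigr => l _.
  rewrite RintegralZl//; last first.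
    apply: cont_integrable => t; apply: cvgM; first exact: cvg_cst.
    apply: cvgM; exact: Sfun_rev_cont.
  by rewrite RintegralZl// [X in _ = _ * (_ * X)]mxE.
have hz t : 0 < t -> t < T -> h t = 0.
  move=> t0 tT; have : h t * h t = 0.
    apply: (@cont_integral0 (fun t => h t * h t)) => //.
      by move=> s; apply: cvgM; exact: ch.
    by move=> s; rewrite -expr2 sqr_ge0.
  by move/eqP; rewrite mulf_eq0 orbb => /eqP.
apply/rowP => j; rewrite [RHS]mxE; apply: Sfun_free => s s0 sT.
have := hz (T - s); rewrite /h subKr; apply; lra.
Qed.

End Gram.

(** * Linearity of complex integrals *)

Section ComplexIntegral.
Variable R : realType.
Local Notation C := R[i].
Local Notation mu := (@lebesgue_measure R).

Definition cintegrable (D : set R) (f : R -> C) : Prop :=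
  mu.-integrable D (EFin \o (fun t => complex.Re (f t))) /\
  mu.-integrable D (EFin \o (fun t => complex.Im (f t))).

Section Domain.
Variable D : set R.
Hypothesis mD : measurable D.

Lemma integrableZ (c : R) (f : R -> R) : mu.-integrable D (EFin \o f) ->
  mu.-integrable D (EFin \o (fun t => c * f t)).
Proof.
move=> fi; have := @integrableZl _ _ _ mu D mD c _ fi.
by congr (_.-integrable _ _); apply/funext => t.
Qed.

Lemma integrableDr (f g : R -> R) : mu.-integrable D (EFin \o f) ->
  mu.-integrable D (EFin \o g) ->
  mu.-integrable D (EFin \o (fun t => f t + g t)).
Proof. by move=> fi gi; exact: (@integrableD _ _ _ mu D mD _ _ fi gi). Qed.

Lemma integrable_sumr (m : nat) (f : 'I_m -> R -> R) :
  (forall i, mu.-integrable D (EFin \o f i)) ->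
  mu.-integrable D (EFin \o (fun t => \sum_(i < m) f i t)).
Proof.
move=> fi; rewrite (_ : EFin \o _ = (fun t => \sum_(i < m) (f i t)%:E)%E).
  by apply: integrable_sum => // i _; exact: fi.
by apply/funext => t; rewrite /= sumEFin.
Qed.

Lemma cintegrableZ (c : C) f : cintegrable D f -> cintegrable D (fun t => c * f t).
Proof.
move=> [f1 f2]; split.
  rewrite (_ : (fun t => _) = (fun t => complex.Re c * complex.Re (f t) +
     (- complex.Im c) * complex.Im (f t))).
    by apply: integrableDr; exact: integrableZ.
  by apply/funext => t; rewrite cReM mulNr.
rewrite (_ : (fun t => _) = (fun t => complex.Re c * complex.Im (f t) +
   complex.Im c * complex.Re (f t))).
  by apply: integrableDr; exact: integrableZ.
by apply/funext => t; rewrite cImM.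
Qed.

Lemma cintegralZ (c : C) f : cintegrable D f ->
  cintegral D (fun t => c * f t) = c * cintegral D f.
Proof.
move=> [f1 f2]; apply: complex_eqP; rewrite ?cReM ?cImM /=.
  under eq_Rintegral do rewrite cReM -mulNr.
  by rewrite RintegralD ?RintegralZl// ?mulNr//; exact: integrableZ.
under eq_Rintegral do rewrite cImM.
by rewrite RintegralD ?RintegralZl//; exact: integrableZ.
Qed.

Lemma cintegrable_sum (m : nat) (f : 'I_m -> R -> C) : (forall i, cintegrable D (f i)) ->
  cintegrable D (fun t => \sum_(i < m) f i t).
Proof.
move=> fi; split.
  rewrite (_ : (fun t => _) = (fun t => \sum_(i < m) complex.Re (f i t))).
    by apply: integrable_sumr => i; case: (fi i).
  by apply/funext => t; rewrite cRe_sum.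
rewrite (_ : (fun t => _) = (fun t => \sum_(i < m) complex.Im (f i t))).
  by apply: integrable_sumr => i; case: (fi i).
by apply/funext => t; rewrite cIm_sum.
Qed.

Lemma cintegral_sum (m : nat) (f : 'I_m -> R -> C) : (forall i, cintegrable D (f i)) ->
  cintegral D (fun t => \sum_(i < m) f i t) =
  \sum_(i < m) cintegral D (f i).
Proof.
move=> fi; apply: complex_eqP; rewrite ?cRe_sum ?cIm_sum /=.
  under eq_Rintegral do rewrite cRe_sum.
  by rewrite Rintegral_sum// => i; case: (fi i).
under eq_Rintegral do rewrite cIm_sum.
by rewrite Rintegral_sum// => i; case: (fi i).
Qed.

End Domain.

Variables (T : R).

(** The product is dominated by 1 + (|f|^2 + |g|^2). *)
Lemma control_mul_integrable (f g : R -> C) : control_space T f -> control_space T g ->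
  cintegrable `]0, T[ (fun t => f t * (g t)^*).
Proof.
move=> cf cg; have [f1 [f2 ffin]] := cf; have [g1 [g2 gfin]] := cg.
have mf := measurable_normc f1 f2; have mg := measurable_normc g1 g2.
pose G t := Num.sqrt (normc (f t) ^+ 2 + normc (g t) ^+ 2).
have G2 t : G t ^+ 2 = normc (f t) ^+ 2 + normc (g t) ^+ 2.
  by rewrite sqr_sqrtr// addr_ge0// sqr_ge0.
have mG : measurable_fun `]0, T[ G.
  apply: (@measurableT_comp _ _ _ _ _ _ (@Num.sqrt R)).
    exact: continuous_measurable_fun (@sqrt_continuous R).
  by apply: measurable_funD; exact: measurable_funX.
have muT : (mu `]0%R, T[ < +oo)%E.
  by rewrite lebesgue_measure_itv/=; case: ifP => _; rewrite ?ltry.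
have Gfin : (\int[mu]_(t in `]0%R, T[) (G t ^+ 2)%:E < +oo)%E.
  under eq_integral do rewrite G2 EFinD.
  rewrite ge0_integralD//=.
  - exact: lte_add_pinfty.
  - by move=> t _; rewrite lee_fin sqr_ge0.
  - by apply/measurable_EFinP; exact: measurable_funX.
  - by move=> t _; rewrite lee_fin sqr_ge0.
  - by apply/measurable_EFinP; exact: measurable_funX.
have fgG t : normc (f t * (g t)^*) <= 1 + G t ^+ 2.
  rewrite Normc.normcM normc_conj G2.
  have := normc_ge0 (f t); have := normc_ge0 (g t); nra.
split; apply: (integrable_dom (g := G)) => //.
- rewrite (_ : (fun t => _) = (fun t => complex.Re (f t) * complex.Re (g t) + complex.Im (f t) * complex.Im (g t))).
    by apply: measurable_funD; exact: measurable_funM.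
  by apply/funext => t; rewrite cReM; case: (g t) => u v /=; ring.
- move=> t _; exact: le_trans (normc_Re _) (fgG t).
- rewrite (_ : (fun t => _) = (fun t => complex.Im (f t) * complex.Re (g t) - complex.Re (f t) * complex.Im (g t))).
    by apply: measurable_funB; exact: measurable_funM.
  by apply/funext => t; rewrite cImM; case: (g t) => u v /=; ring.
- move=> t _; exact: le_trans (normc_Im _) (fgG t).
Qed.

Lemma control_inner_conj (f g : R -> C) : control_space T f -> control_space T g ->
  control_inner T f g = (control_inner T g f)^*.
Proof.
move=> cf cg; have [h1 h2] := control_mul_integrable cg cf.
apply: complex_eqP => /=; rewrite /control_inner /=.
  by apply: eq_Rintegral => t _; case: (f t) (g t) => u v [u' v'] /=; ring.
rewrite -mulN1r -RintegralZl//; apply: eq_Rintegral => t _.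
by case: (f t) (g t) => u v [u' v'] /=; ring.
Qed.

Lemma cintegral_ae (f g : R -> C) : cintegrable `]0, T[ f -> cintegrable `]0, T[ g ->
  ae_eq_on T f g -> cintegral `]0, T[ f = cintegral `]0, T[ g.
Proof.
move=> [f1 f2] [g1 g2] fg; apply: complex_eqP => /=; rewrite /Rintegral; congr fine;
  apply: ae_eq_integral => //; try exact: measurable_int f1; try exact: measurable_int f2;
  try exact: measurable_int g1; try exact: measurable_int g2;
  move: fg; apply: filterS; first exact: (ae_filter_ringOfSetsType mu).
  by move=> t H tT; rewrite H.
  exact: (ae_filter_ringOfSetsType mu).
by move=> t H tT; rewrite H.
Qed.

End ComplexIntegral.

(** * Reachable states and the space B_N *)

Section ReachableStates.
Variable R : realType.
Local Notation C := R[i].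
Local Notation mu := (@lebesgue_measure R).
Variables (a b : nat -> R) (n : nat) (lam om : 'I_n.+1 -> R) (T : R).
Hypothesis spec : is_spectral a b lam om.
Hypothesis T0 : 0 < T.

Lemma cont_sum (m : nat) (f : 'I_m -> R -> R) : (forall i, continuous (f i)) ->
  continuous (fun t => \sum_i f i t).
Proof.
elim: m f => [|m IH] f cf t.
  by rewrite (_ : (fun _ => _) = cst 0); [exact: cvg_cst|apply/funext => s; rewrite big_ord0].
rewrite (_ : (fun _ => _) = (fun s => f ord0 s + \sum_i f (lift ord0 i) s)).
  apply: cvgD; first exact: cf.
  by apply: (IH (fun i => f (lift ord0 i))).
by apply/funext => s; rewrite big_ord_recl.
Qed.

Lemma continuous_control (f : R -> C) : continuous (fun t => complex.Re (f t)) ->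
  continuous (fun t => complex.Im (f t)) -> control_space T f.
Proof.
move=> c1 c2; split; first by apply: measurable_funTS; exact: continuous_measurable_fun.
split; first by apply: measurable_funTS; exact: continuous_measurable_fun.
have ci : mu.-integrable `]0, T[ (EFin \o (fun t => normc (f t) ^+ 2)).
  apply: cont_integrable => t.
  under eq_fun do rewrite sqr_normc !expr2.
  by apply: cvgD; apply: cvgM; [exact: c1|exact: c1|exact: c2|exact: c2].
have [_] := integrableP _ _ _ ci; congr (_ < _)%E; apply: eq_integral => t _.
by rewrite /= ger0_norm// sqr_ge0.
Qed.

Definition span_control (c : 'cV[C]_n.+1) (t : R) : C :=
  \sum_l c l 0 * (Sfun (T - t) (lam l))%:C.

Lemma Sfun_control l : control_space T (fun t => (Sfun (T - t) (lam l))%:C).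
Proof. by apply: continuous_control => /=; [exact: Sfun_rev_cont|exact: cst_continuous]. Qed.

Lemma span_control_space c : control_space T (span_control c).
Proof.
apply: continuous_control.
  rewrite (_ : (fun t => _) = (fun t => \sum_l complex.Re (c l 0) * Sfun (T - t) (lam l))).
    by apply: cont_sum => l t; apply: cvgM; [exact: cvg_cst|exact: Sfun_rev_cont].
  by apply/funext => t; rewrite /span_control cRe_sum; apply: eq_bigr => l _; rewrite cReMr.
rewrite (_ : (fun t => _) = (fun t => \sum_l complex.Im (c l 0) * Sfun (T - t) (lam l))).
  by apply: cont_sum => l t; apply: cvgM; [exact: cvg_cst|exact: Sfun_rev_cont].
by apply/funext => t; rewrite /span_control cIm_sum; apply: eq_bigr => l _; rewrite cImMr.
Qed.

Lemma conj_real (x : R) : (x%:C)^* = x%:C :> C.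
Proof. by apply: complex_eqP => /=; rewrite ?oppr0. Qed.

Lemma moment_integrable f l : control_space T f ->
  cintegrable `]0, T[ (fun t => f t * (Sfun (T - t) (lam l))%:C).
Proof.
move=> cf; have := control_mul_integrable cf (Sfun_control l).
by under [X in cintegrable _ X]eq_fun do rewrite conj_real.
Qed.

Definition moments (f : R -> C) : 'cV[C]_n.+1 := \col_j spectral_moment lam T f j.
Definition gramC : 'M[C]_n.+1 := map_mx (real_complex R) (\matrix_(j, l) gram lam T j l).
Definition spectral_mx : 'M[C]_n.+1 := \matrix_(k, j) ((phi a b k.+1).[lam j])%:C.
Definition weight_mx : 'M[C]_n.+1 := diag_mx (\row_j (om j)%:C).

Lemma spectral_mx_orth : spectral_mx *m weight_mx *m spectral_mx^T = 1%:M.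
Proof.
have [_ cpl _ _] := spec.
apply/matrixP => k l; rewrite [RHS]mxE -(rmorph_nat (real_complex R)) -cpl rmorph_sum mxE.
apply: eq_bigr => j _; rewrite /weight_mx mul_mx_diag 4!mxE.
by rewrite [X in _ * X]mxE !rmorphM /= mulrA [X in X * _]mulrC.
Qed.

Lemma control_op_moments f : control_space T f ->
  control_op n.+1 a b T f = spectral_mx *m weight_mx *m moments f.
Proof.
move=> cf; apply/colP => k; rewrite (control_opE spec T0 cf) mxE.
apply: eq_bigr => j _; rewrite /weight_mx mul_mx_diag 4!mxE.
by rewrite rmorphM /= [X in X * _]mulrC.
Qed.

Lemma moments_span c : moments (span_control c) = gramC *m c.
Proof.
apply/colP => j; rewrite mxE [RHS]mxE /spectral_moment.
transitivity (cintegral `]0, T[ (fun t => \sum_l c l 0 * 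
   ((Sfun (T - t) (lam l))%:C * (Sfun (T - t) (lam j))%:C))).
  congr cintegral; apply/funext => t; rewrite mulr_suml; apply: eq_bigr => l _.
  by rewrite mulrA.
rewrite cintegral_sum//; last first.
  by move=> l; apply: cintegrableZ => //; exact/moment_integrable/Sfun_control.
apply: eq_bigr => l _; rewrite cintegralZ//; last exact/moment_integrable/Sfun_control.
rewrite mulrC; congr (_ * _); rewrite 2!mxE /gram; apply: complex_eqP => /=.
  by apply: eq_Rintegral => t _; rewrite mul0r subr0 mulrC.
under eq_Rintegral do rewrite mulr0 mul0r addr0.
by rewrite Rintegral_cst// mul0r.
Qed.

(** The matrix of the control operator on F_1, in the spanning family and in the
    canonical basis. *)
Definition reach_mx := spectral_mx *m weight_mx *m gramC.

Lemma control_op_span c : control_op n.+1 a b T (span_control c) = reach_mx *m c.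
Proof.
by rewrite (control_op_moments (span_control_space c)) moments_span mulmxA.
Qed.

Lemma reach_mx_unit : reach_mx \in unitmx.
Proof.
have [[_ injl] _ _ _] := spec.
rewrite unitmx_mul map_unitmx (gram_unit T0 injl) andbT.
by have [] := mulmx1_unit spectral_mx_orth.
Qed.

Lemma span_control_F1 c : control_F1 n.+1 a b T (span_control c).
Proof.
split; first exact: span_control_space.
exists n.+1, (fun l => c l 0), lam; split; last by apply: aeW.
by move=> l; apply/(spectral_eigenvalue _ spec); exists l.
Qed.

(** An element of F_1 may be presented with repeated eigenvalues; their
    coefficients are gathered. *)
Lemma control_F1_span f : control_F1 n.+1 a b T f ->
  exists c, ae_eq_on T f (span_control c).
Proof.
move=> [cf [m [c [l [eigl fE]]]]].
have /choice[s sE] : forall i, exists j, l i = lam j.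
  by move=> i; exact: (spectral_eigenvalue (l i) spec).1 (eigl i).
exists (\col_j \sum_(i | s i == j) c i).
rewrite (_ : span_control _ = (fun t => \sum_(i < m) c i * (Sfun (T - t) (l i))%:C))//.
apply/funext => t; rewrite (partition_big s xpredT)//=.
apply: eq_bigr => j _; rewrite mxE mulr_suml; apply: eq_bigr => i /eqP <-.
by rewrite sE.
Qed.

Lemma control_op_ae f g : control_space T f -> control_space T g -> ae_eq_on T f g ->
  control_op n.+1 a b T f = control_op n.+1 a b T g.
Proof.
move=> cf cg fg; rewrite !control_op_moments//; congr (_ *m _).
apply/colP => j; rewrite !mxE; apply: cintegral_ae; try exact: moment_integrable.
move: fg; apply: filterS; first exact: (ae_filter_ringOfSetsType mu).
by move=> t fg tT; rewrite fg.
Qed.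

Lemma control_F1_unique f g : control_F1 n.+1 a b T f -> control_F1 n.+1 a b T g ->
  control_op n.+1 a b T f = control_op n.+1 a b T g -> ae_eq_on T f g.
Proof.
move=> Ff Fg; have [c fc] := control_F1_span Ff; have [d gd] := control_F1_span Fg.
rewrite (control_op_ae Ff.1 (span_control_space c) fc) (control_op_ae Fg.1 (span_control_space d) gd).
rewrite !control_op_span => /(can_inj (mulKmx reach_mx_unit)) E.
move: fc gd; apply: filterS2; first exact: (ae_filter_ringOfSetsType mu).
by move=> t fc gd tT; rewrite fc// gd// E.
Qed.

Lemma control_F1_reach d : exists f, control_F1 n.+1 a b T f /\ control_op n.+1 a b T f = d.
Proof.
exists (span_control (invmx reach_mx *m d)); split; first exact: span_control_F1.
by rewrite control_op_span mulKVmx// reach_mx_unit.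
Qed.

(** The adjoint sends d to the combination of the S(T - t, lam_j) with
    coefficients om_j sum_k phi_k(lam_j) d_k. *)
Lemma control_adjoint_exists : exists V, is_control_adjoint a b T (N := n.+1) V.
Proof.
exists (fun d => span_control (weight_mx *m spectral_mx^T *m d)) => d.
split=> [|f cf]; first exact: span_control_space.
rewrite control_op_moments// /control_inner /state_inner.
transitivity (cintegral `]0, T[ (fun t => \sum_l ((weight_mx *m spectral_mx^T *m d) l 0)^* *
   (f t * (Sfun (T - t) (lam l))%:C))).
  congr cintegral; apply/funext => t; rewrite /span_control rmorph_sum mulr_sumr.
  by apply: eq_bigr => l _; rewrite rmorphM /= conj_real mulrCA.
rewrite cintegral_sum//; last by move=> l; apply: cintegrableZ => //; exact: moment_integrable.
under eq_bigr => l _ do rewrite (cintegralZ (measurable_itv _) _ (moment_integrable l cf)).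
transitivity (\sum_l \sum_(k < n.+1) ((om l)%:C * (((phi a b k.+1).[lam l])%:C * spectral_moment lam T f l)) * (d k 0)^*).
  apply: eq_bigr => l _; rewrite mxE rmorph_sum mulr_suml; apply: eq_bigr => k _.
  rewrite /weight_mx mul_diag_mx 4!mxE !rmorphM /= !conj_real -/(spectral_moment lam T f l).
  move: (spectral_moment _ _ _ _) => u; move: (_%:C) (_%:C) (_^*) => x y z; ring.
rewrite exchange_big /=; apply: eq_bigr => k _; rewrite mxE mulr_suml; apply: eq_bigr => l _.
rewrite /weight_mx mul_mx_diag 4!mxE; move: (spectral_moment _ _ _ _) => u.
by move: (_%:C) (_%:C) (_^*) => x y z; ring.
Qed.

(** Evaluation at the eigenvalues is invertible. *)
Lemma fourier_inj : injective (fourier a b : 'cV[C]_n.+1 -> C -> C).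
Proof.
move=> c d E.
have u : spectral_mx^T \in unitmx.
  by have [] := mulmx1_unit spectral_mx_orth.
apply: (can_inj (mulKmx u)); apply/colP => j; have := congr1 (fun F => F (lam j)%:C) E.
rewrite /fourier !mxE => H.
rewrite -[LHS](_ : \sum_k c k 0 * phiC a b k.+1 (lam j)%:C = _); last first.
  by apply: eq_bigr => k _; rewrite 2!mxE phiC_real mulrC.
by rewrite H; apply: eq_bigr => k _; rewrite 2!mxE phiC_real mulrC.
Qed.

Lemma BN_fourier : BN n.+1 a b T = range (fourier a b : 'cV[C]_n.+1 -> C -> C).
Proof.
apply/seteqP; split=> [F [c _ <-]|F [c _ <-]]; first by exists c.
exists c => //; have [f [[cf _] fc]] := control_F1_reach c.
by exists f.
Qed.

Lemma state_inner_conj (c d : 'cV[C]_n.+1) : (state_inner c d)^* = state_inner d c.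
Proof.
rewrite /state_inner rmorph_sum; apply: eq_bigr => k _.
by rewrite rmorphM /= conjCK mulrC.
Qed.

(** Whatever controls and adjoint the definitions choose, the controls reach c
    and d, and the adjoint turns the pairing of the controls into the one of these
    states. *)
Lemma BN_inner_fourier (c d : 'cV[C]_n.+1) :
  BN_inner n.+1 a b T (fourier a b c) (fourier a b d) = state_inner c d.
Proof.
have chosen e : control_F1 n.+1 a b T (BN_control n.+1 a b T (fourier a b e)) /\
    control_op n.+1 a b T (BN_control n.+1 a b T (fourier a b e)) = e.
  have [f [Ff fe]] := control_F1_reach e.
  have [|F1 F2] := @xgetPex _ (fun=> 0)
    [set h | control_F1 n.+1 a b T h /\ fourier a b e = fourier a b (control_op n.+1 a b T h)].
    by exists f; split=> //; rewrite fe.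
  by split=> //; apply: fourier_inj; rewrite -F2.
have [[cc _] ccE] := chosen c; have [[cd _] cdE] := chosen d.
rewrite /BN_inner /connecting_op ccE.
have adj := @xgetPex _ (fun _ _ => 0) _ control_adjoint_exists.
have [Vc VE] := adj c.
rewrite control_inner_conj//; rewrite -[RHS]state_inner_conj; congr (_^*).
by rewrite [LHS]VE// cdE.
Qed.

Lemma fourier_reproducing z (c d : 'cV[C]_n.+1) :
  (forall k, d k 0 = (phiC a b k.+1 z)^*) -> state_inner c d = fourier a b c z.
Proof. by move=> dE; apply: eq_bigr => k _; rewrite dE conjCK. Qed.

End ReachableStates.

(** * The Hermite-Biehler function *)

Section PolynomialBounds.
Variable R : realType.
Local Notation C := R[i].

Lemma poly_growth (p : {poly C}) m : (size p <= m.+1)%N ->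
  exists2 K : R, 0 < K & forall z, normc p.[z] <= K * (1 + normc z) ^+ m.
Proof.
move=> sp; exists (1 + \sum_(i < m.+1) normc p`_i).
  by rewrite ltr_pwDl// sumr_ge0// => i _; exact: normc_ge0.
move=> z; have z0 := normc_ge0 z; have h1 : 1 <= 1 + normc z by lra.
rewrite (horner_coef_wide _ sp); apply: le_trans (normc_sum _ _ _) _.
rewrite mulrDl mul1r mulr_suml; apply: le_trans (ler_wpDl _ (lexx _)).
  apply: ler_sum => i _; rewrite Normc.normcM normcX ler_wpM2l ?normc_ge0//.
  apply: (@le_trans _ _ ((1 + normc z) ^+ i)); first by apply: lerXn2r; rewrite ?nnegrE; lra.
  by rewrite ler_weXn2l// -ltnS.
by rewrite exprn_ge0//; lra.
Qed.

(** The distance from r to the closed upper half-plane is - Im r. *)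
Lemma linear_lower (r : C) : complex.Im r < 0 -> exists2 c : R, 0 < c &
  forall z, 0 <= complex.Im z -> c * (1 + normc z) <= normc (z - r).
Proof.
move=> r0; pose del := - complex.Im r; have d0 : 0 < del by rewrite oppr_gt0.
have nr := normc_ge0 r; pose q := del + 1 + normc r.
have q0 : 0 < q by rewrite /q; lra.
exists (del / q); first by rewrite divr_gt0.
move=> z z0.
have h1 : del <= normc (z - r).
  by have := le_trans (ler_norm _) (normc_Im (z - r)); rewrite cImB /del; lra.
have h2 : normc z <= normc (z - r) + normc r by have := normcD (z - r) r; rewrite subrK.
rewrite mulrAC ler_pdivrMr//; rewrite /q; move: (normc (z - r)) h1 h2 (normc_ge0 z) => u; nra.
Qed.

Lemma prod_lower (s : seq C) : (forall r, r \in s -> complex.Im r < 0) ->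
  exists2 c : R, 0 < c & forall z, 0 <= complex.Im z ->
    c * (1 + normc z) ^+ size s <= normc (\prod_(r <- s) (z - r)).
Proof.
elim: s => [|r s IH] sr.
  by exists 1 => // z _; rewrite big_nil expr0 mulr1 normc_real normr1.
have [c c0 cP] : exists2 c : R, 0 < c & forall z, 0 <= complex.Im z ->
    c * (1 + normc z) ^+ size s <= normc (\prod_(r <- s) (z - r)).
  by apply: IH => u us; apply: sr; rewrite inE us orbT.
have [d d0 dP] := linear_lower (sr r (mem_head _ _)).
exists (d * c) => [|z z0]; first exact: mulr_gt0.
rewrite big_cons Normc.normcM /= exprS mulrACA.
have nz := normc_ge0 z.
apply: ler_pM; [|by rewrite mulr_ge0 ?ltW// exprn_gt0//; lra|exact: dP|exact: cP].
by rewrite mulr_ge0// ?ltW//; lra.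
Qed.

Lemma poly_lower (p : {poly C}) m : size p = m.+1 ->
  (forall z, 0 <= complex.Im z -> p.[z] != 0) ->
  exists2 c : R, 0 < c & forall z, 0 <= complex.Im z ->
    c * (1 + normc z) ^+ m <= normc p.[z].
Proof.
move=> sp p0; have [rs pE] := closed_field_poly_normal p.
have lc0 : lead_coef p != 0 by rewrite lead_coef_eq0 -size_poly_gt0 sp.
have srs : size rs = m.
  by move: sp; rewrite pE size_scale// size_prod_XsubC => -[].
have hr r : r \in rs -> complex.Im r < 0.
  move=> rrs; rewrite ltNge; apply/negP => /p0; rewrite pE hornerZ mulf_eq0 (negbTE lc0) /=.
  by rewrite -/(root _ _) root_prod_XsubC rrs.
have [c c0 cP] := prod_lower hr.
exists (normc (lead_coef p) * c); first by rewrite mulr_gt0// normc_gt0.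
move=> z z0; rewrite [X in normc X.[z]]pE hornerZ Normc.normcM -mulrA ler_wpM2l ?normc_ge0//.
rewrite -srs; apply: le_trans (cP z z0) _; rewrite horner_prod.
by under eq_bigr do rewrite -hornerXsubC.
Qed.

End PolynomialBounds.

Section HermiteBiehler.
Variable R : realType.
Local Notation C := R[i].
Variables (a b : nat -> R) (n : nat).
Hypothesis ha : forall m, (1 <= m)%N -> (m < n.+1)%N -> 0 < a m.

Lemma size_phi k : (k < n.+1)%N -> size (phi a b k.+1) = k.+1 /\ (size (phi a b k) <= k)%N.
Proof.
elim: k => [|k IH] kn; first by rewrite /= size_poly1 size_poly0.
have [s1 s2] := IH (ltnW kn); have ak := ha (ltn0Sn k) kn.
split; last by rewrite s1.
have : size (a k.+1 *: phi a b k.+2) = k.+2.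
  rewrite phi_rec//.
  have s3 : size (('X - (b k.+1)%:P) * phi a b k.+1) = k.+2.
    by rewrite mulrC size_Mmonic ?monicXsubC// -?size_poly_gt0 ?s1// size_XsubC addn2.
  rewrite size_polyDl s3// size_polyN (leq_ltn_trans (size_scale_leq _ _))//.
  by rewrite ltnS leqW.
by rewrite size_scale// gt_eqF.
Qed.

Lemma size_phiQ : size (phiQ a b n) = n.+2.
Proof.
have [s1 s2] := size_phi (ltnSn n).
have s3 : size (('X - (b n.+1)%:P) * phi a b n.+1) = n.+2.
  by rewrite mulrC size_Mmonic ?monicXsubC// -?size_poly_gt0 ?s1// size_XsubC addn2.
rewrite /phiQ size_polyDl s3// size_polyN (leq_ltn_trans (size_scale_leq _ _))//.
by rewrite ltnS leqW.
Qed.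

(** The structure function E = phi_N - i Q of the space. *)
Definition structure_poly : {poly C} :=
  map_poly (real_complex R) (phi a b n.+1) - (0 +i* 1) *: map_poly (real_complex R) (phiQ a b n).

Definition structure_fun (z : C) : C := structure_poly.[z].

Lemma structure_funE z : structure_fun z = phiC a b n.+1 z - (0 +i* 1) * phiQC a b n z.
Proof. by rewrite /structure_fun hornerD hornerN hornerZ phiQCE. Qed.

Lemma size_structure_poly : size structure_poly = n.+2.
Proof.
have i0 : (0 +i* 1 : C) != 0 by rewrite eq_complex /= oner_eq0 andbF.
have sQ : size (- ((0 +i* 1) *: map_poly (real_complex R) (phiQ a b n))) = n.+2.
  by rewrite size_polyN size_scale// size_map_poly size_phiQ.
by rewrite /structure_poly addrC size_polyDl sQ// size_map_poly (size_phi (ltnSn n)).1.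
Qed.

(** Summation of the recursion against the conjugates of the phi_k
    (Christoffel-Darboux). *)
Lemma phiQ_Im z k : (k < n.+1)%N -> complex.Im (phiQC a b k z * (phiC a b k.+1 z)^*) =
  complex.Im z * \sum_(i < k.+1) normc (phiC a b i.+1 z) ^+ 2.
Proof.
elim: k => [|k IH] kn.
  rewrite big_ord_recl big_ord0 addr0 /phiQC phiC0 mulr0 subr0 phiC1 rmorph1 !mulr1.
  by rewrite normc_real normr1 expr1n mulr1 cImB /= subr0.
have ak := ha (ltn0Sn k) kn.
rewrite big_ord_recr /= mulrDr -IH ?(ltnW kn)// -(phiC_rec b z ak) sqr_normc.
rewrite /phiQC; move: (phiC a b k.+2 z) (phiC a b k.+1 z) => u v.
case: z u v {IH} => x y [u1 u2] [v1 v2] /=; ring.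
Qed.

Lemma structure_fun_sub z : normc (structure_fun z) ^+ 2 - normc (structure_fun z^*) ^+ 2 =
  4 * (complex.Im z * \sum_(k < n.+1) normc (phiC a b k.+1 z) ^+ 2).
Proof.
rewrite -(phiQ_Im _ (ltnSn n)) !structure_funE phiC_conj.
have -> : phiQC a b n z^* = (phiQC a b n z)^*.
  rewrite /phiQC !phiC_conj; move: (phiC a b n.+1 z) (phiC a b n z) => u v.
  by apply: complex_eqP; case: z u v => x y [u1 u2] [v1 v2] /=; ring.
rewrite !sqr_normc; move: (phiQC a b n z) (phiC a b n.+1 z) => u v.
case: u v => u1 u2 [v1 v2] /=; ring.
Qed.

Lemma sum_normc_phi_ge1 z : 1 <= \sum_(k < n.+1) normc (phiC a b k.+1 z) ^+ 2.
Proof.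
rewrite big_ord_recl phiC1 normc_real normr1 expr1n lerDl.
by apply: sumr_ge0 => i _; exact: sqr_ge0.
Qed.

Lemma structure_fun_HB z : 0 < complex.Im z ->
  normc (structure_fun z^*) < normc (structure_fun z).
Proof.
move=> z0; have := structure_fun_sub z; have := sum_normc_phi_ge1 z.
have := normc_ge0 (structure_fun z); have := normc_ge0 (structure_fun z^*).
move: (\sum_(_ < _) _) (normc _) (normc _) => S u v u0 v0 S1 H.
have : v ^+ 2 < u ^+ 2.
  by rewrite -subr_gt0 H mulr_gt0// mulr_gt0//; exact: lt_le_trans S1.
by rewrite ltr_pXn2r// nnegrE.
Qed.

(** Two consecutive zeros propagate down to phi_1 = 1. *)
Lemma phi_backward z k : (k < n.+1)%N -> phiC a b k.+1 z = 0 -> phiQC a b k z = 0 -> False.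
Proof.
elim: k => [|k IH] kn; first by rewrite phiC1 => /eqP; rewrite oner_eq0.
move=> p0; rewrite /phiQC p0 mulr0 sub0r => /eqP; rewrite oppr_eq0 mulf_eq0.
have ak := ha (ltn0Sn k) kn.
rewrite eq_complex /= (gt_eqF ak) /= => /eqP q0; apply: (IH (ltnW kn) q0).
by rewrite -(phiC_rec b z ak) p0 mulr0.
Qed.

(** On the real axis phi_N and - Q are the real and imaginary parts of E, and
    they have no common zero. *)
Lemma structure_fun_neq0 z : 0 <= complex.Im z -> structure_fun z != 0.
Proof.
rewrite le_eqVlt => /predU1P[z0|z0]; last first.
  by rewrite -normc_gt0; apply: le_lt_trans (structure_fun_HB z0); exact: normc_ge0.
have zE : z = (complex.Re z)%:C by apply: complex_eqP => //=; rewrite -z0.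
apply/eqP => E0; apply: (@phi_backward z n) => //; rewrite zE.
all: move: E0; rewrite structure_funE zE /phiQC !phiC_real.
all: move=> /eqP; rewrite eq_complex /= => /andP[/eqP e1 /eqP e2].
all: apply: complex_eqP => //=; move: e1 e2; lra.
Qed.

Lemma phi_growth : exists2 K : R, 0 < K & forall k z, (k < n.+1)%N ->
  normc (phiC a b k.+1 z) <= K * (1 + normc z) ^+ n.
Proof.
have /choice[K KP] : forall k : 'I_n.+1, exists K : R, 0 < K /\
    forall z, normc (phiC a b k.+1 z) <= K * (1 + normc z) ^+ n.
  move=> k; have [|K K0 KP] := @poly_growth R (map_poly (real_complex R) (phi a b k.+1)) n.
    by rewrite size_map_poly (size_phi (ltn_ord k)).1.
  by exists K.
exists (\sum_k K k).
  rewrite big_ord_recl ltr_pwDl//; first exact: (KP _).1.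
  by apply: sumr_ge0 => i _; exact/ltW/(KP _).1.
move=> k z kn; apply: le_trans ((KP (Ordinal kn)).2 z) _.
apply: ler_wpM2r; first by rewrite exprn_ge0// addr_ge0// normc_ge0.
rewrite (bigD1 (Ordinal kn))//= lerDl; apply: sumr_ge0 => i _; exact/ltW/(KP _).1.
Qed.

Lemma structure_fun_growth : exists2 K : R, 0 < K & forall z,
  normc (structure_fun z) <= K * (1 + normc z) ^+ n.+1.
Proof. by apply: poly_growth; rewrite size_structure_poly. Qed.

Lemma structure_fun_lower : exists2 c : R, 0 < c & forall z, 0 <= complex.Im z ->
  c * (1 + normc z) ^+ n.+1 <= normc (structure_fun z).
Proof. exact: poly_lower size_structure_poly structure_fun_neq0. Qed.

Lemma structure_fun_cdiff z : exists d, cdiff structure_fun z d.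
Proof. exact: cdiff_poly. Qed.

Lemma fourier_cdiff (c : 'cV[C]_n.+1) z : exists d, cdiff (fourier a b c) z d.
Proof.
have [d dP] := cdiff_poly (\sum_(k < n.+1) c k 0 *: map_poly (real_complex R) (phi a b k.+1)) z.
exists d; move: dP; congr (cdiff _ _ _); apply/funext => w.
by rewrite horner_sum; apply: eq_bigr => k _; rewrite hornerZ.
Qed.

Lemma fourier_growth (c : 'cV[C]_n.+1) : exists2 K : R, 0 < K &
  forall z, normc (fourier a b c z) <= K * (1 + normc z) ^+ n.
Proof.
have [K K0 KP] := phi_growth.
exists ((1 + \sum_k normc (c k 0)) * K).
  by rewrite mulr_gt0// ltr_pwDl// sumr_ge0// => i _; exact: normc_ge0.
move=> z; apply: le_trans (normc_sum _ _ _) _.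
rewrite -mulrA mulrDl mul1r mulr_suml; apply: le_trans (ler_wpDl _ (lexx _)).
  by apply: ler_sum => k _; rewrite Normc.normcM ler_wpM2l ?normc_ge0// KP.
by rewrite mulr_ge0 ?ltW// exprn_gt0// ltr_pwDl// normc_ge0.
Qed.

Lemma sharp_fourier (c : 'cV[C]_n.+1) : sharp (fourier a b c) = fourier a b (map_mx Num.conj c).
Proof.
apply/funext => z; rewrite /sharp /fourier rmorph_sum; apply: eq_bigr => k _.
by rewrite rmorphM /= mxE phiC_conj conjCK.
Qed.

End HermiteBiehler.

(** * The space B(E) *)

Section CauchyWeight.
Variable R : realType.
Local Notation C := R[i].
Local Notation mu := (@lebesgue_measure R).

Definition cauchy_weight (x : R) : R := (1 + x ^+ 2)^-1.

Lemma cauchy_weight_ge0 x : 0 <= cauchy_weight x.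
Proof. by rewrite invr_ge0 addr_ge0// sqr_ge0. Qed.

Lemma cauchy_weight_cont : continuous cauchy_weight.
Proof. exact: continuous_oneDsqrV. Qed.

Lemma integral_cauchy_weight : (\int[mu]_x (cauchy_weight x)%:E = pi%:E)%E.
Proof.
rewrite ge0_symfun_integralT//.
- transitivity (2%:E * (pi / 2)%:E : \bar R)%E.
    by rewrite -integral0y_oneDsqr set_itvcy.
  by rewrite -EFinM mulrCA divff ?mulr1.
- exact: cauchy_weight_ge0.
- exact: cauchy_weight_cont.
- by move=> x /=; rewrite /cauchy_weight sqrrN.
Qed.

Lemma integrable_cauchy_weight (K : R) : mu.-integrable setT (EFin \o (fun x => K * cauchy_weight x)).
Proof.
suff wi : mu.-integrable setT (EFin \o cauchy_weight) by exact: (@integrableZl _ _ _ mu setT measurableT K _ wi).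
apply/integrableP; split.
  by apply/measurable_EFinP; apply: continuous_measurable_fun; exact: cauchy_weight_cont.
rewrite (_ : (\int[mu]_x _)%E = pi%:E) ?ltry// -integral_cauchy_weight.
by apply: eq_integral => x _ /=; rewrite ger0_norm// cauchy_weight_ge0.
Qed.

Lemma dominated_integrable (f : R -> R) (K : R) : continuous f ->
  (forall x, `|f x| <= K * cauchy_weight x) -> mu.-integrable setT (EFin \o f).
Proof.
move=> cf fK; apply: le_integrable (integrable_cauchy_weight K) => //.
  by apply/measurable_EFinP; exact: continuous_measurable_fun.
move=> x _ /=; rewrite lee_fin; exact: le_trans (fK x) (ler_norm _).
Qed.

(** The dominating weight makes the integral the limit of the integrals over
    growing symmetric intervals. *)
Lemma integral_symmetric_limit (f : R -> R) (K B : R) : continuous f ->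
  (forall x, `|f x| <= K * cauchy_weight x) ->
  (forall X, 0 < X -> `|prim f X - prim f (- X)| <= B / X) ->
  \int[mu]_x f x = 0.
Proof.
move=> cf fK fB.
pose f_ (m : nat) (x : R) : \bar R := (f x * \1_(`[- m.+1%:R, m.+1%:R]%classic) x)%:E.
have cv : (\int[mu]_x f_ m x @[m --> \oo] --> \int[mu]_x (f x)%:E)%E.
  apply: (@dominated_cvg _ _ _ mu setT measurableT f_ _ (fun x => (K * cauchy_weight x)%:E)) => //.
  - move=> m; apply/measurable_EFinP/measurable_funM; first exact: continuous_measurable_fun.
    exact: measurable_indic.
  - move=> x _; apply: cvg_near_cst.
    exists (Num.bound `|x|) => // m /= mx; rewrite /f_ indicE mem_set ?mulr1//=.
    have xm : `|x| <= m.+1%:R.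
      apply/ltW/(lt_le_trans (archi_boundP (normr_ge0 x))).
      by rewrite ler_nat (leq_trans mx).
    by rewrite in_itv /= -ler_norml.
  - exact: integrable_cauchy_weight.
  - move=> m x _; rewrite /f_ /= lee_fin normrM; apply: le_trans (fK x).
    by rewrite ler_piMr// indicE; case: (_ \in _); rewrite ?normr1 ?normr0.
have fE m : (\int[mu]_x f_ m x = (prim f m.+1%:R - prim f (- m.+1%:R))%:E)%E.
  rewrite -(antiderivative_Rintegral cf (primP cf)); last by rewrite gtrN.
  rewrite [RHS]integral_mkcond; apply: eq_integral => x _.
  by rewrite /f_ patchE indicE; case: ifPn => _; rewrite ?mulr1 ?mulr0.
have cv0 : (\int[mu]_x f_ m x @[m --> \oo] --> 0%:E)%E.
  under eq_fun do rewrite fE.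
  apply: cvg_EFin; first by apply: nearW.
  apply/(@cvgrPdist_le R R^o) => e e0 /=; near=> m.
  rewrite sub0r normrN; apply: le_trans (fB _ _) _; first by [].
  rewrite ler_pdivrMr//; apply: le_trans (ler_norm _) _.
  rewrite -ler_pdivrMl// mulrC.
  apply/ltW/(lt_le_trans (archi_boundP _)); first by rewrite mulr_ge0// invr_ge0 ltW.
  rewrite ler_nat; near: m; exists (Num.bound (`|B| / e)) => // m /= /leq_trans; apply.
  by [].
by rewrite /Rintegral (cvg_unique _ cv cv0).
Unshelve. all: by end_near. Qed.

End CauchyWeight.

Section DeBrangesSpace.
Variable R : realType.
Local Notation C := R[i].
Local Notation mu := (@lebesgue_measure R).
Variables (a b : nat -> R) (n : nat) (lam om : 'I_n.+1 -> R).
Hypothesis ha : forall m, (1 <= m)%N -> (m < n.+1)%N -> 0 < a m.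
Hypothesis spec : is_spectral a b lam om.
Local Notation E := (structure_fun a b n).

Lemma fourier_ratio (c : 'cV[C]_n.+1) : exists2 K : R, 0 < K &
  forall z, 0 <= complex.Im z -> normc (fourier a b c z / E z) <= K / (1 + normc z).
Proof.
have [K K0 KP] := fourier_growth b ha c; have [e e0 eP] := structure_fun_lower b ha.
exists (K / e) => [|z z0]; first exact: divr_gt0.
have h1 : 0 < 1 + normc z by rewrite ltr_pwDl// normc_ge0.
have nE : 0 < normc (E z) by rewrite normc_gt0 structure_fun_neq0.
rewrite Normc.normcM Normc.normcV ler_pdivrMr//; apply: le_trans (KP z) _.
apply: (@le_trans _ _ (K / e / (1 + normc z) * (e * (1 + normc z) ^+ n.+1))); last first.
  by rewrite ler_wpM2l ?eP// divr_ge0 ?ltW// divr_gt0.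
rewrite exprS; set X := _ ^+ n; rewrite le_eqVlt; apply/orP; left; apply/eqP.
by field; rewrite !gt_eqF.
Qed.

Lemma normc_cauchy_weight (x y : R) : 0 <= y -> (1 + normc (x +i* y)) ^- 2 <= cauchy_weight x.
Proof.
move=> y0; rewrite lef_pV2 ?posrE ?exprn_gt0 ?ltr_pwDl ?normc_ge0 ?sqr_ge0//.
have := sqr_normc (x +i* y); have := normc_ge0 (x +i* y) => /= h1 h2.
move: (Num.sqrt _) h1 h2 => u h1 h2; have -> : (1 + u) ^+ 2 = 1 + 2 * u + u ^+ 2 by ring.
by rewrite h2; have := sqr_ge0 y; lra.
Qed.

Lemma fourier_hardy (c : 'cV[C]_n.+1) : hardy2 (fun z => fourier a b c z / E z).
Proof.
have div_cdiff z : 0 <= complex.Im z -> exists d, cdiff (fun z => fourier a b c z / E z) z d.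
  move=> z0; have [d Fd] := fourier_cdiff a b c z; have [e Ee] := structure_fun_cdiff a b n z.
  exact: cdiff_div Fd Ee (structure_fun_neq0 b ha z0).
split=> [z z0|]; first by apply/cdiffP/div_cdiff/ltW.
have [K K0 KP] := fourier_ratio c.
apply: (@le_lt_trans _ _ (\int[mu]_x (K ^+ 2 * cauchy_weight x)%:E)%E); last first.
  have [_] := integrableP _ _ _ (integrable_cauchy_weight (K ^+ 2)).
  congr (_ < _)%E; apply: eq_integral => x _ /=.
  by rewrite ger0_norm// mulr_ge0 ?sqr_ge0// cauchy_weight_ge0.
apply: ge_ereal_sup => _ [y /= + <-]; rewrite in_itv /= andbT => y0.
apply: ge0_le_integral => //.
- by move=> x _; rewrite lee_fin sqr_ge0.
- apply/measurable_EFinP; apply: continuous_measurable_fun.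
  by apply: (@line_normc2_cont _ (fun z => fourier a b c z / E z) y) => x; apply: div_cdiff; exact: ltW.
- by apply/measurable_EFinP; apply: measurable_funM => //; apply: continuous_measurable_fun; exact: cauchy_weight_cont.
- move=> x _; rewrite lee_fin; have h := KP (x +i* y) (ltW y0).
  apply: (@le_trans _ _ ((K / (1 + normc (x +i* y))) ^+ 2)).
    by apply: lerXn2r => //; rewrite nnegrE ?normc_ge0// divr_ge0 ?ltW// ltr_pwDl ?normc_ge0.
  by rewrite exprMn exprVn ler_wpM2l ?sqr_ge0// normc_cauchy_weight// ltW.
Qed.

Lemma fourier_deBranges (c : 'cV[C]_n.+1) : deBranges E (fourier a b c).
Proof.
split; first by move=> z _; exact/cdiffP/fourier_cdiff.
- exact: fourier_hardy.
- by rewrite sharp_fourier; exact: fourier_hardy.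
Qed.

Lemma sharp_cdiff (F : C -> C) z d : cdiff F z^* d -> cdiff (sharp F) z d^*.
Proof.
move=> Fd e e0; have [del del0 H] := Fd e e0; exists del => // h hdel _.
have hdel' : normc h^* < del by rewrite normc_conj.
have := H h^* hdel' I; rewrite normc_conj -[X in X <= _ -> _]normc_conj /sharp.
by rewrite !rmorphB !rmorphM /= !rmorphD /= !conjCK.
Qed.

Lemma hardy2_bound (F : C -> C) : hardy2 F -> exists M : R, forall y, 0 < y ->
  (\int[mu]_x ((normc (F (x +i* y))) ^+ 2)%:E <= M%:E)%E.
Proof.
move=> [_]; set S := ereal_sup _ => Sfin.
have HS y : 0 < y -> (\int[mu]_x ((normc (F (x +i* y))) ^+ 2)%:E <= S)%E.
  by move=> y0; apply: ereal_sup_ubound; exists y => //=; rewrite in_itv /= y0.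
exists (fine S) => y y0; rewrite fineK; first exact: HS.
rewrite ge0_fin_numE//; apply: le_trans (HS 1 ltr01).
by apply: integral_ge0 => x _; rewrite lee_fin sqr_ge0.
Qed.

(** In the disc of radius Im z / 2 around z, 1 + |w| is at most 2 (1 + |z|). *)
Lemma hardy_growth_half (F : C -> C) : (forall z, exists d, cdiff F z d) ->
  hardy2 (fun z => F z / E z) -> exists K : R, 0 < K /\ forall z, 0 < complex.Im z ->
    normc (F z) * Num.sqrt (complex.Im z) <= K * (1 + normc z) ^+ n.+1.
Proof.
move=> FD /hardy2_bound[M MP]; have [K K0 KP] := structure_fun_growth b ha.
have M0 : 0 <= M.
  have := MP 1 ltr01; rewrite -lee_fin; apply: le_trans.
  by apply: integral_ge0 => x _; rewrite lee_fin sqr_ge0.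
exists (4 * (K * 2 ^+ n.+1) * (M + 1)); split.
  by rewrite !mulr_gt0// ?exprn_gt0//; lra.
move=> z z0; rewrite -ler_pdivlMr ?sqrtr_gt0//.
have nz := normc_ge0 z.
apply: le_trans (@hardy_pointwise _ F E M (K * 2 ^+ n.+1 * (1 + normc z) ^+ n.+1) z
  FD (structure_fun_cdiff a b n) _ MP z0 _) _.
- by move=> w w0; apply: structure_fun_neq0 => //; exact: ltW.
- move=> w wz; apply: le_trans (KP w) _; rewrite -mulrA -exprMn; apply: ler_wpM2l; first exact: ltW.
  apply: lerXn2r; rewrite ?nnegrE; [have := normc_ge0 w; lra|lra|].
  have := normcD (w - z) z; rewrite subrK; have := le_trans (ler_norm _) (normc_Im z); lra.
- by rewrite le_eqVlt; apply/orP; left; apply/eqP; congr (_ / _); ring.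
Qed.

Lemma deBranges_growth (F : C -> C) : deBranges E F -> exists K : R, 0 < K /\ forall z,
    normc (F z) * Num.sqrt `|complex.Im z| <= K * (1 + normc z) ^+ n.+1.
Proof.
move=> [Fent H1 H2]; have FD z : exists d, cdiff F z d by exact/cdiffP/Fent.
have [K [K0 KP]] := hardy_growth_half FD H1.
have [|L [L0 LP]] := hardy_growth_half _ H2.
  by move=> z; have [d Fd] := FD z^*; exists d^*; exact: sharp_cdiff.
exists (K + L); split; first exact: addr_gt0.
move=> z; rewrite mulrDl; have h : 0 <= (1 + normc z) ^+ n.+1.
  by rewrite exprn_ge0// addr_ge0// normc_ge0.
have [z0|z0|z0] := ltgtP (complex.Im z) 0.
- rewrite (ler0_norm (ltW z0)); apply: ler_wpDl; first by rewrite mulr_ge0// ltW.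
  have := LP z^*; rewrite /sharp conjCK !normc_conj => /(_ _); case: z z0 h => x y /= z0 h; apply.
  by rewrite oppr_gt0.
- by rewrite (ger0_norm (ltW z0)); apply: ler_wpDr; [rewrite mulr_ge0// ltW|exact: KP].
- by rewrite z0 normr0 sqrtr0 mulr0 addr_ge0// mulr_ge0// ltW.
Qed.

(** Lagrange interpolation at the eigenvalues, in the basis of the phi_k. *)
Definition interpolant (F : C -> C) : 'cV[C]_n.+1 :=
  \col_k \sum_j (om j)%:C * F (lam j)%:C * phiC a b k.+1 (lam j)%:C.

Lemma interpolantE (F : C -> C) i : fourier a b (interpolant F) (lam i)%:C = F (lam i)%:C.
Proof.
have [_ _ dual _] := spec.
rewrite /fourier; under eq_bigr do rewrite mxE mulr_suml.
rewrite exchange_big /=.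
transitivity (\sum_j F (lam j)%:C * (om j * \sum_(k < n.+1)
    (phi a b k.+1).[lam j] * (phi a b k.+1).[lam i])%:C).
  apply: eq_bigr => j _; rewrite rmorphM rmorph_sum mulr_sumr mulr_sumr.
  apply: eq_bigr => k _; rewrite !phiC_real.
  move: (phi a b k.+1).[_] (phi a b k.+1).[_] (F _) (om j) => x y z t.
  by case: z => z1 z2; apply: complex_eqP => /=; ring.
rewrite (bigD1 i)//= dual eqxx mulr1 big1 ?addr0// => j ji.
by rewrite dual (negbTE ji) mulr0.
Qed.

Lemma deBranges_fourier (F : C -> C) : deBranges E F -> F = fourier a b (interpolant F).
Proof.
move=> FE; have [K [K0 KP]] := deBranges_growth FE; have [Fent _ _] := FE.
have [[_ injl] _ _ _] := spec; have [L L0 LP] := fourier_growth b ha (interpolant F).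
pose s := [seq (lam j)%:C | j : 'I_n.+1].
apply/funext => z; apply/eqP; rewrite -subr_eq0; apply/eqP.
apply: (@polynomial_growth_liouville _ (fun z => F z - fourier a b (interpolant F) z) s (K + L)).
- move=> w; have /cdiffP[d Fd] := Fent w I; have [e Pe] := fourier_cdiff a b (interpolant F) w.
  by exists (d - e); exact: cdiffB.
- rewrite map_inj_uniq ?enum_uniq// => i j /eqP.
  by rewrite eq_complex /= eqxx andbT => /eqP/injl.
- by move=> _ /mapP[j _ ->]; rewrite interpolantE subrr.
- have -> : size s = n.+1 by rewrite size_map -cardE card_ord.
  move=> w; have nw := normc_ge0 w; rewrite mulrDl.
  apply: le_trans (ler_wpM2r (sqrtr_ge0 _) (normcB _ _)) _.
  rewrite mulrDl lerD//; apply: (@le_trans _ _ (L * (1 + normc w) ^+ n * (1 + normc w))).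
    apply: ler_pM; [exact: normc_ge0|exact: sqrtr_ge0|exact: LP|].
    have h1 : 0 <= 1 + normc w by lra.
    have -> : 1 + normc w = Num.sqrt ((1 + normc w) ^+ 2) by rewrite sqrtr_sqr ger0_norm.
    by apply: ler_wsqrtr; have := normc_Im w; move: (normc w) (Num.norm _) nw => u v; nra.
  by rewrite exprSr mulrA.
Qed.

Lemma deBrangesE : deBranges E = range (fourier a b : 'cV[C]_n.+1 -> C -> C).
Proof.
apply/seteqP; split=> [F FE|_ [c _ <-]]; last exact: fourier_deBranges.
by exists (interpolant F) => //; rewrite -deBranges_fourier.
Qed.

End DeBrangesSpace.

(** * The inner product of B(E) *)

Section HalfPlaneIntegral.
Variable R : realType.
Local Notation C := R[i].
Local Notation mu := (@lebesgue_measure R).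

(** A retraction on the closed upper half-plane.  It extends a function defined
    there to a continuous function on the plane. *)
Definition clamp (z : C) : C := complex.Re z +i* Num.max (complex.Im z) 0.

Lemma clampE z : 0 <= complex.Im z -> clamp z = z.
Proof. by case: z => x y /= y0; rewrite /clamp /= max_l. Qed.

Lemma clamp_cont z : ccont clamp z.
Proof.
move=> e e0; exists e => // h; apply: le_lt_trans.
rewrite -(@ler_pXn2r _ 2) ?nnegrE ?normc_ge0// !sqr_normc /= !(cReB, cReD) /=.
case: z h => x y [u v] /=; have -> : x + u - x = u by ring.
rewrite lerD2l; have [y0|y0] := leP y 0; have [yv|yv] := leP (y + v) 0; nra.
Qed.

Variables (q : C -> C) (K : R).
Hypothesis q_cdiff : forall z, 0 <= complex.Im z -> exists d, cdiff q z d.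
Hypothesis q_bound : forall z, 0 <= complex.Im z -> normc (q z) <= K / (1 + normc z) ^+ 2.

Let k := q \o clamp.

Let k_cont z : ccont k z.
Proof.
apply: ccont_comp; first exact: clamp_cont.
have [|d qd] := q_cdiff (z := clamp z); last exact: cdiff_cont qd.
by rewrite /clamp /= le_max lexx orbT.
Qed.

Let kE z : 0 <= complex.Im z -> k z = q z.
Proof. by move=> z0; rewrite /k /= clampE. Qed.

Let K_ge0 : 0 <= K.
Proof.
have := q_bound (z := 0) (lexx _); rewrite normc_real normr0 addr0 expr1n divr1.
exact: le_trans (normc_ge0 _).
Qed.

Let k_far (z : C) (X : R) : 0 < X -> 0 <= complex.Im z -> X <= normc z -> normc (k z) <= K / X ^+ 2.
Proof.
move=> X0 z0 Xz; rewrite kE//; apply: le_trans (q_bound z0) _; apply: ler_wpM2l; first exact: K_ge0.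
rewrite lef_pV2 ?posrE ?exprn_gt0//; last by rewrite ltr_pwDl// normc_ge0.
by apply: lerXn2r; rewrite ?nnegrE; have := normc_ge0 z; lra.
Qed.

Let edge_bound (f : R -> C) (u v B : R) : rcont f -> u <= v ->
  (forall t, u <= t <= v -> normc (f t) <= B) -> normc (cprim f v - cprim f u) <= 2 * (B * (v - u)).
Proof.
move=> cf uv fB; have := cprim_dist cf (rcont_cst 0) uv (B := B).
rewrite cprim_cst mulr0 subr0; apply => t tuv.
by rewrite subr0; exact: fB.
Qed.

Let bottom_edge (X : R) : 0 < X -> normc (hint k 0 (- X) X) <= 8 * K / X.
Proof.
move=> X0; have XX : - X <= X by lra.
have G : rect_int k (- X) X 0 X = 0.
  apply: goursat => //; first exact: ltW.
  move=> z _ /andP[z0 _]; have [d qd] := q_cdiff z0; exists d => e e0.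
  have [del del0 H] := qd e e0; exists del => // h hd [_ /andP[zh _]].
  by rewrite !kE//; exact: H.
have top : normc (hint k X (- X) X) <= 2 * (K / X ^+ 2 * (X - - X)).
  apply: edge_bound => //; first exact: rcont_hline.
  move=> t _; rewrite hlineEE; apply: k_far => //=; first exact: ltW.
  have := le_trans (ler_norm _) (normc_Im (t +i* X)); exact.
have side (s : R) : X <= `|s| -> normc (vint k s 0 X) <= 2 * (K / X ^+ 2 * (X - 0)).
  move=> Xs; apply: edge_bound => //; [exact: rcont_vline|exact: ltW|].
  move=> t /andP[t0 _]; rewrite vlineEE; apply: k_far => //=.
  exact: le_trans Xs (normc_Re (s +i* t)).
have -> : hint k 0 (- X) X = hint k X (- X) X - 'i * (vint k X 0 X - vint k (- X) 0 X).
  by move/eqP: G; rewrite /rect_int -subr_eq0 subr0 addr_eq0 subr_eq => /eqP ->; ring.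
have s1 : normc (vint k X 0 X) <= 2 * (K / X ^+ 2 * (X - 0)) by apply: side; rewrite ger0_norm// ltW.
have s2 : normc (vint k (- X) 0 X) <= 2 * (K / X ^+ 2 * (X - 0)).
  by apply: side; rewrite normrN ger0_norm// ltW.
apply: le_trans (normcB _ _) _; rewrite Normc.normcM.
have -> : normc ('i : C) = 1 by rewrite /= expr0n add0r expr1n sqrtr1.
rewrite mul1r; have := normcB (vint k X 0 X) (vint k (- X) 0 X).
have XE : K / X ^+ 2 * X = K / X by field; rewrite gt_eqF.
have E1 : 8 * K / X = 8 * (K / X) by rewrite mulrA.
move: top s1 s2; rewrite E1 opprK subr0 mulrDr XE; lra.
Qed.

(** The integral over the rectangle with corners - X and X + i X vanishes and
    the one over its upper three sides is O(1 / X). *)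
Lemma half_plane_integral : \int[mu]_x complex.Im (q (x +i* 0)) = 0.
Proof.
have [_ fc] := rcont_hline 0 k_cont.
have fE x : complex.Im (hline k 0 x) = complex.Im (q (x +i* 0)) by rewrite hlineEE kE.
transitivity (\int[mu]_x complex.Im (hline k 0 x)); first by apply: eq_Rintegral => x _.
apply: (@integral_symmetric_limit _ _ K (8 * K)) => //.
- move=> x; rewrite fE; apply: le_trans (normc_Im _) _; apply: le_trans (q_bound _) _ => //.
  by apply: ler_wpM2l; [exact: K_ge0|exact: normc_cauchy_weight].
- move=> X X0; apply: le_trans (bottom_edge X0).
  by apply: le_trans (normc_Im _); rewrite /hint cImB.
Qed.

End HalfPlaneIntegral.

Section DeterminantBound.
Variable R : realType.
Local Notation C := R[i].

Lemma normc_prod I (r : seq I) (P : pred I) (F : I -> C) :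
  normc (\prod_(i <- r | P i) F i) = \prod_(i <- r | P i) normc (F i).
Proof.
elim/big_ind2: _ => // [|x y u v <- <-]; first by rewrite normc_real normr1.
by rewrite Normc.normcM.
Qed.

Lemma normc_det_le m (M : 'M[C]_m) (B : R) :
  (forall i j, normc (M i j) <= B) -> normc (\det M) <= (m`!)%:R * B ^+ m.
Proof.
move=> MB; apply: le_trans (normc_sum _ _ _) _.
suff H (s : 'S_m) : normc ((-1) ^+ s * \prod_(i < m) M i (s i)) <= B ^+ m.
  apply: le_trans (ler_sum _ (fun s _ => H s)) _.
  by rewrite sumr_const card_Sn mulr_natl.
rewrite Normc.normcM normcX normc_opp normc_real normr1 expr1n mul1r.
rewrite normc_prod -[m in leRHS]card_ord -prodr_const.
by apply: ler_prod => i _; rewrite normc_ge0 MB.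
Qed.

Lemma normc_adj_le m (M : 'M[C]_m.+1) (B : R) i j :
  (forall i j, normc (M i j) <= B) -> normc ((\adj M) i j) <= (m`!)%:R * B ^+ m.
Proof.
move=> MB; rewrite mxE /cofactor Normc.normcM normcX normc_opp normc_real normr1 expr1n mul1r.
by apply: normc_det_le => u v; rewrite 2!mxE.
Qed.

End DeterminantBound.

Section DissipativeResolvent.
Variable R : realType.
Local Notation C := R[i].
Local Notation mu := (@lebesgue_measure R).
Local Notation I1 := (0 +i* 1 : C).
Variables (a b : nat -> R) (n : nat).
Hypothesis ha : forall m, (1 <= m)%N -> (m < n.+1)%N -> 0 < a m.
Local Notation E := (structure_fun a b n).

Definition jacobiC : 'M[C]_n.+1 := map_mx (real_complex R) (jacobi n.+1 a b).
Definition corner_mx : 'M[C]_n.+1 := delta_mx ord_max ord_max.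
(** A rank one perturbation of the Jacobi matrix that moves all eigenvalues to
    the lower half-plane. *)
Definition dissipative_mx : 'M[C]_n.+1 := jacobiC - I1 *: corner_mx.

Definition pencil (z : C) : 'M[C]_n.+1 := z%:M - dissipative_mx.
(** Cramer's formula, with polynomial numerator and denominator: differentiability
    is then immediate. *)
Definition resolvent (z : C) : 'M[C]_n.+1 :=
  \matrix_(j, k) (((\adj (char_poly_mx dissipative_mx)) j k).[z] / (char_poly dissipative_mx).[z]).

Definition phi_col (z : C) : 'cV[C]_n.+1 := \col_k phiC a b k.+1 z.

Lemma pencil_map z : map_mx (horner_eval z) (char_poly_mx dissipative_mx) = pencil z.
Proof.
apply/matrixP => i j; rewrite [LHS]mxE /char_poly_mx mxE [X in X + _]mxE [X in _ + X]mxE [X in - X]mxE.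
rewrite /horner_eval hornerD hornerN hornerC hornerMn hornerX.
by rewrite /pencil [RHS]mxE [X in _ = X + _]mxE [X in _ = _ + X]mxE.
Qed.

Lemma det_pencil z : \det (pencil z) = (char_poly dissipative_mx).[z].
Proof. rewrite -pencil_map; exact: det_map_mx. Qed.

Lemma adj_pencil z j k : (\adj (pencil z)) j k = ((\adj (char_poly_mx dissipative_mx)) j k).[z].
Proof. by rewrite -pencil_map -map_mx_adj mxE. Qed.

Lemma resolventE z : resolvent z = (\det (pencil z))^-1 *: \adj (pencil z).
Proof. by apply/matrixP => j k; rewrite [LHS]mxE [RHS]mxE adj_pencil det_pencil mulrC. Qed.

Lemma jacobiC_sym : jacobiC^T = jacobiC.
Proof. by apply/matrixP => i j; rewrite [LHS]mxE [LHS]mxE [RHS]mxE jacobi_sym. Qed.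

Lemma pencil_sym z : (pencil z)^T = pencil z.
Proof.
rewrite /pencil /dissipative_mx linearB /= tr_scalar_mx linearB linearZ /= jacobiC_sym.
by rewrite /corner_mx trmx_delta.
Qed.

Lemma jacobiC_mul (v : 'cV[C]_n.+1) k :
  (jacobiC *m v) k 0 = \sum_(l < n.+1) (jacobi n.+1 a b k l)%:C * v l 0.
Proof. by rewrite mxE; apply: eq_bigr => l _; rewrite [jacobiC k l]mxE. Qed.

Lemma corner_mul (v : 'cV[C]_n.+1) k :
  (corner_mx *m v) k 0 = if k == n :> nat then v ord_max 0 else 0.
Proof.
rewrite mxE (bigD1 ord_max)//= big1 ?addr0 => [|l /negbTE ln]; last first.
  by rewrite mxE ln andbF mul0r.
by rewrite mxE eqxx andbT -(inj_eq val_inj) /=; case: (_ == _); rewrite ?mul1r ?mul0r.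
Qed.

Lemma pencil_mul z (v : 'cV[C]_n.+1) k : (pencil z *m v) k 0 =
  z * v k 0 - \sum_(l < n.+1) (jacobi n.+1 a b k l)%:C * v l 0
  + (if k == n :> nat then I1 * v ord_max 0 else 0).
Proof.
rewrite /pencil /dissipative_mx !mulmxBl mul_scalar_mx -scalemxAl opprB addrA.
rewrite [LHS]mxE [X in X + _]mxE [X in _ + X = _]mxE jacobiC_mul [(z *: v) k 0]mxE.
have -> : (I1 *: (corner_mx *m v)) k 0 = I1 * (corner_mx *m v) k 0 by rewrite mxE.
rewrite corner_mul.
by case: ifP => _; rewrite ?mulr0; ring.
Qed.

(** The vector of the phi_k(z) almost solves the eigenvalue equation; the defect
    in the last row is, up to i, the structure function. *)
Lemma pencil_phi z : pencil z *m phi_col z = (I1 * E z) *: (delta_mx ord_max 0).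
Proof.
apply/colP => k; rewrite pencil_mul [phi_col z k 0]mxE [phi_col z ord_max 0]mxE.
under eq_bigr do rewrite [phi_col z _ 0]mxE.
rewrite jacobi_phi// structure_funE [RHS]mxE [delta_mx _ _ _ _]mxE eqxx andbT -(inj_eq val_inj) /=.
have I2 : I1 * I1 = -1 by apply: complex_eqP => /=; ring.
case: (k == n :> nat); last by rewrite mulr0; ring.
rewrite mulr1 mulrBr mulrA I2; move: (phiC _ _ _ _) (phiC _ _ _ _) (phiQC _ _ _ _) => u v w; ring.
Qed.

(** By the recursion a vector of the kernel is a multiple of the vector of the
    phi_k(z), hence 0 since E(z) is nonzero. *)
Lemma pencil_ker z (v : 'cV[C]_n.+1) : 0 <= complex.Im z -> pencil z *m v = 0 -> v = 0.
Proof.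
move=> z0 Dv; pose d l : C := v (inord l) 0.
have dE (l : 'I_n.+1) : v l 0 = d l by rewrite /d inord_val.
have Dk k := congr1 (fun M : 'cV[C]_n.+1 => M k 0) Dv.
have fwd : forall k, (k <= n)%N -> d k = d 0%N * phiC a b k.+1 z.
  apply: jacobi_forward => // k kn; have := Dk k; rewrite pencil_mul mxE ltn_eqF// addr0 dE.
  by move/eqP; rewrite subr_eq0 => /eqP ->; apply: eq_bigr => l _; rewrite dE.
have vE : v = d 0%N *: phi_col z.
  by apply/colP => k; rewrite [RHS]mxE [phi_col z k 0]mxE dE fwd// -ltnS.
have := Dk ord_max; rewrite vE -scalemxAr pencil_phi scalerA [LHS]mxE [delta_mx _ _ _ _]mxE !eqxx mulr1 mxE.
have I0 : I1 != 0 by rewrite eq_complex /= oner_eq0 andbF.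
move/eqP; rewrite !mulf_eq0 (negbTE I0) (negbTE (structure_fun_neq0 b ha z0)) !orbF => /eqP ->.
by rewrite scale0r.
Qed.

Lemma pencil_unit z : 0 <= complex.Im z -> pencil z \in unitmx.
Proof.
move=> z0; rewrite -row_free_unit -kermx_eq0; apply/eqP/row_matrixP => i.
rewrite row0; apply: (can_inj trmxK); rewrite trmx0; apply: (pencil_ker z0).
by rewrite -{1}(pencil_sym z) -trmx_mul -row_mul mulmx_ker row0 trmx0.
Qed.

Lemma mul_resolvent z : 0 <= complex.Im z -> resolvent z *m pencil z = 1%:M.
Proof.
move=> /pencil_unit; rewrite unitmxE unitfE => d0.
by rewrite resolventE -scalemxAl mul_adj_mx scale_scalar_mx mulVf.
Qed.

Lemma resolvent_mul z : 0 <= complex.Im z -> pencil z *m resolvent z = 1%:M.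
Proof. by move=> z0; apply: mulmx1C; exact: mul_resolvent. Qed.

Lemma resolvent_sym z : 0 <= complex.Im z -> (resolvent z)^T = resolvent z.
Proof.
move=> z0; have H : (resolvent z)^T *m pencil z = 1%:M.
  by rewrite -(pencil_sym z) -trmx_mul resolvent_mul// trmx1.
by rewrite -[LHS]mulmx1 -(resolvent_mul z0) mulmxA H mul1mx.
Qed.

Lemma resolvent_last z k : 0 <= complex.Im z ->
  resolvent z k ord_max = phiC a b k.+1 z / (I1 * E z).
Proof.
move=> z0; have I0 : I1 != 0 by rewrite eq_complex /= oner_eq0 andbF.
have E0 : I1 * E z != 0 by rewrite mulf_neq0// structure_fun_neq0.
apply: (mulIf E0); rewrite divfK//.
have := congr1 (fun M => (resolvent z *m M) k 0) (pencil_phi z).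
rewrite mulmxA mul_resolvent// mul1mx [X in X = _]mxE => ->.
rewrite -scalemxAr [RHS]mxE mulrC; congr (_ * _).
by rewrite -colE [RHS]mxE.
Qed.

Lemma conj_jacobiC : map_mx Num.conj jacobiC = jacobiC.
Proof. by apply/matrixP => i j; rewrite [LHS]mxE [jacobiC i j]mxE conj_real. Qed.

Lemma conj_pencil (x : R) : map_mx Num.conj (pencil x%:C) = pencil x%:C - (2 * I1) *: corner_mx.
Proof.
have cI : (I1)^* = - I1 by apply: complex_eqP => /=; ring.
rewrite /pencil /dissipative_mx !map_mxB map_scalar_mx /= conj_real conj_jacobiC map_mxZ /= cI.
rewrite /corner_mx map_delta_mx scaleNr opprK mulr_natl mulr2n scalerDl.
move: (x%:C%:M) jacobiC (_ *: _) => X Y Z.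
by apply/matrixP => i j; rewrite !mxE; ring.
Qed.

(** The second resolvent identity, between the matrix and its conjugate, which
    differ in the last diagonal entry only. *)
Lemma resolvent_Im (x : R) j k :
  complex.Im (resolvent x%:C j k) =
  - ((phi a b j.+1).[x] * (phi a b k.+1).[x] / normc (E x%:C) ^+ 2).
Proof.
have x0 : 0 <= complex.Im (x%:C : C) by [].
pose S := resolvent x%:C; pose S' := map_mx Num.conj S.
have H : S - S' = - (2 * I1) *: (S *m corner_mx *m S').
  have e1 : S *m map_mx Num.conj (pencil x%:C) *m S' = S.
    by rewrite -mulmxA -map_mxM resolvent_mul// map_mx1 mulmx1.
  have e2 : S *m pencil x%:C *m S' = S' by rewrite mul_resolvent// mul1mx.
  transitivity (S *m map_mx Num.conj (pencil x%:C) *m S' - S *m pencil x%:C *m S').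
    by rewrite e1 e2.
  rewrite -mulmxBl -mulmxBr conj_pencil addrAC subrr add0r.
  by rewrite mulmxN -scalemxAr mulNmx -scalemxAl scaleNr.
have Hjk : S j k - (S j k)^* = - (2 * I1) * (S j ord_max * (S k ord_max)^*).
  have := congr1 (fun M : 'M[C]_n.+1 => M j k) H; rewrite mxE [X in _ + X]mxE [S' j k]mxE => ->.
  rewrite [LHS]mxE; congr (_ * _).
  rewrite mxE (bigD1 ord_max)//= big1 ?addr0 => [|l /negbTE ln].
    rewrite [X in X * _](_ : _ = S j ord_max).
      rewrite [S' ord_max k]mxE; congr (_ * (_)^*).
      by rewrite -{1}[S]trmxK resolvent_sym// mxE.
    rewrite mxE (bigD1 ord_max)//= big1 ?addr0 => [|m /negbTE mn].
      by rewrite [corner_mx _ _]mxE !eqxx mulr1.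
    by rewrite [corner_mx _ _]mxE mn mulr0.
  rewrite mxE (bigD1 ord_max)//= big1 ?addr0 => [|m /negbTE mn].
    by rewrite [corner_mx _ _]mxE ln andbF mulr0 mul0r.
  by rewrite [corner_mx _ _]mxE mn mulr0.
have EE : (E x%:C) * (E x%:C)^* = (normc (E x%:C) ^+ 2)%:C.
  by rewrite sqr_normc; case: (E _) => u v; apply: complex_eqP => /=; ring.
have nE : (normc (E x%:C) ^+ 2)%:C != 0 :> C.
  by rewrite eq_complex /= eqxx andbT expf_neq0// normc_eq0 structure_fun_neq0.
have w : S j ord_max * (S k ord_max)^* =
    ((phi a b j.+1).[x] * (phi a b k.+1).[x] / normc (E x%:C) ^+ 2)%:C.
  rewrite /S !resolvent_last// !phiC_real; move: nE EE (_.[x]) (_.[x]) => nE EE p q.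
  have cI : (I1)^* = - I1 by apply: complex_eqP => /=; ring.
  have I2 : I1 * I1 = -1 by apply: complex_eqP => /=; ring.
  rewrite rmorphM /= conj_real fmorphV rmorphM /= cI mulf_div.
  have -> : I1 * E x%:C * (- I1 * (E x%:C)^*) = (normc (E x%:C) ^+ 2)%:C.
    by rewrite -EE mulrACA mulrN I2 opprK mul1r.
  by rewrite [in RHS]rmorphM [in RHS]fmorphV [in RHS]rmorphM.
have := congr1 (fun z : C => complex.Im z) Hjk; rewrite w cImB -/S.
move: (_ / _) => t; case: (S j k) => u v /=; lra.
Qed.

End DissipativeResolvent.

Section DeBrangesInner.
Variable R : realType.
Local Notation C := R[i].
Local Notation mu := (@lebesgue_measure R).
Local Notation I1 := (0 +i* 1 : C).
Variables (a b : nat -> R) (n : nat).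
Hypothesis ha : forall m, (1 <= m)%N -> (m < n.+1)%N -> 0 < a m.
Local Notation E := (structure_fun a b n).
Local Notation S := (resolvent a b n).
Local Notation B := (dissipative_mx a b n).

Lemma char_dissipative_neq0 z : 0 <= complex.Im z -> (char_poly B).[z] != 0.
Proof. by move=> /(pencil_unit b ha); rewrite unitmxE unitfE det_pencil. Qed.

Lemma resolvent_cdiff j k z : 0 <= complex.Im z -> exists d, cdiff (fun z => S z j k) z d.
Proof.
move=> z0; have [d dP] := cdiff_poly ((\adj (char_poly_mx B)) j k) z.
have [e eP] := cdiff_poly (char_poly B) z.
have [f fP] := cdiff_div dP eP (char_dissipative_neq0 z0).
by exists f; under eq_fun do rewrite mxE.
Qed.

(** The adjugate has entries of degree at most N - 1 and the determinant has
    degree N and no zeros in the closed upper half-plane. *)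
Lemma resolvent_bound : exists2 K : R, 0 < K & forall j k z, 0 <= complex.Im z ->
  normc (S z j k) <= K / (1 + normc z).
Proof.
have [c c0 cP] := poly_lower (size_char_poly B) char_dissipative_neq0.
pose L := 1 + \sum_i \sum_j normc (B i j).
have L1 : 1 <= L by rewrite lerDl; apply: sumr_ge0 => i _; apply: sumr_ge0 => j _; exact: normc_ge0.
have BL i j : normc (B i j) <= L - 1.
  rewrite /L addrC addKr (bigD1 i)//= (bigD1 j)//=.
  rewrite -addrA lerDl addr_ge0//; first by apply: sumr_ge0 => l _; exact: normc_ge0.
  by apply: sumr_ge0 => l _; apply: sumr_ge0 => m _; exact: normc_ge0.
exists ((n`!)%:R * L ^+ n / c).
  by rewrite divr_gt0// mulr_gt0 ?ltr0n ?fact_gt0// exprn_gt0//; lra.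
move=> j k z z0; have nz := normc_ge0 z.
have PB i l : normc (pencil a b n z i l) <= L * (1 + normc z).
  rewrite /pencil mxE [X in _ + X]mxE [X in X + _]mxE; apply: le_trans (normcB _ _) _.
  apply: (@le_trans _ _ (normc z + (L - 1))); last nra.
  rewrite lerD//; case: (i == l); rewrite ?mulr1n// mulr0n.
  by rewrite (eqP (_ : normc 0 == 0)) ?normc_eq0.
have h1 : 0 < 1 + normc z by lra.
have d0 := char_dissipative_neq0 z0.
rewrite [S z j k]mxE -adj_pencil Normc.normcM Normc.normcV.
apply: (@le_trans _ _ ((n`!)%:R * (L * (1 + normc z)) ^+ n / (c * (1 + normc z) ^+ n.+1))).
  apply: ler_pM; rewrite ?invr_ge0 ?normc_ge0//; first exact: normc_adj_le.
  by rewrite lef_pV2 ?cP// posrE ?normc_gt0// mulr_gt0// exprn_gt0.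
rewrite exprMn exprS; set X := (1 + normc z) ^+ n; have X0 : X != 0 by rewrite expf_neq0// gt_eqF.
rewrite le_eqVlt; apply/orP; left; apply/eqP; field.
by rewrite X0 !gt_eqF.
Qed.

Lemma resolvent_shift z j k : 0 <= complex.Im z ->
  (z + I1) * S z j k = (j == k)%:R + \sum_l (B j l + I1 *+ (j == l)) * S z l k.
Proof.
move=> z0; have := congr1 (fun M : 'M[C]_n.+1 => M j k) (resolvent_mul b ha z0).
rewrite /pencil mulmxBl mul_scalar_mx [LHS]mxE [X in X + _ = _]mxE [X in _ + X = _]mxE.
have -> : (B *m S z) j k = \sum_l B j l * S z l k by rewrite mxE.
rewrite [X in _ = X -> _]mxE => <-.
under [X in _ = _ + X]eq_bigr do rewrite mulrDl.
rewrite big_split /= [X in _ = _ + (_ + X)](bigD1 j)//= [X in _ = _ + (_ + (_ + X))]big1 ?addr0.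
  by rewrite eqxx mulr1n mulrDl addrA addrNK.
by move=> l lj; rewrite eq_sym (negbTE lj) mulr0n mul0r.
Qed.

Lemma shift_lower : exists2 c : R, 0 < c & forall z : C, 0 <= complex.Im z ->
  c * (1 + normc z) <= normc (z + I1).
Proof.
have [|c c0 cP] := @linear_lower R (- I1); first by rewrite cImN /= ltrN10.
by exists c => // z z0; have := cP z z0; rewrite opprK.
Qed.

(** The leading term at infinity is removed with a pole at - i, outside the
    closed upper half-plane. *)
Definition resolvent_tail j k (z : C) : C := S z j k - (j == k)%:R / (z + I1).

Lemma shift_neq0 z : 0 <= complex.Im z -> z + I1 != 0.
Proof.
by case: z => x y /= y0; rewrite eq_complex /= negb_and; apply/orP; right; rewrite gt_eqF//; lra.
Qed.

Lemma resolvent_tail_cdiff j k z : 0 <= complex.Im z -> exists d, cdiff (resolvent_tail j k) z d.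
Proof.
move=> z0; have [d dP] := resolvent_cdiff j k z0.
have H := cdiffD (cdiff_id z) (cdiff_cst I1 z).
have [e eP] := cdiff_div (cdiff_cst ((j == k)%:R : C) z) H (shift_neq0 z0).
by exists (d - e); exact: cdiffB.
Qed.

Lemma resolvent_tail_bound j k : exists K : R, forall z, 0 <= complex.Im z ->
  normc (resolvent_tail j k z) <= K / (1 + normc z) ^+ 2.
Proof.
have [K K0 KP] := resolvent_bound; have [c c0 cP] := shift_lower.
pose L := \sum_l normc (B j l + I1 *+ (j == l)).
exists (L * K / c) => z z0; have h1 : 0 < 1 + normc z by rewrite ltr_pwDl// normc_ge0.
have zi := shift_neq0 z0; have cz := cP z z0.
have -> : resolvent_tail j k z = (\sum_l (B j l + I1 *+ (j == l)) * S z l k) / (z + I1).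
  apply: (mulIf zi); rewrite mulrBl !divfK// mulrC resolvent_shift//.
  by rewrite addrC addKr.
rewrite Normc.normcM Normc.normcV.
apply: (@le_trans _ _ ((L * (K / (1 + normc z))) / (c * (1 + normc z)))).
  apply: ler_pM; rewrite ?invr_ge0 ?normc_ge0//.
    apply: le_trans (normc_sum _ _ _) _; rewrite mulr_suml; apply: ler_sum => l _.
    by rewrite Normc.normcM ler_wpM2l ?normc_ge0// KP.
  by rewrite lef_pV2 ?posrE ?normc_gt0// mulr_gt0.
rewrite le_eqVlt; apply/orP; left; apply/eqP; field.
by rewrite !gt_eqF.
Qed.

Definition spectral_density j k (x : R) : R :=
  (phi a b j.+1).[x] * (phi a b k.+1).[x] / normc (E x%:C) ^+ 2.

Lemma resolvent_tail_Im (j k : 'I_n.+1) x : complex.Im (resolvent_tail j k (x +i* 0)) =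
  (j == k)%:R * cauchy_weight x - spectral_density j k x.
Proof.
rewrite /resolvent_tail cImB -[x +i* 0]/(x%:C) resolvent_Im// -/(spectral_density j k x).
rewrite addrC; congr (_ - _).
case: (j == k); last by rewrite !mul0r /= oppr0.
have -> : 1%:R / (x%:C + I1) = (x * cauchy_weight x) +i* (- cauchy_weight x).
  have x1 : 1 + x ^+ 2 != 0 by rewrite gt_eqF// ltr_pwDl// sqr_ge0.
  have zi : x%:C + I1 != 0 by exact: shift_neq0.
  apply: (mulIf zi); rewrite divfK//; apply: complex_eqP; rewrite /cauchy_weight /=; field; exact: x1.
by rewrite /= opprK mul1r.
Qed.

(** The imaginary part of the tail, whose integral vanishes, is
    delta_jk / (1 + x^2) minus the density. *)
Lemma integral_spectral_density (j k : 'I_n.+1) :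
  mu.-integrable setT (EFin \o spectral_density j k) /\
  \int[mu]_x spectral_density j k x = pi * (j == k)%:R.
Proof.
have [K KP] := resolvent_tail_bound j k.
have qc z : 0 <= complex.Im z -> exists d, cdiff (resolvent_tail j k) z d.
  exact: resolvent_tail_cdiff.
pose f x := complex.Im (resolvent_tail j k (x +i* 0)).
have fc : continuous f.
  by have [|_] := @line_cont R (resolvent_tail j k) 0; first by move=> x; exact: qc.
have K0 : 0 <= K.
  have := KP 0 (lexx _); rewrite normc_real normr0 addr0 expr1n divr1.
  exact: le_trans (normc_ge0 _).
have fi : mu.-integrable setT (EFin \o f).
  apply: (dominated_integrable (K := K)) => // x; apply: le_trans (normc_Im _) _.
  apply: le_trans (KP _ _) _ => //; apply: ler_wpM2l => //; exact: normc_cauchy_weight.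
have wi := integrable_cauchy_weight ((j == k)%:R : R).
have dE x : spectral_density j k x = (j == k)%:R * cauchy_weight x + (-1) * f x.
  by rewrite /f resolvent_tail_Im; ring.
have fi' := integrableZ measurableT (-1) fi.
have -> : spectral_density j k = (fun x => (j == k)%:R * cauchy_weight x + (-1) * f x).
  by apply/funext => x; exact: dE.
split; first exact: integrableDr.
have f0 : \int[mu]_x f x = 0 := half_plane_integral qc KP.
rewrite RintegralD// [X in _ + X]RintegralZl// f0 mulr0 addr0.
rewrite RintegralZl//; last first.
  have := integrable_cauchy_weight (1 : R).
  by congr (_.-integrable _ _); apply/funext => x /=; rewrite mul1r.
by rewrite /Rintegral integral_cauchy_weight mulrC.
Qed.

Lemma deBranges_inner_fourier (c d : 'cV[C]_n.+1) :
  deBranges_inner E (fourier a b c) (fourier a b d) = state_inner c d.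
Proof.
pose g j k (x : R) : C := (spectral_density j k x)%:C.
have gi (j k : 'I_n.+1) : cintegrable setT (g j k).
  split; first exact: (integral_spectral_density j k).1.
  by rewrite /g; exact: integrable0.
have gE (j k : 'I_n.+1) : cintegral setT (g j k) = (pi * (j == k)%:R)%:C.
  apply: complex_eqP => /=; first exact: (integral_spectral_density j k).2.
  by rewrite Rintegral_cst// mul0r.
rewrite /deBranges_inner.
have -> : cintegral setT (fun x => fourier a b c x%:C * (fourier a b d x%:C)^* /
      (normc (E x%:C) ^+ 2)%:C) =
    cintegral setT (fun x => \sum_(j < n.+1) \sum_(k < n.+1) (c j 0 * (d k 0)^*) * g j k x).
  congr cintegral; apply/funext => x.
  rewrite /fourier rmorph_sum mulr_suml mulr_suml; apply: eq_bigr => j _.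
  rewrite mulr_sumr mulr_suml; apply: eq_bigr => k _.
  rewrite !phiC_real /g /spectral_density; move: (_.[x]) (_.[x]) (normc _ ^+ 2) => p q e.
  rewrite [in LHS]rmorphM /= conj_real [in RHS]rmorphM [in RHS]fmorphV [in RHS]rmorphM /=.
  by rewrite mulrACA !mulrA.
rewrite cintegral_sum//; last first.
  by move=> j; apply: cintegrable_sum => // k; exact: cintegrableZ.
rewrite mulr_sumr; apply: eq_bigr => j _.
rewrite cintegral_sum//; last by move=> k; exact: cintegrableZ.
rewrite (bigD1 j)//= big1 ?addr0 => [|k kj]; rewrite cintegralZ// gE.
  rewrite eqxx mulr1 mulrCA -rmorphM mulVf ?rmorph1 ?mulr1//.
  by rewrite gt_eqF// pi_gt0.
by rewrite eq_sym (negbTE kj) mulr0 mulr0.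
Qed.

End DeBrangesInner.
(** * The theorem *)

Theorem mainTheorem1 (R : realType) (N : nat) (a b : nat -> R) (T : R)
    (hN : (1 <= N)%N)
    (ha : forall n : nat, (1 <= n)%N -> (n < N)%N -> 0 < a n)
    (hT : 0 < T) :
  (exists E : R[i] -> R[i],
     [/\ hermite_biehler E,
         BN N a b T = deBranges E &
         forall H G : R[i] -> R[i], BN N a b T H -> BN N a b T G ->
           BN_inner N a b T H G = deBranges_inner E H G])
  /\
  (forall z : R[i],
     let is_jz (j : R -> R[i]) :=
       control_F1 N a b T j /\
       forall k : 'I_N, control_op N a b T j k 0 = (phiC a b k.+1 z)^* in
     [/\ exists j : R -> R[i], is_jz j,
         forall j j' : R -> R[i], is_jz j -> is_jz j' -> ae_eq_on T j j' &
         forall j : R -> R[i], is_jz j ->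
           forall G : R[i] -> R[i], BN N a b T G ->
             BN_inner N a b T G (fourier a b (control_op N a b T j)) = G z]).
Proof.
case: N hN ha => // n _ ha; have [lam [om spec]] := ex_spectral b ha.
split.
  exists (structure_fun a b n); split.
  - split=> [z _|z z0]; first exact/cdiffP/structure_fun_cdiff.
    exact: structure_fun_HB.
  - by rewrite (BN_fourier spec hT) (deBrangesE ha spec).
  - rewrite (BN_fourier spec hT) => _ _ [c _ <-] [d _ <-].
    by rewrite (BN_inner_fourier spec hT) deBranges_inner_fourier.
move=> z is_jz; split.
- have [j [Fj jE]] := control_F1_reach spec hT (\col_k (phiC a b k.+1 z)^*).
  by exists j; split=> // k; rewrite jE mxE.
- move=> j j' [Fj jE] [Fj' jE']; apply: (control_F1_unique spec hT Fj Fj').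
  by apply/colP => k; rewrite jE jE'.
- move=> j [Fj jE] G; rewrite (BN_fourier spec hT) => -[c _ <-].
  by rewrite (BN_inner_fourier spec hT) (fourier_reproducing _ jE).
Qed.
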